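(* Let $\varphi$ be a crystalline anisotropy on $\mathbb{R}^2$, let $\alpha>0$, and let $\Gamma^0=\bigcup_{i=1}^n S_i^0$ be an admissible (closed or unbounded) polygonal curve. Then: (a) there exist a maximal time $T^\dagger\in(0,+\infty]$ and a unique crystalline elastic flow $\{\Gamma(t)\}_{t\in[0,T^\dagger)}$ starting from $\Gamma^0$; (b) $t\mapsto\Gamma(t)$ has the semigroup property: for any $t,s\ge 0$ with $t+s<T^\dagger$, $\Gamma(t+s;\Gamma^0)=\Gamma(t;\Gamma(s;\Gamma^0))$, where $\Gamma(\cdot;\Sigma)$ denotes the crystalline elastic flow starting from $\Sigma$; (c) if $\Gamma^0$ is bounded (closed) and $T^\dagger<+\infty$, then $t\mapsto\Gamma(t)$ is Kuratowski continuous in $[0,T^\dagger]$ (where $\Gamma(T^\dagger)$ denotes the Kuratowski limit of $\Gamma(t)$ as $t\nearrow T^\dagger$, which in particular exists), the set $\bigcup_{t\in[0,T^\dagger]}\Gamma(t)$ is bounded, and there exists an index $i\in\{1,\dots,n\}$ with $c_i=0$ such that $\lim_{t\nearrow T^\dagger}\mathcal{H}^1(S_i(t))=0$. Thus, at the maximal time at least one segment with zero $\varphi$-curvature disappears. Moreover, the length of every segment with nonzero $\varphi$-curvature is bounded away from $0$ as $t\nearrow T^\dagger$.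
   Context: Anisotropy. An anisotropy is a convex, positively one-homogeneous function $\varphi:\mathbb{R}^2\to[0,\infty)$ with $c|x|\le\varphi(x)\le C|x|$ for some $0<c\le C<\infty$; $W^\varphi=\{\varphi\le1\}$ is its Wulff shape and $\varphi^o(x)=\max_{y\in W^\varphi}\langle x,y\rangle$ its dual. It is crystalline if $W^\varphi$ is a polygon, whose edges are called facets; $\partial W^\varphi$ is oriented so that the unit normal $\nu_F$ of each facet $F$ is outward. $\mathcal{H}^1$ is length. Polygonal curves. All curves are oriented and may self-intersect. A closed polygonal curve is a closed consecutive union $\Gamma=\bigcup_{i=1}^nS_i$ of finitely many segments of positive length, indices being cyclic ($S_0=S_n$, $S_{n+1}=S_1$, likewise for all indexed quantities). An unbounded polygonal curve is a consecutive union $\bigcup_{i=1}^n S_i$ with $S_1,S_n$ half-lines and $S_2,\dots,S_{n-1}$ bounded segments. Consecutive segments are not parallel. $\nu_{S_i}$ is the unit tangent (in the direction of the parametrization) rotated counterclockwise by $90^\circ$. The angle $\theta_i$ between $S_{i-1}$ and $S_i$ is taken in $(0,\pi)$ if $S_{i-1},S_i$ form a convex cone for which $\nu_{S_{i-1}},\nu_{S_i}$ are inner normals, and in $(\pi,2\pi)$ otherwise (for a convex polygon with outward normals, $\theta_i$ is $2\pi$ minus the interior angle). Admissibility. $\Gamma$ is admissible if (for a suitable orientation) each $\nu_{S_i}$ equals $\nu_{F_i}$ for a (unique) facet $F_i$ of $W^\varphi$, and for consecutive $S_{i-1},S_i$ the facets $F_{i-1},F_i$ have a common vertex. The transition number $c_i$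 of $S_i$ is $+1$ if $\theta_i,\theta_{i+1}\in(\pi,2\pi)$, $-1$ if $\theta_i,\theta_{i+1}\in(0,\pi)$, and $0$ otherwise or if $S_i$ is a half-line. The $\varphi$-curvature on $S_i$ is $c_i\mathcal{H}^1(F_i)/\mathcal{H}^1(S_i)$ ($0$ on half-lines). Parallel curves and heights. $\bar\Gamma=\bigcup_{i=1}^n\bar S_i$ is parallel to $\Gamma=\bigcup_{i=1}^nS_i$ if each $\bar S_i$ is a nondegenerate segment (resp. half-line) parallel to the segment (resp. half-line) $S_i$ with $\nu_{\bar S_i}=\nu_{S_i}$, and for half-lines $S_i\Delta\bar S_i$ is bounded. For parallel segments $S,T$ on lines $\ell_S,\ell_T$, the distance vector $H(S,T)$ is the vector orthogonal to them with $\ell_T=\ell_S+H(S,T)$; the signed height from $S$ to $T$ is $\langle H(S,T),\nu_S\rangle$. Angles, normals, facets $F_i$ and $c_i$ are the same for parallel curves. Flow. Set $\delta_j=\mathcal{H}^1(F_j)^2\varphi^o(\nu_{S_j})$. A family $\{\Gamma(t)\}_{t\in[0,T)}$, $T\in(0,+\infty]$, is a crystalline elastic flow starting from $\Gamma^0=\bigcup_{i=1}^nS_i^0$ if $\Gamma(t)=\bigcup_{i=1}^nS_i(t)$ is parallel to $\Gamma^0$ for all $t$, and $h_i(t)=\langle H(S_i^0,S_i(t)),\nu_{S_i^0}\rangle$ belong to $C^0([0,T))\cap C^1(0,T)$, $h_i(0)=0$, and for each segment $S_i$ (for $i=2,\dots,n-1$ in the unbounded case, with $h_1=h_n\equiv0$)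 $$\frac{h_i'}{\varphi^o(\nu_{S_i})}=-\frac{c_i\mathcal{H}^1(F_i)}{\mathcal{H}^1(S_i)}-\frac{\alpha}{\mathcal{H}^1(S_i)}\Big(\frac{c_{i-1}^2\delta_{i-1}}{\mathcal{H}^1(S_{i-1})^2\sin\theta_i}+\frac{c_i^2\delta_i[\cot\theta_i+\cot\theta_{i+1}]}{\mathcal{H}^1(S_i)^2}+\frac{c_{i+1}^2\delta_{i+1}}{\mathcal{H}^1(S_{i+1})^2\sin\theta_{i+1}}\Big)$$ in $(0,T)$, where $S_j=S_j(t)$ and terms with $c_j=0$ are $0$. Kuratowski continuity/convergence refers to Kuratowski convergence of closed subsets of $\mathbb{R}^2$. *)

(* Defs.v *)
From Stdlib Require Import Reals List Arith Lra Lia.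
From Coquelicot Require Import Coquelicot.
Open Scope R_scope.

(* Real analysis is that of Stdlib and Coquelicot.  The plane is [R * R] with
   Coquelicot's product structure, whose [norm] is the Euclidean norm. *)
Notation pt := (R * R)%type.

Definition dot (x y : pt) : R := fst x * fst y + snd x * snd y.
Definition cross (x y : pt) : R := fst x * snd y - snd x * fst y.
(* Counterclockwise rotation by 90 degrees. *)
Definition rot90 (x : pt) : pt := (- snd x, fst x).

Definition bounded_set (A : pt -> Prop) : Prop :=
  exists M : R, forall x, A x -> norm x <= M.

(** Oriented segments and half-lines *)

(* [Seg a b] runs from [a] to [b]; [RayIn d b] is the half-line that arrives at
   [b] in the direction [d]; [RayOut a d] leaves [a] in the direction [d]. *)
Inductive edge : Type :=
| Seg (a b : pt)
| RayIn (d b : pt)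
| RayOut (a d : pt).

Definition is_seg (S : edge) : Prop :=
  match S with Seg _ _ => True | _ => False end.

Definition tangent (S : edge) : pt :=
  match S with
  | Seg a b => scal (/ norm (minus b a)) (minus b a)
  | RayIn d _ => d
  | RayOut _ d => d
  end.

Definition normal (S : edge) : pt := rot90 (tangent S).

(* One-dimensional Hausdorff measure. *)
Definition H1 (S : edge) : Rbar :=
  match S with Seg a b => Finite (norm (minus b a)) | _ => p_infty end.

Definition in_edge (S : edge) (x : pt) : Prop :=
  match S with
  | Seg a b => exists s, 0 <= s <= 1 /\ x = plus a (scal s (minus b a))
  | RayIn d b => exists s, 0 <= s /\ x = minus b (scal s d)
  | RayOut a d => exists s, 0 <= s /\ x = plus a (scal s d)
  end.

Definition endpoint (S : edge) (x : pt) : Prop :=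
  match S with
  | Seg a b => x = a \/ x = b
  | RayIn _ b => x = b
  | RayOut a _ => x = a
  end.

Definition nondegenerate (S : edge) : Prop :=
  match S with
  | Seg a b => a <> b
  | RayIn d _ => norm d = 1
  | RayOut _ d => norm d = 1
  end.

Definition base (S : edge) : pt :=
  match S with Seg a _ => a | RayIn _ b => b | RayOut a _ => a end.

Definition line (S : edge) (x : pt) : Prop :=
  exists s : R, x = plus (base S) (scal s (tangent S)).

(* The distance vector H(S,T) of parallel S, T; see [dist_vec_spec]. *)
Definition dist_vec (S T : edge) : pt :=
  scal (dot (minus (base T) (base S)) (normal S)) (normal S).

Lemma norm_plane (x : pt) : norm x = sqrt (fst x ^ 2 + snd x ^ 2).
Proof.
  destruct x as [a b].
  change (sqrt (Rabs a ^ 2 + Rabs b ^ 2) = sqrt (a ^ 2 + b ^ 2)).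
  now rewrite !pow2_abs.
Qed.

Lemma dist_vec_spec (S T : edge) :
  norm (tangent S) = 1 -> normal T = normal S ->
  dot (dist_vec S T) (tangent S) = 0 /\
  (forall x, line T x <-> line S (minus x (dist_vec S T))).
Proof.
  unfold line, dist_vec, normal; intros Hn HT.
  destruct (tangent S) as [u v] eqn:HS; destruct (tangent T) as [u' v'].
  destruct (base S) as [a b]; destruct (base T) as [a' b'].
  injection HT as Hv Hu.
  assert (u' = u) by lra; assert (v' = v) by lra; subst u' v'.
  rewrite norm_plane in Hn; cbn [fst snd] in Hn.
  assert (Hq : u * u + v * v = 1).
  { replace (u * u + v * v) with (u ^ 2 + v ^ 2) by ring.
    rewrite <- (sqrt_sqrt (u ^ 2 + v ^ 2)), Hn by nra; ring. }
  unfold dot, rot90, minus, plus, opp, scal; simpl.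
  unfold prod_plus, prod_opp, prod_scal, plus, opp, scal; simpl; unfold mult; simpl.
  set (k := (a' + - a) * - v + (b' + - b) * u).
  split; [ring|].
  assert (E1 : a' - a = k * - v + ((a' - a) * u + (b' - b) * v) * u).
  { unfold k; transitivity ((a' - a) * (u * u + v * v)); [rewrite Hq|]; ring. }
  assert (E2 : b' - b = k * u + ((a' - a) * u + (b' - b) * v) * v).
  { unfold k; transitivity ((b' - b) * (u * u + v * v)); [rewrite Hq|]; ring. }
  set (m := (a' - a) * u + (b' - b) * v) in *; clearbody k m.
  intros [x y]; simpl; split; intros [s Hs]; injection Hs as Hx Hy.
  - exists (s + m); f_equal; nra.
  - exists (s - m); f_equal; nra.
Qed.

Definition height (S T : edge) : R := dot (dist_vec S T) (normal S).

(* The symmetric difference condition forces parallel half-lines onto the same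
   line.  Equality of the normals contains parallelism. *)
Definition parallel_edge (S T : edge) : Prop :=
  nondegenerate T /\ normal T = normal S /\
  match S, T with
  | Seg _ _, Seg _ _ => True
  | RayIn _ _, RayIn _ _ | RayOut _ _, RayOut _ _ =>
      bounded_set (fun x => (in_edge S x /\ ~ in_edge T x) \/
                            (in_edge T x /\ ~ in_edge S x))
  | _, _ => False
  end.

(* Angle between consecutive [S], [T].  They bound the convex cone spanned by
   [- tangent S] and [tangent T], of opening [acos (- dot _ _)]; the test says
   that each ray lies on the side to which the normal of the other one points,
   i.e. that the normals are inner. *)
Definition angle (S T : edge) : R :=
  let opening := acos (- dot (tangent S) (tangent T)) in
  if Rlt_dec 0 (dot (normal S) (tangent T)) then
    if Rlt_dec 0 (dot (normal T) (opp (tangent S))) then opening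
    else 2 * PI - opening
  else 2 * PI - opening.

(** Anisotropies *)

Definition Wulff (phi : pt -> R) (x : pt) : Prop := phi x <= 1.

Definition anisotropy (phi : pt -> R) : Prop :=
  (forall x, 0 <= phi x) /\
  (forall x y s, 0 <= s <= 1 ->
     phi (plus (scal s x) (scal (1 - s) y)) <= s * phi x + (1 - s) * phi y) /\
  (forall x s, 0 <= s -> phi (scal s x) = s * phi x) /\
  (exists c C : R, 0 < c <= C /\
     forall x, c * norm x <= phi x <= C * norm x).

Definition dual (phi : pt -> R) (x : pt) : R :=
  real (Lub_Rbar (fun r => exists y, Wulff phi y /\ r = dot x y)).

Definition convex_set (A : pt -> Prop) : Prop :=
  forall x y s, A x -> A y -> 0 <= s <= 1 ->
    A (plus (scal s x) (scal (1 - s) y)).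

Definition convex_hull (l : list pt) (x : pt) : Prop :=
  forall A, convex_set A -> (forall v, In v l -> A v) -> A x.

(* Wulff shapes of anisotropies are convex with nonempty interior, so "polygon"
   means the convex hull of finitely many points. *)
Definition crystalline (phi : pt -> R) : Prop :=
  anisotropy phi /\
  exists l : list pt, forall x, Wulff phi x <-> convex_hull l x.

(* An edge of the Wulff shape: a face that is a nondegenerate segment, oriented
   so that its normal is outward. *)
Definition facet (phi : pt -> R) (F : edge) : Prop :=
  is_seg F /\ nondegenerate F /\
  (forall x, Wulff phi x -> dot x (normal F) <= dot (base F) (normal F)) /\
  (forall x, in_edge F x <->
     Wulff phi x /\ dot x (normal F) = dot (base F) (normal F)).

(** Polygonal curves *)

(* [Closed [p_0; ...; p_(n-1)]] has the segments S_i = [p_i, p_(i+1)], indices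
   modulo n.  [Unbounded d [p_0; ...; p_(n-2)] e] has the half-lines
   S_0 = RayIn d p_0, S_(n-1) = RayOut p_(n-2) e and the segments
   S_i = [p_(i-1), p_i] in between.  Indices start at 0. *)
Inductive curve : Type :=
| Closed (p : list pt)
| Unbounded (d : pt) (p : list pt) (e : pt).

Definition is_closed (G : curve) : Prop :=
  match G with Closed _ => True | _ => False end.

Definition nb_edges (G : curve) : nat :=
  match G with Closed p => length p | Unbounded _ p _ => S (length p) end.

Definition next (G : curve) (i : nat) : nat := (i + 1) mod nb_edges G.
Definition prev (G : curve) (i : nat) : nat := (i + (nb_edges G - 1)) mod nb_edges G.

Definition edge_of (G : curve) (i : nat) : edge :=
  match G with
  | Closed p => Seg (nth i p zero) (nth (next G i) p zero)
  | Unbounded d p e =>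
      if i =? 0 then RayIn d (nth 0 p zero)
      else if i =? length p then RayOut (nth (length p - 1) p zero) e
      else Seg (nth (i - 1) p zero) (nth i p zero)
  end.

(* [S_(prev i)] and [S_i] are consecutive. *)
Definition joint (G : curve) (i : nat) : Prop :=
  (i < nb_edges G)%nat /\ (is_closed G \/ (0 < i)%nat).

Definition support (G : curve) (x : pt) : Prop :=
  exists i, (i < nb_edges G)%nat /\ in_edge (edge_of G i) x.

Definition polygonal (G : curve) : Prop :=
  match G with Closed p => p <> nil | Unbounded _ p _ => p <> nil end /\
  (forall i, (i < nb_edges G)%nat -> nondegenerate (edge_of G i)) /\
  (forall i, joint G i ->
     cross (tangent (edge_of G (prev G i))) (tangent (edge_of G i)) <> 0).

(* [theta G i] is the angle at the joint of S_(i-1) and S_i. *)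
Definition theta (G : curve) (i : nat) : R :=
  angle (edge_of G (prev G i)) (edge_of G i).

Definition transition (G : curve) (i : nat) : R :=
  match edge_of G i with
  | Seg _ _ =>
      if Rlt_dec PI (theta G i) then
        if Rlt_dec PI (theta G (next G i)) then 1 else 0
      else
        if Rlt_dec (theta G (next G i)) PI then -1 else 0
  | _ => 0
  end.

(* [F i] is the facet of the Wulff shape associated with S_i. *)
Definition facets_of (phi : pt -> R) (G : curve) (F : nat -> edge) : Prop :=
  (forall i, (i < nb_edges G)%nat ->
     facet phi (F i) /\ normal (edge_of G i) = normal (F i)) /\
  (forall i, joint G i ->
     exists v, endpoint (F (prev G i)) v /\ endpoint (F i) v).

(* Curves are oriented; an admissible one carries the orientation for which its
   normals are normals of facets. *)
Definition admissible (phi : pt -> R) (G : curve) : Prop :=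
  polygonal G /\ exists F, facets_of phi G F.

Definition parallel (G G' : curve) : Prop :=
  polygonal G' /\ (is_closed G <-> is_closed G') /\
  nb_edges G' = nb_edges G /\
  forall i, (i < nb_edges G)%nat -> parallel_edge (edge_of G i) (edge_of G' i).

(** Crystalline elastic flow *)

Definition delta (phi : pt -> R) (F : nat -> edge) (G : curve) (j : nat) : R :=
  (real (H1 (F j)))^2 * dual phi (normal (edge_of G j)).

Definition cot (x : R) : R := cos x / sin x.

(* [phi]-curvature of S_i; it is 0 when c_i = 0, in particular on half-lines,
   where [real (H1 _)] is the irrelevant value [real p_infty = 0].  The same
   applies to the terms of [elastic_term]. *)
Definition curvature (F : nat -> edge) (G : curve) (i : nat) : R :=
  transition G i * real (H1 (F i)) / real (H1 (edge_of G i)).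

Definition elastic_term (phi : pt -> R) (F : nat -> edge) (G : curve) (i : nat) : R :=
  let c := transition G in
  let len j := real (H1 (edge_of G j)) in
  let j := prev G i in
  let k := next G i in
  c j ^ 2 * delta phi F G j / (len j ^ 2 * sin (theta G i))
  + c i ^ 2 * delta phi F G i * (cot (theta G i) + cot (theta G k)) / len i ^ 2
  + c k ^ 2 * delta phi F G k / (len k ^ 2 * sin (theta G k)).

(* Only the values [G t] for 0 <= t < T matter. *)
Definition elastic_flow (phi : pt -> R) (alpha : R) (G0 : curve)
    (T : Rbar) (G : R -> curve) : Prop :=
  Rbar_lt 0 T /\
  (forall t, 0 <= t -> Rbar_lt t T -> parallel G0 (G t)) /\
  exists F, facets_of phi G0 F /\
  forall i, (i < nb_edges G0)%nat ->
    let h t := height (edge_of G0 i) (edge_of (G t) i) in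
    continuous_on (fun t => 0 <= t /\ Rbar_lt t T) h /\
    (forall t, 0 < t -> Rbar_lt t T ->
       ex_derive h t /\ continuous (Derive h) t) /\
    h 0 = 0 /\
    (is_seg (edge_of G0 i) ->
     forall t, 0 < t -> Rbar_lt t T ->
       Derive h t / dual phi (normal (edge_of (G t) i)) =
       - curvature F (G t) i
       - alpha / real (H1 (edge_of (G t) i)) * elastic_term phi F (G t) i) /\
    (~ is_seg (edge_of G0 i) ->
     forall t, 0 <= t -> Rbar_lt t T -> h t = 0).

(* The flow on its maximal interval: every other flow with the same initial
   curve is a restriction of it. *)
Definition maximal_flow (phi : pt -> R) (alpha : R) (G0 : curve)
    (T : Rbar) (G : R -> curve) : Prop :=
  elastic_flow phi alpha G0 T G /\
  forall T' G', elastic_flow phi alpha G0 T' G' ->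
    Rbar_le T' T /\
    forall t, 0 <= t -> Rbar_lt t T' -> G' t = G t.

(** Kuratowski convergence *)

Definition lower_limit (Fl : (R -> Prop) -> Prop) (A : R -> pt -> Prop) (x : pt) : Prop :=
  forall eps, 0 < eps ->
    Fl (fun t => exists y, A t y /\ norm (minus y x) < eps).

Definition upper_limit (Fl : (R -> Prop) -> Prop) (A : R -> pt -> Prop) (x : pt) : Prop :=
  forall eps, 0 < eps ->
    ~ Fl (fun t => ~ exists y, A t y /\ norm (minus y x) < eps).

Definition kuratowski_cvg (Fl : (R -> Prop) -> Prop) (A : R -> pt -> Prop)
    (K : pt -> Prop) : Prop :=
  (forall x, lower_limit Fl A x <-> K x) /\
  (forall x, upper_limit Fl A x <-> K x).

Definition kuratowski_continuous_on (D : R -> Prop) (A : R -> pt -> Prop) : Prop :=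
  forall t, D t -> kuratowski_cvg (within D (locally t)) A (A t).

(* [t |-> G t] as sets on [0, T], with the value [K] at [T]. *)
Definition extended (G : R -> curve) (T : R) (K : pt -> Prop) (t : R) : pt -> Prop :=
  if Rlt_dec t T then support (G t) else K.

(* Main.v *)
Require Import Defs.
From Stdlib Require Import Reals List Arith Lra Lia Psatz ClassicalEpsilon.
From Coquelicot Require Import Coquelicot.
Open Scope R_scope.

(** A curve parallel to [G0] is determined by the levels of its edges, i.e. by the inner products of
    their points with the normals, and its lengths are [L = - A sigma] for a matrix [A] with entries
    in the cotangents and inverse sines of the angles, which is symmetric for closed curves.  The flow
    is therefore an ODE for the levels, locally Lipschitz where the lengths are positive.  Truncating
    the lengths from below makes the field bounded and Lipschitz; the maximal flow is the union of
    the local ones.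

    For closed curves, [- (A phi°)_i = c_i H1(F_i)] makes the energy
    [sum phi°(nu_i) L_i + alpha sum c_i^2 delta_i / L_i] nonincreasing, so that lengths are bounded
    and edges with [c_i <> 0] do not shrink to a point.  The speed of an edge with [c_i = 0] can blow
    up, but such an edge has neighbours with the same normal and moves so as to equalize
    their lengths.  Hence [1/2 sum u_j u_k |L_j - L_k| - (n + 1) sum u_j L_j], with [u = c^2],
    decreases at least at the speed of that edge, up to bounded terms.  This potential is bounded
    below, so all levels have finite variation and converge at the maximal time.  If all limit
    lengths were positive, the truncated equation would continue the flow. *)

(** * Finite sums *)

(** The bracket in the flow law is the length matrix applied to the weights w_j = c_j^2 delta_j /
    L_j^2, so the law is a weighted gradient flow, with dissipation sum v_i^2 L_i / phi°(nu_i). This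
    rate controls no speed where L_i tends to 0; hence the second functional. Let c_i = 0, with
    neighbours p, q and turn D. Then v_i = - k (w_p - w_q) / D with k > 0 of order 1 / L_i, and the
    edge adds k (w_p - w_q) (g_p - g_q) / D^2 to the time derivative of a function of the lengths
    with gradient g. If both neighbours are curved, w decreases in L with the same constant for p
    and q, so g_p - g_q has to dominate the sign of L_p - L_q. Summing over neighbouring pairs only
    could mix opposite signs; the sum over all pairs has a gradient ordered like the lengths. If
    only one neighbour is curved, its gradient has to be at most -1: the factor n + 1 outweighs at
    most n sign terms. Finally |D| <= 1 makes the gain at least |v_i|. The absolute value is
    smoothed to be differentiated; the error is of order e / L_i and vanishes as e tends to 0 on
    each compact time interval. *)

Fixpoint rsum (n : nat) (f : nat -> R) : R :=
  match n with O => 0 | S k => rsum k f + f k end.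

Lemma rsum_ext n f g : (forall i, (i < n)%nat -> f i = g i) -> rsum n f = rsum n g.
Proof.
  induction n as [|n IH]; intros H; simpl; [easy|].
  rewrite IH by (intros; apply H; lia); rewrite H by lia; easy.
Qed.

Lemma rsum_plus n f g : rsum n (fun i => f i + g i) = rsum n f + rsum n g.
Proof. induction n as [|n IH]; simpl; [lra|rewrite IH; lra]. Qed.

Lemma rsum_scal n c f : rsum n (fun i => c * f i) = c * rsum n f.
Proof. induction n as [|n IH]; simpl; [lra|rewrite IH; lra]. Qed.

Lemma rsum_const n c : rsum n (fun _ => c) = INR n * c.
Proof. induction n as [|n IH]; [simpl; lra|]. rewrite S_INR; simpl; rewrite IH; lra. Qed.

Lemma rsum_le n f g : (forall i, (i < n)%nat -> f i <= g i) -> rsum n f <= rsum n g.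
Proof.
  induction n as [|n IH]; intros H; simpl; [lra|].
  apply Rplus_le_compat; [apply IH; intros; apply H; lia|apply H; lia].
Qed.

Lemma rsum_nonneg n f : (forall i, (i < n)%nat -> 0 <= f i) -> 0 <= rsum n f.
Proof.
  intros H; replace 0 with (rsum n (fun _ => 0)) by (rewrite rsum_const; ring).
  now apply rsum_le.
Qed.

Lemma rsum_le_const n f c : (forall i, (i < n)%nat -> f i <= c) -> rsum n f <= INR n * c.
Proof. intros H; rewrite <- rsum_const; now apply rsum_le. Qed.

Lemma rsum_term n f i :
  (forall j, (j < n)%nat -> 0 <= f j) -> (i < n)%nat -> f i <= rsum n f.
Proof.
  induction n as [|n IH]; intros H Hi; [lia|]; simpl.
  assert (0 <= f n) by (apply H; lia).
  destruct (Nat.eq_dec i n) as [->|Hn].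
  - assert (0 <= rsum n f) by (apply rsum_nonneg; intros; apply H; lia); lra.
  - assert (f i <= rsum n f) by (apply IH; [intros; apply H; lia|lia]); lra.
Qed.

Lemma rsum_abs n f : Rabs (rsum n f) <= rsum n (fun i => Rabs (f i)).
Proof.
  induction n as [|n IH]; simpl; [rewrite Rabs_R0; lra|].
  eapply Rle_trans; [apply Rabs_triang|lra].
Qed.

Lemma rsum_shift n f : rsum (S n) f = f 0%nat + rsum n (fun i => f (S i)).
Proof. induction n as [|n IH]; [simpl; lra|]. cbn [rsum] in *; rewrite IH; lra. Qed.

Lemma rsum_cyclic n f : rsum n (fun i => f ((i + 1) mod n)%nat) = rsum n f.
Proof.
  destruct n as [|n]; [easy|].
  rewrite (rsum_shift n f); cbn [rsum].
  rewrite (rsum_ext n _ (fun i => f (S i))).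
  - replace (n + 1)%nat with (S n) by lia; rewrite Nat.Div0.mod_same; lra.
  - intros i Hi; rewrite Nat.mod_small by lia; f_equal; lia.
Qed.

Lemma is_derive_rsum n (f : nat -> R -> R) (df : nat -> R) t :
  (forall i, (i < n)%nat -> is_derive (f i) t (df i)) ->
  is_derive (fun s => rsum n (fun i => f i s)) t (rsum n df).
Proof.
  induction n as [|n IH]; intros H; simpl; [apply (is_derive_const (V := R_NormedModule))|].
  apply (is_derive_plus (V := R_NormedModule)); [apply IH; intros; apply H; lia|apply H; lia].
Qed.

Lemma continuous_rsum n (f : nat -> R -> R) t :
  (forall i, (i < n)%nat -> continuous (f i) t) ->
  continuous (fun s => rsum n (fun i => f i s)) t.
Proof.
  induction n as [|n IH]; intros H; simpl; [apply continuous_const|].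
  apply (continuous_plus (V := R_NormedModule)); [apply IH; intros; apply H; lia|apply H; lia].
Qed.

(** * Differential inequalities *)

Lemma derive_le (f f' : R -> R) (a b C : R) :
  a <= b ->
  (forall t, a <= t <= b -> continuous f t) ->
  (forall t, a < t < b -> is_derive f t (f' t) /\ f' t <= C) ->
  f b - f a <= C * (b - a).
Proof.
  intros Hab Hc Hd.
  set (df := fun t => if Rlt_dec a t then if Rlt_dec t b then f' t else C else C).
  destruct (MVT_gen f a b df) as (c & _ & Hc').
  - intros t; rewrite Rmin_left, Rmax_right by easy; intros Ht; unfold df.
    destruct (Rlt_dec a t); [|lra]; destruct (Rlt_dec t b); [|lra].
    now apply Hd.
  - intros t; rewrite Rmin_left, Rmax_right by easy; intros Ht.
    apply continuity_pt_filterlim; now apply Hc.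
  - rewrite Hc'; apply Rmult_le_compat_r; [lra|]; unfold df.
    destruct (Rlt_dec a c); [|lra]; destruct (Rlt_dec c b); [|lra].
    now apply Hd.
Qed.

(** Here [g] is an antiderivative of the bound on the speed of [f], so time-dependent bounds are
    integrated without integrals. *)
Lemma derive_abs_le (f f' g g' : R -> R) (a b : R) :
  a <= b ->
  (forall t, a <= t <= b -> continuous f t /\ continuous g t) ->
  (forall t, a < t < b ->
     is_derive f t (f' t) /\ is_derive g t (g' t) /\ Rabs (f' t) <= g' t) ->
  Rabs (f b - f a) <= g b - g a.
Proof.
  intros Hab Hc Hd; apply Rabs_le; split.
  - assert (H : (- f b - g b) - (- f a - g a) <= 0 * (b - a)); [|lra].
    apply (derive_le (fun t => - f t - g t) (fun t => - f' t - g' t)); [easy| |].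
    + intros t Ht; destruct (Hc t Ht).
      apply (continuous_minus (V := R_NormedModule)); [|easy].
      now apply (continuous_opp (V := R_NormedModule)).
    + intros t Ht; destruct (Hd t Ht) as (H1 & H2 & H3); apply Rabs_le_between in H3.
      split; [|lra].
      apply (is_derive_minus (V := R_NormedModule)); [|easy].
      now apply (is_derive_opp (V := R_NormedModule)).
  - assert (H : (f b - g b) - (f a - g a) <= 0 * (b - a)); [|lra].
    apply (derive_le (fun t => f t - g t) (fun t => f' t - g' t)); [easy| |].
    + intros t Ht; destruct (Hc t Ht).
      now apply (continuous_minus (V := R_NormedModule)).
    + intros t Ht; destruct (Hd t Ht) as (H1 & H2 & H3); apply Rabs_le_between in H3.
      split; [|lra].
      now apply (is_derive_minus (V := R_NormedModule)).
Qed.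

(** The function [e t * exp (- C * t)] does not increase, starts at 0 and is nonnegative at [b]. *)
Lemma gronwall_zero (e e' : R -> R) (C b : R) :
  0 <= b -> e 0 = 0 -> 0 <= e b ->
  (forall t, 0 <= t <= b -> continuous e t) ->
  (forall t, 0 < t < b -> is_derive e t (e' t) /\ e' t <= C * e t) ->
  e b = 0.
Proof.
  intros Hb H0 Hp Hc Hd.
  assert (H : e b * exp (- C * b) - e 0 * exp (- C * 0) <= 0 * (b - 0)).
  { apply (derive_le (fun t => e t * exp (- C * t))
             (fun t => e' t * exp (- C * t) + e t * (- C * exp (- C * t)))); [easy| |].
    - intros t Ht; apply (continuous_mult (K := R_AbsRing)); [now apply Hc|].
      apply (ex_derive_continuous (V := R_NormedModule)); auto_derive; easy.
    - intros t Ht; destruct (Hd t Ht) as [H1 H2]; split.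
      + assert (H3 : is_derive (fun t => exp (- C * t)) t (- C * exp (- C * t)))
          by (auto_derive; [easy|ring]).
        exact (is_derive_mult (K := R_AbsRing) e _ t _ _ H1 H3 Rmult_comm).
      + assert (0 < exp (- C * t)) by apply exp_pos; nra. }
  assert (0 < exp (- C * b)) by apply exp_pos.
  rewrite H0 in H; nra.
Qed.

Definition lipschitz (g : R -> R) (L : R) : Prop :=
  forall s t, Rabs (g t - g s) <= L * Rabs (t - s).

Lemma lipschitz_continuous g L t : lipschitz g L -> continuous g t.
Proof.
  intros H; apply (proj1 (continuity_pt_filterlim g t)).
  intros eps Heps; exists (eps / (Rabs L + 1)).
  assert (0 <= Rabs L) by apply Rabs_pos.
  split; [apply Rdiv_lt_0_compat; lra|].
  intros s [_ Hs]; simpl in *; unfold Rdist in *.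
  assert (Hs' : Rabs (s - t) * (Rabs L + 1) < eps).
  { apply (Rmult_lt_compat_r (Rabs L + 1)) in Hs; [|lra].
    unfold Rdiv in Hs; rewrite Rmult_assoc, Rinv_l in Hs by lra; lra. }
  specialize (H t s); assert (L <= Rabs L) by apply Rle_abs.
  assert (0 <= Rabs (s - t)) by apply Rabs_pos; nra.
Qed.

Lemma derive_lipschitz (g g' : R -> R) (M : R) :
  (forall t, is_derive g t (g' t)) -> (forall t, Rabs (g' t) <= M) -> lipschitz g M.
Proof.
  intros Hd HM.
  assert (H : forall s t, s <= t -> Rabs (g t - g s) <= M * (t - s)).
  { intros s t Hst; replace (M * (t - s)) with (M * t - M * s) by ring.
    apply (derive_abs_le g g' (fun t => M * t) (fun _ => M)); [easy| |].
    - intros u _; split; apply (ex_derive_continuous (V := R_NormedModule));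
        [exists (g' u); apply Hd|auto_derive; easy].
    - intros u _; split; [|split]; [apply Hd|auto_derive; [easy|ring]|apply HM]. }
  intros s t; destruct (Rle_dec s t) as [Hst|Hst].
  - rewrite (Rabs_pos_eq (t - s)) by lra; now apply H.
  - rewrite (Rabs_minus_sym (g t)), (Rabs_minus_sym t), (Rabs_pos_eq (s - t)) by lra.
    apply H; lra.
Qed.

(** * Global existence for bounded Lipschitz vector fields *)

Section Picard.

Variable n : nat.
Variable f : (nat -> R) -> nat -> R.
Variables K M : R.
Hypothesis f_lip : forall x y i,
  Rabs (f x i - f y i) <= K * rsum n (fun j => Rabs (x j - y j)).
Hypothesis f_bound : forall x i, Rabs (f x i) <= M.
Variable x0 : nat -> R.

Fixpoint picard (k : nat) (t : R) (i : nat) : R :=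
  match k with
  | O => x0 i
  | S k => x0 i + RInt (fun s => f (picard k s) i) 0 t
  end.

Lemma field_diff_le d : 0 <= d ->
  forall x y i, (forall j, (j < n)%nat -> Rabs (x j - y j) <= d) ->
  Rabs (f x i - f y i) <= Rabs K * INR n * d.
Proof.
  intros Hd x y i H; eapply Rle_trans; [apply f_lip|].
  assert (H1 := rsum_le_const n _ d H).
  assert (0 <= rsum n (fun j => Rabs (x j - y j))) by (apply rsum_nonneg; intros; apply Rabs_pos).
  assert (K <= Rabs K) by apply Rle_abs; assert (0 <= Rabs K) by apply Rabs_pos; nra.
Qed.

Lemma field_lipschitz (x : R -> nat -> R) i :
  (forall j, lipschitz (fun t => x t j) M) ->
  lipschitz (fun t => f (x t) i) (Rabs K * INR n * M).
Proof.
  intros H s t; rewrite Rmult_assoc; apply field_diff_le.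
  - assert (0 <= M) by (eapply Rle_trans; [apply Rabs_pos|apply (f_bound (x s) i)]).
    assert (0 <= Rabs (t - s)) by apply Rabs_pos; nra.
  - intros j _; apply H.
Qed.

Lemma is_derive_primitive (a : R) (g : R -> R) L t :
  lipschitz g L -> is_derive (fun t => a + RInt g 0 t) t (g t).
Proof.
  intros H; rewrite <- (Rplus_0_l (g t)).
  apply (is_derive_plus (V := R_NormedModule) (fun _ => a) (fun t => RInt g 0 t) t 0 (g t));
    [apply (is_derive_const (V := R_NormedModule))|].
  apply (is_derive_RInt (V := R_NormedModule)) with (a := 0).
  - exists (mkposreal 1 Rlt_0_1); intros u _.
    apply (RInt_correct (V := R_CompleteNormedModule)), (ex_RInt_continuous (V := R_CompleteNormedModule)).
    intros z _; apply (lipschitz_continuous g L z H).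
  - apply (lipschitz_continuous g L t H).
Qed.

Lemma M_nonneg : 0 <= M.
Proof. eapply Rle_trans; [apply Rabs_pos|apply (f_bound x0 0%nat)]. Qed.

(** The two claims feed each other: a Lipschitz iterate makes the next integrand continuous, so the
    derivative formula holds, and the bound on the field then makes the next iterate Lipschitz with
    the same constant. *)
Lemma picard_step k i t :
  is_derive (fun s => picard (S k) s i) t (f (picard k t) i) /\
  lipschitz (fun s => picard k s i) M.
Proof.
  revert i t; induction k as [|k IH]; intros i t.
  - assert (HL : forall j, lipschitz (fun s => picard 0 s j) M).
    { intros j s u; simpl; rewrite Rminus_diag, Rabs_R0.
      assert (0 <= Rabs (u - s)) by apply Rabs_pos; assert (HM := M_nonneg); nra. }
    split; [|apply HL].
    apply (is_derive_primitive _ _ _ t (field_lipschitz (fun s => picard 0 s) i HL)).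
  - assert (HL : forall j, lipschitz (fun s => picard (S k) s j) M).
    { intros j; apply derive_lipschitz with (g' := fun t => f (picard k t) j).
      - intros u; apply (IH j u).
      - intros u; apply f_bound. }
    split; [|apply HL].
    apply (is_derive_primitive _ _ _ t (field_lipschitz (picard (S k)) i HL)).
Qed.

Lemma picard_0 k i : picard k 0 i = x0 i.
Proof. destruct k; simpl; [easy|]; rewrite RInt_point; unfold zero; simpl; ring. Qed.

Lemma picard_continuous k i t : continuous (fun s => picard k s i) t.
Proof. eapply lipschitz_continuous, picard_step; exact 0. Qed.

(* The exponential weight makes the Picard iteration contract by 1/2 at each step. *)
Let c := 2 * (Rabs K * INR n + 1).

Lemma c_ge : 1 <= c /\ Rabs K * INR n <= c / 2.
Proof.
  assert (0 <= Rabs K) by apply Rabs_pos; assert (0 <= INR n) by apply pos_INR.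
  unfold c; split; nra.
Qed.

Lemma picard_diff k i t : 0 <= t ->
  Rabs (picard (S k) t i - picard k t i) <= M * exp (c * t) * (/ 2) ^ k.
Proof.
  destruct c_ge as [Hc1 Hc2]; assert (HM := M_nonneg).
  revert i t; induction k as [|k IH]; intros i t Ht.
  - assert (H := proj2 (picard_step 1 i 0) 0 t); cbv beta in H.
    rewrite (picard_0 1) in H; rewrite Rminus_0_r, (Rabs_pos_eq t) in H by easy.
    change (picard 0 t i) with (x0 i).
    eapply Rle_trans; [apply H|].
    rewrite pow_O, Rmult_1_r; apply Rmult_le_compat_l; [easy|].
    assert (H1 := exp_ineq1_le (c * t)); nra.
  - assert (Hpk : 0 < (/ 2) ^ k) by (apply pow_lt; lra).
    (* The field multiplies the previous bound by at most c / 2, and (c / 2) M e^(c u) 2^(-k) is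
       exactly the derivative of M e^(c u) 2^(-k-1). *)
    assert (H : Rabs ((picard (S (S k)) t i - picard (S k) t i)
                      - (picard (S (S k)) 0 i - picard (S k) 0 i))
                <= M * exp (c * t) * (/ 2) ^ S k - M * exp (c * 0) * (/ 2) ^ S k).
    { apply (derive_abs_le (fun t => picard (S (S k)) t i - picard (S k) t i)
               (fun t => f (picard (S k) t) i - f (picard k t) i)
               (fun t => M * exp (c * t) * (/ 2) ^ S k)
               (fun t => M * (c * exp (c * t)) * (/ 2) ^ S k)); [easy| |].
      - intros u _; split.
        + apply (continuous_minus (V := R_NormedModule)); apply picard_continuous.
        + apply (ex_derive_continuous (V := R_NormedModule)); auto_derive; easy.
      - intros u Hu; split; [|split].
        + apply (is_derive_minus (V := R_NormedModule)); apply picard_step.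
        + auto_derive; [easy|simpl; ring].
        + eapply Rle_trans.
          * apply (field_diff_le (M * exp (c * u) * (/ 2) ^ k)).
            -- assert (0 < exp (c * u)) by apply exp_pos.
               apply Rmult_le_pos; [apply Rmult_le_pos|]; lra.
            -- intros j _; apply IH; lra.
          * assert (0 < exp (c * u)) by apply exp_pos.
            replace (M * (c * exp (c * u)) * (/ 2) ^ S k)
              with (c / 2 * (M * exp (c * u) * (/ 2) ^ k)) by (simpl; field).
            apply Rmult_le_compat_r; [|easy].
            apply Rmult_le_pos; [apply Rmult_le_pos|]; lra. }
    rewrite !picard_0, Rminus_diag, Rminus_0_r in H.
    eapply Rle_trans; [apply H|].
    assert (0 <= M * exp (c * 0) * (/ 2) ^ S k); [|lra].
    assert (0 < exp (c * 0)) by apply exp_pos.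
    assert (0 < (/ 2) ^ S k) by (apply pow_lt; lra).
    apply Rmult_le_pos; [apply Rmult_le_pos|]; lra.
Qed.

Lemma picard_cauchy k p i t : 0 <= t ->
  Rabs (picard (p + k) t i - picard k t i) <= 2 * (M * exp (c * t)) * (/ 2) ^ k.
Proof.
  intros Ht; assert (HM := M_nonneg).
  assert (0 < exp (c * t)) by apply exp_pos.
  set (B := M * exp (c * t)); assert (HB : 0 <= B) by (apply Rmult_le_pos; lra).
  assert (0 < (/ 2) ^ k) by (apply pow_lt; lra).
  assert (H1 : Rabs (picard (p + k) t i - picard k t i)
               <= 2 * B * (/ 2) ^ k * (1 - (/ 2) ^ p)).
  { induction p as [|p IH].
    - simpl; rewrite Rminus_diag, Rabs_R0, Rminus_diag; lra.
    - replace (picard (S p + k) t i - picard k t i)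
        with ((picard (S (p + k)) t i - picard (p + k) t i)
              + (picard (p + k) t i - picard k t i)) by (simpl Nat.add; ring).
      eapply Rle_trans; [apply Rabs_triang|].
      assert (H1 := picard_diff (p + k) i t Ht); fold B in H1.
      rewrite pow_add in H1; cbn [pow]; lra. }
  eapply Rle_trans; [apply H1|].
  assert (0 < (/ 2) ^ p) by (apply pow_lt; lra).
  assert (0 <= 2 * B * (/ 2) ^ k) by (apply Rmult_le_pos; lra); nra.
Qed.

Lemma geometric_small (B eps : R) : 0 <= B -> 0 < eps -> exists k, B * (/ 2) ^ k < eps.
Proof.
  intros HB Heps.
  destruct (pow_lt_1_zero (/ 2)) with (y := eps / (B + 1)) as [k Hk].
  - rewrite Rabs_pos_eq; lra.
  - apply Rdiv_lt_0_compat; lra.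
  - exists k; specialize (Hk k (le_n k)).
    assert (H : 0 < (/ 2) ^ k) by (apply pow_lt; lra).
    rewrite Rabs_pos_eq in Hk by lra.
    apply (Rmult_lt_compat_r (B + 1)) in Hk; [|lra].
    unfold Rdiv in Hk; rewrite Rmult_assoc, Rinv_l in Hk by lra; nra.
Qed.

(** The convergence estimates hold for nonnegative times; the even extension makes the limit
    Lipschitz on the whole line, as [is_derive_primitive] requires of its integrand. *)
Definition picard_lim (t : R) (i : nat) : R := real (Lim_seq (fun k => picard k (Rabs t) i)).

Lemma picard_is_lim t i : is_lim_seq (fun k => picard k (Rabs t) i) (picard_lim t i).
Proof.
  apply Lim_seq_correct', ex_lim_seq_cauchy_corr.
  assert (HM := M_nonneg).
  assert (0 < exp (c * Rabs t)) by apply exp_pos.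
  set (B := 2 * (M * exp (c * Rabs t))).
  assert (HB : 0 <= B) by (unfold B; nra).
  intros eps; destruct (geometric_small B (eps / 2) HB) as [k Hk]; [destruct eps; simpl; lra|].
  exists k; intros a b Ha Hb.
  assert (H1 := picard_cauchy k (a - k) i (Rabs t) (Rabs_pos t)).
  assert (H2 := picard_cauchy k (b - k) i (Rabs t) (Rabs_pos t)).
  replace (a - k + k)%nat with a in H1 by lia; replace (b - k + k)%nat with b in H2 by lia.
  fold B in H1, H2.
  apply Rabs_le_between in H1; apply Rabs_le_between in H2; apply Rabs_def1; lra.
Qed.

Lemma picard_lim_close k t i :
  Rabs (picard_lim t i - picard k (Rabs t) i) <= 2 * (M * exp (c * Rabs t)) * (/ 2) ^ k.
Proof.
  set (B := 2 * (M * exp (c * Rabs t)) * (/ 2) ^ k).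
  assert (H : is_lim_seq (fun p => Rabs (picard (p + k) (Rabs t) i - picard k (Rabs t) i))
                (Rbar_abs (Finite (picard_lim t i - picard k (Rabs t) i)))).
  { apply is_lim_seq_abs.
    apply is_lim_seq_minus' with (v := fun _ => picard k (Rabs t) i); [|apply is_lim_seq_const].
    apply (is_lim_seq_incr_n (fun k => picard k (Rabs t) i) k), picard_is_lim. }
  apply (is_lim_seq_le _ (fun _ => B) _ (Finite B)) in H; [exact H| |apply is_lim_seq_const].
  intros p; apply picard_cauchy, Rabs_pos.
Qed.

Lemma picard_lim_lipschitz i : lipschitz (fun t => picard_lim t i) M.
Proof.
  intros s t.
  assert (H : is_lim_seq (fun p => Rabs (picard p (Rabs t) i - picard p (Rabs s) i))
                (Rbar_abs (Finite (picard_lim t i - picard_lim s i)))).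
  { apply is_lim_seq_abs, is_lim_seq_minus'; apply picard_is_lim. }
  apply (is_lim_seq_le _ (fun _ => M * Rabs (t - s)) _ (Finite (M * Rabs (t - s)))) in H;
    [exact H| |apply is_lim_seq_const].
  intros p; eapply Rle_trans; [apply (proj2 (picard_step p i 0) (Rabs s) (Rabs t))|].
  apply Rmult_le_compat_l; [apply M_nonneg|apply Rabs_triang_inv2].
Qed.

Lemma picard_lim_integral t i : 0 <= t ->
  picard_lim t i = x0 i + RInt (fun s => f (picard_lim s) i) 0 t.
Proof.
  intros Ht; assert (HM := M_nonneg).
  set (y := fun t => x0 i + RInt (fun s => f (picard_lim s) i) 0 t).
  assert (Hy : forall t, is_derive y t (f (picard_lim t) i)).
  { intros u; apply (is_derive_primitive _ _ _ u (field_lipschitz picard_lim i picard_lim_lipschitz)). }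
  assert (Hy0 : y 0 = x0 i) by (unfold y; rewrite RInt_point; unfold zero; simpl; ring).
  assert (He : 0 < exp (c * t)) by apply exp_pos.
  set (B := 2 * (M * exp (c * t))); assert (HB : 0 <= B) by (unfold B; nra).
  destruct c_ge as [Hc1 Hc2].
  (* Both sides are compared with the iterate of order k + 1: [B] comes from the distance of the
     limit to the iterates, [c / 2 * B * t] from integrating the resulting difference of the
     fields. *)
  set (A := B + c / 2 * B * t); assert (HA : 0 <= A).
  { unfold A; assert (0 <= c / 2 * B * t) by (apply Rmult_le_pos; [apply Rmult_le_pos|]; lra); lra. }
  change (picard_lim t i = y t).
  apply cond_eq; intros eps Heps; destruct (geometric_small A eps HA Heps) as [k Hk].
    eapply Rle_lt_trans; [|apply Hk].
    assert (Hp : 0 < (/ 2) ^ k) by (apply pow_lt; lra).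
    assert (H1 := picard_lim_close (S k) t i).
    rewrite (Rabs_pos_eq t Ht) in H1; fold B in H1; cbn [pow] in H1.
    assert (H2 : Rabs ((y t - picard (S k) t i) - (y 0 - picard (S k) 0 i))
                 <= c / 2 * (B * (/ 2) ^ k) * t - c / 2 * (B * (/ 2) ^ k) * 0).
    { apply (derive_abs_le (fun t => y t - picard (S k) t i)
               (fun t => f (picard_lim t) i - f (picard k t) i)
               (fun t => c / 2 * (B * (/ 2) ^ k) * t) (fun _ => c / 2 * (B * (/ 2) ^ k))); [easy| |].
      - intros u _; split.
        + apply (continuous_minus (V := R_NormedModule)); [|apply picard_continuous].
          apply (ex_derive_continuous (V := R_NormedModule)); eexists; apply Hy.
        + apply (ex_derive_continuous (V := R_NormedModule)); auto_derive; easy.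
      - intros u Hu; split; [|split].
        + apply (is_derive_minus (V := R_NormedModule)); [apply Hy|apply picard_step].
        + auto_derive; [easy|ring].
        + assert (HBu : 2 * (M * exp (c * u)) <= B).
          { unfold B; apply Rmult_le_compat_l; [lra|]; apply Rmult_le_compat_l; [easy|].
            left; apply exp_increasing; nra. }
          eapply Rle_trans.
          * apply (field_diff_le (B * (/ 2) ^ k)); [nra|].
            intros j _; assert (H3 := picard_lim_close k u j).
            rewrite (Rabs_pos_eq u) in H3 by lra; nra.
          * apply Rmult_le_compat_r; [nra|easy]. }
    rewrite picard_0, Hy0, Rminus_diag, Rminus_0_r, Rmult_0_r, Rminus_0_r in H2.
    apply Rabs_le_between in H1; apply Rabs_le_between in H2.
    unfold A; apply Rabs_le; nra.
Qed.

Theorem picard_exists : exists x : R -> nat -> R,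
  (forall i, x 0 i = x0 i) /\
  (forall i t, continuous (fun t => x t i) t) /\
  (forall i t, 0 < t -> is_derive (fun t => x t i) t (f (x t) i)).
Proof.
  exists picard_lim; split; [|split].
  - intros i; rewrite picard_lim_integral by lra; rewrite RInt_point; unfold zero; simpl; ring.
  - intros i t; eapply lipschitz_continuous, picard_lim_lipschitz.
  - intros i t Ht.
    apply (is_derive_ext_loc (V := R_NormedModule)
             (fun t => x0 i + RInt (fun s => f (picard_lim s) i) 0 t)).
    + exists (mkposreal t Ht); intros u Hu; symmetry; apply picard_lim_integral.
      apply Rabs_lt_between in Hu; unfold minus, plus, opp in Hu; simpl in Hu; lra.
    + apply (is_derive_primitive _ _ _ t (field_lipschitz picard_lim i picard_lim_lipschitz)).
Qed.

End Picard.

(** Gronwall applied to the sum of squared differences, which is differentiable. The factor 2 |K| n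
    arises from 2 |d_i| |d_j| <= d_i^2 + d_j^2 summed over all pairs. *)
Lemma ode_unique (n : nat) (f : (nat -> R) -> nat -> R) (K b : R) (x y : R -> nat -> R) :
  0 <= b -> (forall i, (i < n)%nat -> x 0 i = y 0 i) ->
  (forall i t, (i < n)%nat -> 0 <= t <= b ->
     continuous (fun t => x t i) t /\ continuous (fun t => y t i) t) ->
  (forall i t, (i < n)%nat -> 0 < t < b ->
     is_derive (fun t => x t i) t (f (x t) i) /\
     is_derive (fun t => y t i) t (f (y t) i) /\
     Rabs (f (x t) i - f (y t) i) <= K * rsum n (fun j => Rabs (x t j - y t j))) ->
  forall i, (i < n)%nat -> x b i = y b i.
Proof.
  intros Hb H0 Hc Hd.
  set (d := fun i t => x t i - y t i).
  assert (He : rsum n (fun i => (d i b) ^ 2) = 0).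
  { apply (gronwall_zero (fun t => rsum n (fun i => (d i t) ^ 2))
      (fun t => rsum n (fun i => 2 * d i t * (f (x t) i - f (y t) i))) (2 * (Rabs K * INR n)) b);
      [easy| | | |].
    - rewrite (rsum_ext n _ (fun _ => 0)); [rewrite rsum_const; ring|].
      intros i Hi; unfold d; rewrite H0 by easy; ring.
    - apply rsum_nonneg; intros; apply pow2_ge_0.
    - intros t Ht; apply (continuous_rsum n (fun i t => (d i t) ^ 2)); intros i Hi.
      destruct (Hc i t Hi Ht) as [H1 H2].
      assert (Hdi : continuous (d i) t) by now apply (continuous_minus (V := R_NormedModule)).
      simpl; apply (continuous_mult (K := R_AbsRing)); [easy|].
      apply (continuous_mult (K := R_AbsRing)); [easy|apply continuous_const].
    - intros t Ht; split.
      + apply (is_derive_rsum n (fun i t => (d i t) ^ 2)); intros i Hi.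
        destruct (Hd i t Hi Ht) as (H1 & H2 & _).
        assert (Hdi : is_derive (d i) t (f (x t) i - f (y t) i))
          by now apply (is_derive_minus (V := R_NormedModule)).
        evar_last; [apply is_derive_pow, Hdi|]; simpl; ring.
      + eapply Rle_trans.
        * apply (rsum_le n _ (fun i => Rabs K * rsum n (fun j => (d i t) ^ 2 + (d j t) ^ 2))).
          intros i Hi; destruct (Hd i t Hi Ht) as (_ & _ & H3).
          set (w := f (x t) i - f (y t) i) in *.
          set (S1 := rsum n (fun j => Rabs (x t j - y t j))) in *.
          assert (HS : 2 * (Rabs (d i t) * S1) <= rsum n (fun j => (d i t) ^ 2 + (d j t) ^ 2)).
          { rewrite <- Rmult_assoc; unfold S1; rewrite <- rsum_scal; apply rsum_le; intros j Hj.
            fold (d j t); rewrite <- (pow2_abs (d i t)), <- (pow2_abs (d j t)).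
            assert (0 <= (Rabs (d i t) - Rabs (d j t)) ^ 2) by apply pow2_ge_0; nra. }
          assert (HS1 : 0 <= S1) by (apply rsum_nonneg; intros; apply Rabs_pos).
          assert (Hdw : d i t * w <= Rabs (d i t) * Rabs w)
            by (rewrite <- Rabs_mult; apply Rle_abs).
          assert (0 <= Rabs (d i t)) by apply Rabs_pos.
          assert (K <= Rabs K) by apply Rle_abs; assert (0 <= Rabs K) by apply Rabs_pos.
          assert (H4 : Rabs w <= Rabs K * S1) by nra.
          assert (H5 : Rabs (d i t) * Rabs w <= Rabs (d i t) * (Rabs K * S1))
            by (apply Rmult_le_compat_l; easy).
          nra.
        * rewrite rsum_scal.
          rewrite (rsum_ext n _ (fun i => INR n * d i t ^ 2 + rsum n (fun j => d j t ^ 2)))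
            by (intros i _; rewrite rsum_plus, rsum_const; ring).
          rewrite rsum_plus, rsum_scal, rsum_const; lra. }
  intros i Hi.
  assert (H := rsum_term n (fun i => d i b ^ 2) i (fun j _ => pow2_ge_0 (d j b)) Hi).
  cbv beta in H; rewrite He in H; unfold d in H; simpl in H; nra.
Qed.

(** * Plane geometry *)

Ltac plane :=
  unfold dot, cross, rot90, minus, plus, opp, scal, zero in *; simpl in *;
  unfold prod_plus, prod_opp, prod_scal, plus, opp, scal, zero in *; simpl in *;
  unfold mult in *; simpl in *.

Lemma norm_dot (x : pt) : norm x = sqrt (dot x x).
Proof. rewrite norm_plane; f_equal; unfold dot; ring. Qed.

Lemma dot_self_nonneg (x : pt) : 0 <= dot x x.
Proof. unfold dot; nra. Qed.

Lemma norm_sqr (x : pt) : norm x * norm x = dot x x.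
Proof. rewrite norm_dot; apply sqrt_sqrt, dot_self_nonneg. Qed.

Lemma unit_dot (x : pt) : norm x = 1 -> dot x x = 1.
Proof. intros H; rewrite <- norm_sqr, H; ring. Qed.

Lemma pt_norm_nonneg (x : pt) : 0 <= norm x.
Proof. rewrite norm_dot; apply sqrt_pos. Qed.

Lemma norm_minus_pos (a b : pt) : a <> b -> 0 < norm (minus b a).
Proof.
  intros H; rewrite norm_dot; apply sqrt_lt_R0.
  destruct a as [a1 a2], b as [b1 b2]; plane.
  destruct (Req_dec a1 b1) as [->|H1]; [destruct (Req_dec a2 b2) as [->|H2]|].
  - now exfalso; apply H.
  - assert (0 < (b2 + - a2) * (b2 + - a2)) by (apply Rsqr_pos_lt; intros E; apply H2; lra).
    assert (0 <= (b1 + - b1) * (b1 + - b1)) by apply Rle_0_sqr; lra.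
  - assert (0 < (b1 + - a1) * (b1 + - a1)) by (apply Rsqr_pos_lt; intros E; apply H1; lra).
    assert (0 <= (b2 + - a2) * (b2 + - a2)) by apply Rle_0_sqr; lra.
Qed.

Lemma tangent_unit S : nondegenerate S -> dot (tangent S) (tangent S) = 1.
Proof.
  destruct S as [a b|d b|a d]; simpl; intros H; [|now apply unit_dot..].
  generalize (norm_minus_pos a b H) (norm_sqr (minus b a)).
  generalize (minus b a); intros [x y]; generalize (norm (x, y)); intros r Hr Hs; plane.
  transitivity (/ r * / r * (r * r)); [rewrite Hs; ring|field; lra].
Qed.

Lemma rot90_inj (x y : pt) : rot90 x = rot90 y -> x = y.
Proof. destruct x, y; unfold rot90; simpl; intros H; injection H; intros; f_equal; lra. Qed.

Lemma dot_rot90 (x y : pt) : dot x (rot90 y) = cross y x.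
Proof. destruct x, y; plane; ring. Qed.

Lemma cross_anti (x y : pt) : cross x y = - cross y x.
Proof. destruct x, y; plane; ring. Qed.

Lemma lagrange (x y : pt) : cross x y ^ 2 + dot x y ^ 2 = dot x x * dot y y.
Proof. destruct x, y; plane; ring. Qed.

Lemma dot_minus_l (x y z : pt) : dot (minus x y) z = dot x z - dot y z.
Proof. destruct x, y, z; plane; ring. Qed.

Lemma dot_plus_l (x y z : pt) : dot (plus x y) z = dot x z + dot y z.
Proof. destruct x, y, z; plane; ring. Qed.

Lemma dot_scal_l (k : R) (x y : pt) : dot (scal k x) y = k * dot x y.
Proof. destruct x, y; plane; ring. Qed.

Lemma dot_comm (x y : pt) : dot x y = dot y x.
Proof. unfold dot; ring. Qed.

Lemma cauchy_schwarz (x y : pt) : Rabs (dot x y) <= norm x * norm y.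
Proof.
  rewrite <- (Rabs_pos_eq (norm x * norm y))
    by (apply Rmult_le_pos; apply pt_norm_nonneg).
  apply Rsqr_le_abs_0; unfold Rsqr.
  replace (norm x * norm y * (norm x * norm y))
    with ((norm x * norm x) * (norm y * norm y)) by ring.
  rewrite !norm_sqr, <- lagrange; assert (0 <= cross x y ^ 2) by apply pow2_ge_0; nra.
Qed.

Lemma scal_normalize (x : pt) : 0 < norm x -> x = scal (norm x) (scal (/ norm x) x).
Proof.
  generalize (norm x); intros r Hr; destruct x; plane; f_equal; field; lra.
Qed.

Lemma seg_vector (a b : pt) :
  a <> b -> minus b a = scal (norm (minus b a)) (tangent (Seg a b)).
Proof. intros H; exact (scal_normalize _ (norm_minus_pos a b H)). Qed.

Lemma seg_length (a b : pt) :
  a <> b -> norm (minus b a) = dot (minus b a) (tangent (Seg a b)).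
Proof.
  intros H.
  transitivity (dot (scal (norm (minus b a)) (tangent (Seg a b))) (tangent (Seg a b))).
  - rewrite dot_scal_l, tangent_unit by easy; ring.
  - f_equal; symmetry; now apply seg_vector.
Qed.

Lemma tangent_seg a b (u : pt) L : dot u u = 1 -> 0 < L -> minus b a = scal L u ->
  a <> b /\ tangent (Seg a b) = u /\ norm (minus b a) = L.
Proof.
  intros Hu HL H.
  assert (HN : norm (minus b a) = L).
  { rewrite H, norm_dot, dot_scal_l, dot_comm, dot_scal_l, Hu.
    replace (L * (L * 1)) with (L * L) by ring; apply sqrt_square; lra. }
  split; [|split; [|easy]].
  - intros ->; rewrite minus_eq_zero in HN.
    apply (Rlt_not_eq 0 L HL); rewrite <- HN; symmetry.
    exact (norm_zero (V := prod_NormedModule R_AbsRing R_NormedModule R_NormedModule)).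
  - transitivity (scal (/ norm (minus b a)) (scal L u)); [now rewrite <- H|].
    rewrite HN; destruct u; plane; f_equal; field; lra.
Qed.

(** Cramer's rule for the intersection of the lines with directions [u], [v] and levels [r], [s]. *)
Definition meet (u v : pt) (r s : R) : pt :=
  scal (/ cross u v) (minus (scal r v) (scal s u)).

Lemma meet_spec u v r s : cross u v <> 0 ->
  dot (meet u v r s) (rot90 u) = r /\ dot (meet u v r s) (rot90 v) = s.
Proof.
  unfold meet; destruct u as [u1 u2], v as [v1 v2]; plane; intros H; split; field; exact H.
Qed.

Lemma meet_unique u v r s x : cross u v <> 0 ->
  dot x (rot90 u) = r -> dot x (rot90 v) = s -> x = meet u v r s.
Proof.
  unfold meet; destruct u as [u1 u2], v as [v1 v2], x as [x y]; plane; intros H <- <-.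
  f_equal; field; exact H.
Qed.

Lemma angle_spec S T :
  dot (tangent S) (tangent S) = 1 -> dot (tangent T) (tangent T) = 1 ->
  cross (tangent S) (tangent T) <> 0 ->
  sin (angle S T) = cross (tangent S) (tangent T) /\
  cos (angle S T) = - dot (tangent S) (tangent T) /\
  (PI < angle S T <-> cross (tangent S) (tangent T) < 0) /\
  (angle S T < PI <-> 0 < cross (tangent S) (tangent T)).
Proof.
  unfold angle, normal; set (u := tangent S); set (v := tangent T); intros Hu Hv HD.
  (* Both tests in [angle] amount to the positivity of the same cross product. *)
  replace (dot (rot90 u) v) with (cross u v) by (rewrite dot_comm, dot_rot90; easy).
  replace (dot (rot90 v) (opp u)) with (cross u v) by (destruct u, v; plane; ring).
  assert (HL := lagrange u v); rewrite Hu, Hv, Rmult_1_r in HL.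
  assert (H1 : -1 < - dot u v < 1).
  { assert (0 < cross u v ^ 2).
    { replace (cross u v ^ 2) with (Rsqr (cross u v)) by (unfold Rsqr; ring).
      now apply Rsqr_pos_lt. }
    nra. }
  assert (HC : cos (acos (- dot u v)) = - dot u v) by (apply cos_acos; lra).
  assert (HS : sin (acos (- dot u v)) = Rabs (cross u v)).
  { rewrite sin_acos by lra; rewrite <- sqrt_Rsqr_abs; f_equal; unfold Rsqr; lra. }
  assert (HB := acos_bound_lt (- dot u v) H1).
  destruct (Rlt_dec 0 (cross u v)) as [Hp|Hp].
  - rewrite HS, HC, Rabs_pos_eq by lra; repeat split; lra.
  - rewrite sin_minus, cos_minus, sin_2PI, cos_2PI, HS, HC, Rabs_left by lra.
    repeat split; lra.
Qed.

(** * Combinatorics of polygonal curves *)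

Definition tau (G : curve) (i : nat) : pt := tangent (edge_of G i).
Definition turn (G : curve) (i : nat) : R := cross (tau G (prev G i)) (tau G i).
(** The common point of S_(prev i) and S_i, meaningful where [joint G i] holds. *)
Definition vtx (G : curve) (i : nat) : pt :=
  match G with Closed p => nth i p zero | Unbounded _ p _ => nth (i - 1) p zero end.
Definition seg (G : curve) (i : nat) : Prop := (i < nb_edges G)%nat /\ is_seg (edge_of G i).
(** Signed distance from the origin to the line of S_i, measured along the normal. *)
Definition level (G : curve) (i : nat) : R := dot (base (edge_of G i)) (rot90 (tau G i)).

Lemma nb_edges_pos G : polygonal G -> (0 < nb_edges G)%nat.
Proof.
  destruct G as [p|d p e]; intros [H _]; simpl in *; [|lia].
  destruct p; [easy|simpl; lia].
Qed.

Lemma next_lt G i : (0 < nb_edges G)%nat -> (next G i < nb_edges G)%nat.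
Proof. intros H; apply Nat.mod_upper_bound; lia. Qed.

Lemma prev_lt G i : (0 < nb_edges G)%nat -> (prev G i < nb_edges G)%nat.
Proof. intros H; apply Nat.mod_upper_bound; lia. Qed.

Lemma prev_next G i : (i < nb_edges G)%nat -> prev G (next G i) = i.
Proof.
  intros H; unfold prev, next.
  destruct (Nat.eq_dec (i + 1) (nb_edges G)) as [E|E].
  - rewrite E, Nat.Div0.mod_same; simpl; rewrite Nat.mod_small by lia; lia.
  - rewrite (Nat.mod_small (i + 1)) by lia.
    replace (i + 1 + (nb_edges G - 1))%nat with (i + 1 * nb_edges G)%nat by lia.
    rewrite Nat.Div0.mod_add; apply Nat.mod_small; lia.
Qed.

Lemma next_prev G i : (i < nb_edges G)%nat -> next G (prev G i) = i.
Proof.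
  intros H; unfold prev, next.
  destruct i as [|i].
  - rewrite (Nat.mod_small (0 + _)) by lia.
    replace (0 + (nb_edges G - 1) + 1)%nat with (nb_edges G) by lia; apply Nat.Div0.mod_same.
  - replace (S i + (nb_edges G - 1))%nat with (i + 1 * nb_edges G)%nat by lia.
    rewrite Nat.Div0.mod_add, (Nat.mod_small i) by lia.
    rewrite Nat.mod_small by lia; lia.
Qed.

Lemma prev_S G i : (S i < nb_edges G)%nat -> prev G (S i) = i.
Proof.
  intros H; unfold prev.
  replace (S i + (nb_edges G - 1))%nat with (i + 1 * nb_edges G)%nat by lia.
  rewrite Nat.Div0.mod_add; apply Nat.mod_small; lia.
Qed.

Lemma next_S G i : (S i < nb_edges G)%nat -> next G i = S i.
Proof. intros H; unfold next; rewrite Nat.mod_small by lia; lia. Qed.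

Lemma edge_of_closed p i : edge_of (Closed p) i = Seg (vtx (Closed p) i) (vtx (Closed p) (next (Closed p) i)).
Proof. easy. Qed.

Lemma edge_of_unbounded_0 d p e : edge_of (Unbounded d p e) 0 = RayIn d (nth 0 p zero).
Proof. easy. Qed.

Lemma edge_of_unbounded_last d p e : p <> nil ->
  edge_of (Unbounded d p e) (length p) = RayOut (vtx (Unbounded d p e) (length p)) e.
Proof.
  intros H; simpl; destruct p as [|q p]; [easy|]; simpl length.
  replace (S (length p) =? 0) with false by easy.
  now rewrite Nat.eqb_refl.
Qed.

Lemma edge_of_unbounded_mid d p e i : (0 < i < length p)%nat ->
  edge_of (Unbounded d p e) i =
  Seg (vtx (Unbounded d p e) i) (vtx (Unbounded d p e) (S i)).
Proof.
  intros H; simpl.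
  rewrite (proj2 (Nat.eqb_neq i 0)), (proj2 (Nat.eqb_neq i (length p))) by lia.
  do 2 f_equal; lia.
Qed.

Lemma seg_unbounded d p e i : p <> nil -> seg (Unbounded d p e) i <-> (0 < i < length p)%nat.
Proof.
  intros Hp; split.
  - intros [Hi Hs]; cbn [nb_edges] in Hi; destruct (Nat.eq_dec i 0) as [->|H0].
    + now rewrite edge_of_unbounded_0 in Hs.
    + destruct (Nat.eq_dec i (length p)) as [->|H1]; [|lia].
      now rewrite edge_of_unbounded_last in Hs.
  - intros H; split; [simpl; lia|now rewrite edge_of_unbounded_mid].
Qed.

Lemma seg_edge G i : polygonal G -> seg G i ->
  joint G i /\ joint G (next G i) /\ edge_of G i = Seg (vtx G i) (vtx G (next G i)).
Proof.
  intros HG Hs; assert (Hn := nb_edges_pos G HG); destruct Hs as [Hi Hs].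
  destruct G as [p|d p e].
  - split; [|split]; [split; [easy|now left]|split; [now apply next_lt|now left]|easy].
  - assert (H : (0 < i < length p)%nat) by (apply (seg_unbounded d p e); [apply HG|easy]).
    assert (Hx : next (Unbounded d p e) i = S i) by (apply next_S; simpl; lia).
    rewrite Hx, edge_of_unbounded_mid by easy.
    split; [|split]; [split; [easy|right; lia]|split; [simpl; lia|right; lia]|easy].
Qed.

Lemma joint_edge G i : polygonal G -> joint G i -> base (edge_of G i) = vtx G i.
Proof.
  intros HG [Hi Hj]; destruct G as [p|d p e]; [easy|].
  destruct Hj as [[]|Hj]; cbn [nb_edges] in Hi.
  destruct (Nat.eq_dec i (length p)) as [->|H1].
  - rewrite edge_of_unbounded_last; [easy|apply HG].
  - rewrite edge_of_unbounded_mid by lia; easy.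
Qed.

Lemma joint_prev G i : polygonal G -> joint G i ->
  (prev G i < nb_edges G)%nat /\
  (edge_of G (prev G i) = Seg (vtx G (prev G i)) (vtx G i) \/
   exists d, edge_of G (prev G i) = RayIn d (vtx G i)).
Proof.
  intros HG [Hi Hj]; split; [now apply prev_lt, nb_edges_pos|].
  destruct G as [p|d p e].
  - left; rewrite edge_of_closed, next_prev; easy.
  - destruct Hj as [[]|Hj]; destruct i as [|i]; [lia|].
    rewrite prev_S by easy; cbn [nb_edges] in Hi.
    destruct i as [|i].
    + right; exists d; easy.
    + left; rewrite edge_of_unbounded_mid by lia; easy.
Qed.

Lemma tau_unit G i : polygonal G -> (i < nb_edges G)%nat -> dot (tau G i) (tau G i) = 1.
Proof. intros (_ & H & _) Hi; now apply tangent_unit, H. Qed.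

Lemma turn_neq_0 G i : polygonal G -> joint G i -> turn G i <> 0.
Proof. intros (_ & _ & H) Hi; now apply H. Qed.

Lemma vtx_level G i : polygonal G -> joint G i ->
  dot (vtx G i) (rot90 (tau G (prev G i))) = level G (prev G i) /\
  dot (vtx G i) (rot90 (tau G i)) = level G i.
Proof.
  intros HG Hj; unfold level; split; [|now rewrite (joint_edge G i)].
  destruct (joint_prev G i HG Hj) as [Hp [E|[d E]]]; rewrite E; simpl; [|easy].
  assert (Hne : vtx G (prev G i) <> vtx G i).
  { assert (H := proj1 (proj2 HG) _ Hp); now rewrite E in H. }
  apply Rminus_diag_uniq; rewrite <- dot_minus_l, (seg_vector _ _ Hne).
  rewrite <- E; fold (tau G (prev G i)); rewrite dot_scal_l, dot_rot90.
  unfold cross; ring.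
Qed.

Lemma vtx_meet G i : polygonal G -> joint G i ->
  vtx G i = meet (tau G (prev G i)) (tau G i) (level G (prev G i)) (level G i).
Proof.
  intros HG Hj; destruct (vtx_level G i HG Hj) as [H1 H2].
  apply meet_unique; [now apply turn_neq_0|easy|easy].
Qed.

(* Up to sign, the linear map from levels to lengths: see [seg_length_op]. *)
Definition op (G : curve) (x : nat -> R) (i : nat) : R :=
  x (prev G i) / turn G i
  - x i * (dot (tau G (prev G i)) (tau G i) / turn G i
           + dot (tau G i) (tau G (next G i)) / turn G (next G i))
  + x (next G i) / turn G (next G i).

(** The two points are the endpoints that edge i would have at levels [x], so [- op] is its signed
    length along the fixed tangent. This holds for arbitrary levels, including those where the edge
    is degenerate or reversed. *)
Lemma meet_op G x i : polygonal G -> seg G i ->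
  dot (minus (meet (tau G i) (tau G (next G i)) (x i) (x (next G i)))
             (meet (tau G (prev G i)) (tau G i) (x (prev G i)) (x i))) (tau G i)
  = - op G x i.
Proof.
  intros HG Hs; destruct (seg_edge G i HG Hs) as (H1 & H2 & _).
  assert (Hu := tau_unit G i HG (proj1 Hs)).
  assert (D1 := turn_neq_0 G i HG H1); assert (D2 := turn_neq_0 G _ HG H2).
  unfold op, meet in *; unfold turn in *; rewrite prev_next in * by apply Hs.
  rewrite dot_minus_l, !dot_scal_l, !dot_minus_l, !dot_scal_l, Hu.
  rewrite (dot_comm (tau G (next G i))); field; easy.
Qed.

Lemma seg_length_op G i : polygonal G -> seg G i ->
  H1 (edge_of G i) = Finite (- op G (level G) i) /\ 0 < - op G (level G) i.
Proof.
  intros HG Hs; destruct (seg_edge G i HG Hs) as (J1 & J2 & E).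
  assert (Hne : vtx G i <> vtx G (next G i)).
  { assert (H := proj1 (proj2 HG) _ (proj1 Hs)); now rewrite E in H. }
  assert (HE : norm (minus (vtx G (next G i)) (vtx G i)) = - op G (level G) i).
  { rewrite (seg_length _ _ Hne), <- E; fold (tau G i).
    rewrite (vtx_meet G i), (vtx_meet G (next G i)), prev_next by (easy || apply Hs).
    now apply meet_op. }
  rewrite E; simpl; rewrite HE; split; [easy|].
  rewrite <- HE; now apply norm_minus_pos.
Qed.

Lemma theta_spec G i : polygonal G -> joint G i ->
  sin (theta G i) = turn G i /\
  cos (theta G i) = - dot (tau G (prev G i)) (tau G i) /\
  (PI < theta G i <-> turn G i < 0) /\ (theta G i < PI <-> 0 < turn G i).
Proof.
  intros HG Hj; apply angle_spec.
  - apply tau_unit; [easy|]; now apply joint_prev.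
  - apply tau_unit; [easy|apply Hj].
  - now apply turn_neq_0.
Qed.

(** The transition number becomes a matter of signs of [turn], which depend on the tangents only;
    this is what makes it common to parallel curves. *)
Lemma transition_seg G i : polygonal G -> seg G i ->
  (turn G i < 0 /\ turn G (next G i) < 0 /\ transition G i = 1) \/
  (0 < turn G i /\ 0 < turn G (next G i) /\ transition G i = -1) \/
  (turn G i * turn G (next G i) < 0 /\ transition G i = 0).
Proof.
  intros HG Hs; destruct (seg_edge G i HG Hs) as (J1 & J2 & E).
  destruct (theta_spec G i HG J1) as (_ & _ & A1 & A2).
  destruct (theta_spec G _ HG J2) as (_ & _ & B1 & B2).
  assert (D1 := turn_neq_0 G i HG J1); assert (D2 := turn_neq_0 G _ HG J2).
  unfold transition; rewrite E.
  destruct (Rlt_dec PI (theta G i)) as [H1|H1].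
  - assert (turn G i < 0) by tauto.
    destruct (Rlt_dec PI (theta G (next G i))) as [H2|H2]; [left; tauto|].
    right; right; assert (0 < turn G (next G i)) by (assert (~ turn G (next G i) < 0) by tauto; lra).
    split; [nra|easy].
  - assert (0 < turn G i) by (assert (~ turn G i < 0) by tauto; lra).
    destruct (Rlt_dec (theta G (next G i)) PI) as [H2|H2]; [right; left; tauto|].
    right; right; assert (turn G (next G i) < 0) by (assert (~ 0 < turn G (next G i)) by tauto; lra).
    split; [nra|easy].
Qed.

Lemma transition_not_seg G i : ~ is_seg (edge_of G i) -> transition G i = 0.
Proof. unfold transition; destruct (edge_of G i); simpl; tauto. Qed.

(** * Parallel curves and levels of their edges *)

Lemma norm_plus_scal_le (b d : pt) s : norm (plus b (scal s d)) <= norm b + Rabs s * norm d.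
Proof.
  eapply Rle_trans; [apply (norm_triangle (V := prod_NormedModule R_AbsRing R_NormedModule R_NormedModule))|].
  apply Rplus_le_compat_l.
  apply (norm_scal (V := prod_NormedModule R_AbsRing R_NormedModule R_NormedModule)).
Qed.

Lemma minus_scal (b d : pt) s : minus b (scal s d) = plus b (scal (- s) d).
Proof. destruct b, d; plane; f_equal; ring. Qed.

Lemma on_line_scal (w u : pt) : dot u u = 1 -> dot w (rot90 u) = 0 -> w = scal (dot w u) u.
Proof.
  destruct w as [w1 w2], u as [u1 u2]; plane; intros Hu Hw; f_equal.
  - transitivity (w1 * (u1 * u1 + u2 * u2) + u2 * (w1 * - u2 + w2 * u1)); [rewrite Hu, Hw|]; ring.
  - transitivity (w2 * (u1 * u1 + u2 * u2) - u1 * (w1 * - u2 + w2 * u1)); [rewrite Hu, Hw|]; ring.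
Qed.

Lemma halfline_unbounded (b d : pt) (M : R) :
  norm d = 1 -> (forall s, 0 <= s -> norm (plus b (scal s d)) <= M) -> False.
Proof.
  intros Hd H.
  set (s := Rabs (dot b d) + Rabs M + 1).
  assert (0 <= Rabs (dot b d)) by apply Rabs_pos; assert (0 <= Rabs M) by apply Rabs_pos.
  assert (Hs := H s ltac:(unfold s; lra)).
  assert (HC := cauchy_schwarz (plus b (scal s d)) d).
  rewrite dot_plus_l, dot_scal_l, (unit_dot d Hd), Hd, !Rmult_1_r in HC.
  assert (- dot b d <= Rabs (dot b d)) by (rewrite <- Rabs_Ropp; apply Rle_abs).
  assert (M <= Rabs M) by apply Rle_abs.
  assert (dot b d + s <= Rabs (dot b d + s)) by apply Rle_abs.
  unfold s in *; lra.
Qed.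

(* [eps = -1] for incoming, [eps = 1] for outgoing half-lines *)
Lemma halflines_same_line (eps : R) (b b' d : pt) :
  eps * eps = 1 -> norm d = 1 ->
  bounded_set (fun x =>
    ((exists s, 0 <= s /\ x = plus b (scal (eps * s) d)) /\
     ~ (exists s, 0 <= s /\ x = plus b' (scal (eps * s) d))) \/
    ((exists s, 0 <= s /\ x = plus b' (scal (eps * s) d)) /\
     ~ (exists s, 0 <= s /\ x = plus b (scal (eps * s) d)))) <->
  dot b (rot90 d) = dot b' (rot90 d).
Proof.
  intros He Hd.
  assert (Hz : forall s, dot (scal s d) (rot90 d) = 0)
    by (intros s; rewrite dot_scal_l, dot_rot90; unfold cross; ring).
  split.
  - intros [M HM]; apply NNPP; intros Hne.
    (* On distinct parallel lines the half-lines are disjoint, so the symmetric difference contains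
       a whole half-line. *)
    apply (halfline_unbounded b' (scal eps d) M).
    + rewrite norm_dot, dot_scal_l, dot_comm, dot_scal_l, (unit_dot d Hd).
      rewrite <- Rmult_assoc, He; rewrite Rmult_1_l; apply sqrt_1.
    + intros s Hs; apply HM; right; split.
      * exists s; split; [easy|]; destruct b', d; plane; f_equal; ring.
      * intros [s' [_ E]]; apply Hne.
        assert (E' := f_equal (fun x => dot x (rot90 d)) E); cbv beta in E'.
        rewrite !dot_plus_l, !dot_scal_l, (dot_rot90 d d) in E'.
        replace (cross d d) with 0 in E' by (unfold cross; ring); lra.
  - intros E.
    (* On a common line the half-lines differ by the shift [k], so a point of one that is farther
       than |k| from its own endpoint lies on the other. *)
    set (k := dot (minus b' b) d).
    assert (Hb : b' = plus b (scal k d)).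
    { transitivity (plus b (minus b' b)); [destruct b, b'; plane; f_equal; ring|].
      f_equal; apply on_line_scal; [now apply unit_dot|].
      rewrite dot_minus_l, E; ring. }
    exists (norm b + norm b' + Rabs k); intros x Hx.
    assert (Hk : k <= Rabs k) by apply Rle_abs.
    assert (Hk' : - k <= Rabs k) by (rewrite <- Rabs_Ropp; apply Rle_abs).
    assert (Hn := pt_norm_nonneg b); assert (Hn' := pt_norm_nonneg b').
    assert (Habs : forall s, 0 <= s -> Rabs (eps * s) = s).
    { intros s Hs; rewrite Rabs_mult, (Rabs_pos_eq s) by easy.
      replace (Rabs eps) with 1; [ring|].
      destruct (Rcase_abs eps); [rewrite Rabs_left by easy|rewrite Rabs_right by easy]; nra. }
    assert (He' : forall s, eps * (eps * s) = s) by (intros; rewrite <- Rmult_assoc, He; ring).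
    destruct Hx as [[[s [Hs ->]] Hx]|[[s [Hs ->]] Hx]];
      (eapply Rle_trans; [apply norm_plus_scal_le|]); rewrite Hd, Habs by easy.
    + destruct (Rlt_dec (Rabs k) s) as [Hlt|Hlt]; [|lra].
      exfalso; apply Hx; exists (s - eps * k); split.
      * assert (Rabs (eps * k) <= Rabs k); [|assert (eps * k <= Rabs (eps * k)) by apply Rle_abs; lra].
        rewrite Rabs_mult; replace (Rabs eps) with 1; [lra|].
        rewrite <- (Rmult_1_r eps), Habs; lra.
      * rewrite Hb; replace (eps * (s - eps * k)) with (eps * s - k)
          by (rewrite Rmult_minus_distr_l, He'; ring).
        destruct b, d; plane; f_equal; ring.
    + destruct (Rlt_dec (Rabs k) s) as [Hlt|Hlt]; [|lra].
      exfalso; apply Hx; exists (s + eps * k); split.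
      * assert (Rabs (eps * k) <= Rabs k);
          [|assert (- (eps * k) <= Rabs (eps * k)) by (rewrite <- Rabs_Ropp; apply Rle_abs); lra].
        rewrite Rabs_mult; replace (Rabs eps) with 1; [lra|].
        rewrite <- (Rmult_1_r eps), Habs; lra.
      * rewrite Hb; replace (eps * (s + eps * k)) with (eps * s + k)
          by (rewrite Rmult_plus_distr_l, He'; ring).
        destruct b, d; plane; f_equal; ring.
Qed.

Lemma bounded_set_ext (A B : pt -> Prop) :
  (forall x, A x <-> B x) -> bounded_set A -> bounded_set B.
Proof. intros H [M HM]; exists M; intros x Hx; now apply HM, H. Qed.

Lemma parallel_rayin (d b b' : pt) : norm d = 1 ->
  parallel_edge (RayIn d b) (RayIn d b') <-> dot b (rot90 d) = dot b' (rot90 d).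
Proof.
  intros Hd; rewrite <- (halflines_same_line (-1)) by (easy || ring).
  assert (HE : forall c x, (exists s, 0 <= s /\ x = plus c (scal (-1 * s) d)) <->
                           in_edge (RayIn d c) x).
  { intros c x; simpl; split; intros [s [Hs ->]]; exists s; split; try easy;
      rewrite minus_scal; do 2 f_equal; ring. }
  unfold parallel_edge; split.
  - intros (_ & _ & H); revert H; apply bounded_set_ext; intros x; now rewrite !HE.
  - intros H; split; [easy|split; [easy|]]; revert H; apply bounded_set_ext; intros x; now rewrite !HE.
Qed.

Lemma parallel_rayout (d b b' : pt) : norm d = 1 ->
  parallel_edge (RayOut b d) (RayOut b' d) <-> dot b (rot90 d) = dot b' (rot90 d).
Proof.
  intros Hd; rewrite <- (halflines_same_line 1) by (easy || ring).
  assert (HE : forall c x, (exists s, 0 <= s /\ x = plus c (scal (1 * s) d)) <->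
                           in_edge (RayOut c d) x).
  { intros c x; simpl; split; intros [s [Hs ->]]; exists s; split; try easy;
      do 2 f_equal; ring. }
  unfold parallel_edge; split.
  - intros (_ & _ & H); revert H; apply bounded_set_ext; intros x; now rewrite !HE.
  - intros H; split; [easy|split; [easy|]]; revert H; apply bounded_set_ext; intros x; now rewrite !HE.
Qed.

Section Parallel.

Variables G0 G : curve.
Hypothesis HG0 : polygonal G0.
Hypothesis HP : parallel G0 G.

Lemma parallel_next i : next G i = next G0 i.
Proof. unfold next; now rewrite (proj1 (proj2 (proj2 HP))). Qed.

Lemma parallel_prev i : prev G i = prev G0 i.
Proof. unfold prev; now rewrite (proj1 (proj2 (proj2 HP))). Qed.

Lemma parallel_joint i : joint G i <-> joint G0 i.
Proof.
  destruct HP as (_ & H1 & H2 & _); unfold joint; rewrite H2; tauto.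
Qed.

Lemma parallel_tau i : (i < nb_edges G0)%nat -> tau G i = tau G0 i.
Proof.
  intros Hi; destruct (proj2 (proj2 (proj2 HP)) i Hi) as (_ & H & _); now apply rot90_inj.
Qed.

Lemma parallel_seg i : seg G i <-> seg G0 i.
Proof.
  unfold seg; destruct HP as (_ & _ & H2 & H3); rewrite H2.
  split; intros [Hi H]; (split; [easy|]); destruct (H3 i Hi) as (_ & _ & H4);
    destruct (edge_of G0 i), (edge_of G i); simpl in *; tauto.
Qed.

Lemma parallel_turn i : (i < nb_edges G0)%nat -> turn G i = turn G0 i.
Proof.
  intros Hi; unfold turn; rewrite parallel_prev, !parallel_tau; try easy.
  now apply prev_lt, nb_edges_pos.
Qed.

Lemma parallel_transition i : (i < nb_edges G0)%nat -> transition G i = transition G0 i.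
Proof.
  intros Hi; destruct (classic (seg G0 i)) as [Hs|Hs].
  - assert (Hs' := proj2 (parallel_seg i) Hs).
    assert (A := transition_seg G0 i HG0 Hs); assert (A' := transition_seg G i (proj1 HP) Hs').
    rewrite parallel_next, !parallel_turn in A' by (try easy; now apply next_lt, nb_edges_pos).
    destruct A as [(? & ? & ->)|[(? & ? & ->)|(? & ->)]];
      destruct A' as [(? & ? & ->)|[(? & ? & ->)|(? & ->)]]; try easy; nra.
  - assert (Hs' : ~ seg G i) by now rewrite parallel_seg.
    rewrite !transition_not_seg; [easy| |]; intros H; [apply Hs|apply Hs']; split; try easy.
    now rewrite (proj1 (proj2 (proj2 HP))).
Qed.

Lemma parallel_op x i : (i < nb_edges G0)%nat -> op G x i = op G0 x i.
Proof.
  intros Hi; assert (Hn := nb_edges_pos G0 HG0); unfold op.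
  rewrite parallel_prev, parallel_next, !parallel_turn, !parallel_tau;
    try easy; try (now apply prev_lt); now apply next_lt.
Qed.

(** Heights and levels differ by a constant in time, so the flow law is an equation for the
    levels. *)
Lemma parallel_height i : (i < nb_edges G0)%nat ->
  height (edge_of G0 i) (edge_of G i) = level G i - level G0 i.
Proof.
  intros Hi; assert (Hu := tau_unit G0 i HG0 Hi).
  unfold height, dist_vec, level; rewrite dot_scal_l, dot_minus_l.
  change (normal (edge_of G0 i)) with (rot90 (tau G0 i)); rewrite parallel_tau by easy.
  replace (dot (rot90 (tau G0 i)) (rot90 (tau G0 i))) with (dot (tau G0 i) (tau G0 i))
    by (destruct (tau G0 i); plane; ring).
  rewrite Hu; ring.
Qed.

Lemma parallel_length i : seg G0 i ->
  H1 (edge_of G i) = Finite (- op G0 (level G) i) /\ 0 < - op G0 (level G) i.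
Proof.
  intros Hs; rewrite <- parallel_op by apply Hs.
  apply seg_length_op; [apply HP|now apply parallel_seg].
Qed.

Lemma parallel_level_ray i : (i < nb_edges G0)%nat -> ~ is_seg (edge_of G0 i) ->
  level G i = level G0 i.
Proof.
  intros Hi Hs; assert (HE := proj2 (proj2 (proj2 HP)) i Hi).
  assert (Ht := parallel_tau i Hi); assert (HN := proj1 (proj2 HG0) i Hi).
  unfold level, tau in *.
  destruct (edge_of G0 i) as [a b|d b|a d], (edge_of G i) as [a' b'|d' b'|a' d'];
    try (now destruct HE); try (now destruct Hs); simpl in Ht; subst; symmetry.
  - exact (proj1 (parallel_rayin _ _ _ HN) HE).
  - exact (proj1 (parallel_rayout _ _ _ HN) HE).
Qed.

Lemma parallel_vtx i : joint G0 i ->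
  vtx G i = meet (tau G0 (prev G0 i)) (tau G0 i) (level G (prev G0 i)) (level G i).
Proof.
  intros Hj; rewrite vtx_meet by (apply HP || now apply parallel_joint).
  rewrite parallel_prev, !parallel_tau; [easy|apply Hj|].
  now apply prev_lt, nb_edges_pos.
Qed.

End Parallel.

(** Vertices are intersections of the lines given by levels and tangents, and the directions of
    half-lines are tangents; hence the curves agree as data and not merely as sets. *)
Lemma parallel_eq G0 G G' : polygonal G0 -> parallel G0 G -> parallel G0 G' ->
  (forall i, (i < nb_edges G0)%nat -> level G i = level G' i) -> G = G'.
Proof.
  intros HG0 H H' HL; assert (Hn := nb_edges_pos G0 HG0).
  assert (HV : forall i, joint G0 i -> vtx G i = vtx G' i).
  { intros i Hi; rewrite (parallel_vtx G0 G HG0 H i Hi), (parallel_vtx G0 G' HG0 H' i Hi).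
    rewrite !HL; [easy|apply Hi|now apply prev_lt]. }
  assert (HT : forall i, (i < nb_edges G0)%nat -> tau G i = tau G' i)
    by (intros i Hi; rewrite (parallel_tau G0 G H i Hi); symmetry; now apply parallel_tau).
  assert (EN := eq_trans (proj1 (proj2 (proj2 H))) (eq_sym (proj1 (proj2 (proj2 H'))))).
  assert (EN0 := proj1 (proj2 (proj2 H))).
  assert (HC := proj1 (proj2 H)); assert (HC' := proj1 (proj2 H')).
  destruct H as [HG _], H' as [HG' _].
  destruct G as [p|d p e], G' as [p'|d' p' e'];
    [|exfalso; simpl in *; tauto|exfalso; simpl in *; tauto|].
  - f_equal; cbn [nb_edges] in EN, EN0; apply (nth_ext _ _ zero zero EN); intros i Hi.
    apply (HV i); split; [rewrite <- EN0; exact Hi|left; now apply HC].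
  - assert (Hp : p <> nil) by apply HG; assert (Hp' : p' <> nil) by apply HG'.
    cbn [nb_edges] in EN, EN0; injection EN as EN.
    assert (Hpl : (0 < length p)%nat) by (destruct p; simpl; [easy|lia]).
    f_equal.
    + assert (E := HT 0%nat Hn); unfold tau in E; now rewrite !edge_of_unbounded_0 in E.
    + apply (nth_ext _ _ zero zero EN); intros i Hi.
      change (i < length p)%nat in Hi.
      assert (E : vtx (Unbounded d p e) (S i) = vtx (Unbounded d' p' e') (S i))
        by (apply HV; split; [lia|right; lia]).
      simpl in E; rewrite !Nat.sub_0_r in E; exact E.
    + assert (E := HT (length p) ltac:(lia)); unfold tau in E.
      rewrite edge_of_unbounded_last in E by easy; rewrite EN in E.
      now rewrite edge_of_unbounded_last in E.
Qed.

(** * Rebuilding a curve from the levels of its edges *)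

Definition meet_at (G : curve) (x : nat -> R) (i : nat) : pt :=
  meet (tau G (prev G i)) (tau G i) (x (prev G i)) (x i).

Definition rebuild (G : curve) (x : nat -> R) : curve :=
  match G with
  | Closed p => Closed (map (meet_at G x) (seq 0 (length p)))
  | Unbounded d p e => Unbounded d (map (fun i => meet_at G x (S i)) (seq 0 (length p))) e
  end.

Lemma nth_map_seq (f : nat -> pt) n i : (i < n)%nat -> nth i (map f (seq 0 n)) zero = f i.
Proof.
  intros Hi; rewrite (nth_indep _ zero (f 0%nat)) by (rewrite length_map, length_seq; easy).
  now rewrite map_nth, seq_nth.
Qed.

Lemma nb_edges_rebuild G x : nb_edges (rebuild G x) = nb_edges G.
Proof. destruct G; simpl; now rewrite length_map, length_seq. Qed.

Lemma rebuild_vtx G x i : joint G i -> vtx (rebuild G x) i = meet_at G x i.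
Proof.
  destruct G as [p|d p e]; intros [Hi Hj]; unfold rebuild, vtx; cbn [nb_edges] in Hi.
  - now apply nth_map_seq.
  - destruct Hj as [[]|Hj]; rewrite nth_map_seq by lia; f_equal; lia.
Qed.

Section Rebuild.

Variable G : curve.
Variable x : nat -> R.
Hypothesis HG : polygonal G.

Lemma rebuild_nonempty :
  match rebuild G x with Closed p => p <> nil | Unbounded _ p _ => p <> nil end.
Proof.
  destruct HG as [H _]; destruct G as [[|a p]|d [|a p] e]; simpl; easy.
Qed.

Lemma meet_at_spec i : joint G i ->
  dot (meet_at G x i) (rot90 (tau G (prev G i))) = x (prev G i) /\
  dot (meet_at G x i) (rot90 (tau G i)) = x i.
Proof. intros Hj; apply meet_spec; now apply turn_neq_0. Qed.

Lemma rebuild_edge i : (i < nb_edges G)%nat ->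
  match edge_of G i with
  | Seg _ _ => edge_of (rebuild G x) i = Seg (meet_at G x i) (meet_at G x (next G i))
  | RayIn d _ => edge_of (rebuild G x) i = RayIn d (meet_at G x (next G i)) /\ joint G (next G i)
  | RayOut _ d => edge_of (rebuild G x) i = RayOut (meet_at G x i) d /\ joint G i
  end.
Proof.
  intros Hi; destruct HG as [Hne _].
  assert (HV := rebuild_vtx G x); assert (HN := rebuild_nonempty).
  assert (HB := nb_edges_rebuild G x).
  destruct G as [p|d p e].
  - assert (HJ : forall j, (j < length p)%nat -> joint (Closed p) j) by (intros; split; [easy|now left]).
    rewrite edge_of_closed; unfold rebuild in *; rewrite edge_of_closed.
    assert (E : forall j, next (Closed (map (meet_at (Closed p) x) (seq 0 (length p)))) j
                = next (Closed p) j) by (intros; unfold next; now rewrite HB).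
    assert (next (Closed p) i < length p)%nat by (apply next_lt; simpl in *; lia).
    rewrite E, !HV; [easy|now apply HJ|now apply HJ].
  - cbn [nb_edges] in Hi; unfold rebuild in *.
    set (p' := map (fun i0 => meet_at (Unbounded d p e) x (S i0)) (seq 0 (length p))) in *.
    assert (HL : length p' = length p) by (unfold p'; now rewrite length_map, length_seq).
    assert (Hp : (0 < length p)%nat) by (destruct p; simpl in *; [easy|lia]).
    destruct (Nat.eq_dec i 0) as [->|H0]; [|destruct (Nat.eq_dec i (length p)) as [->|H1]].
    + rewrite !edge_of_unbounded_0; rewrite next_S by (simpl; lia).
      assert (HJ : joint (Unbounded d p e) 1) by (split; [simpl; lia|right; lia]).
      split; [|easy]; rewrite <- (HV 1%nat) by easy; easy.
    + rewrite edge_of_unbounded_last by easy; rewrite <- HL at 1.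
      rewrite edge_of_unbounded_last by easy.
      assert (HJ : joint (Unbounded d p e) (length p)) by (split; [simpl; lia|right; lia]).
      split; [|easy]; rewrite HL, HV; easy.
    + rewrite !edge_of_unbounded_mid by lia; rewrite next_S by (simpl; lia).
      rewrite !HV; [easy|split; [simpl; lia|right; lia]..].
Qed.

Hypothesis x_length : forall i, seg G i -> 0 < - op G x i.
Hypothesis x_ray : forall i, (i < nb_edges G)%nat -> ~ is_seg (edge_of G i) -> x i = level G i.

(** Both endpoints lie on the line of level [x i], so their difference is a multiple of the tangent;
    by [meet_op] the factor is [- op G x i], whose positivity preserves the orientation. *)
Lemma rebuild_seg i : seg G i ->
  meet_at G x i <> meet_at G x (next G i) /\
  tangent (Seg (meet_at G x i) (meet_at G x (next G i))) = tau G i.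
Proof.
  intros Hs; destruct (seg_edge G i HG Hs) as (J1 & J2 & _).
  destruct (tangent_seg (meet_at G x i) (meet_at G x (next G i)) (tau G i) (- op G x i))
    as (T1 & T2 & _); [apply tau_unit; [easy|apply Hs]|now apply x_length| |easy].
  rewrite <- meet_op by easy.
  assert (E : meet_at G x (next G i) = meet (tau G i) (tau G (next G i)) (x i) (x (next G i)))
    by (unfold meet_at; now rewrite prev_next by apply Hs).
  rewrite <- E; fold (meet_at G x i); apply on_line_scal; [apply tau_unit; [easy|apply Hs]|].
  rewrite dot_minus_l, (proj2 (meet_at_spec i J1)).
  assert (E2 := proj1 (meet_at_spec _ J2)); rewrite prev_next in E2 by apply Hs.
  rewrite E2; ring.
Qed.

Lemma rebuild_tau i : (i < nb_edges G)%nat ->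
  nondegenerate (edge_of (rebuild G x) i) /\ tau (rebuild G x) i = tau G i.
Proof.
  intros Hi; assert (HE := rebuild_edge i Hi); assert (HN := proj1 (proj2 HG) i Hi).
  unfold tau; destruct (edge_of G i) as [a b|d b|a d] eqn:E.
  - assert (Hs : seg G i) by (split; [easy|now rewrite E]).
    destruct (rebuild_seg i Hs) as [S1 S2]; rewrite HE; split; [easy|].
    rewrite S2; unfold tau; now rewrite E.
  - destruct HE as [-> _]; easy.
  - destruct HE as [-> _]; easy.
Qed.

Lemma rebuild_level i : (i < nb_edges G)%nat -> level (rebuild G x) i = x i.
Proof.
  intros Hi; unfold level; rewrite (proj2 (rebuild_tau i Hi)).
  assert (HE := rebuild_edge i Hi).
  destruct (edge_of G i) as [a b|d b|a d] eqn:E.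
  - assert (Hs : seg G i) by (split; [easy|now rewrite E]).
    rewrite HE; apply meet_at_spec; now apply seg_edge.
  - destruct HE as [-> HJ]; simpl; destruct (meet_at_spec _ HJ) as [H _].
    now rewrite prev_next in H.
  - destruct HE as [-> HJ]; simpl; now apply meet_at_spec.
Qed.

Lemma rebuild_parallel : parallel G (rebuild G x).
Proof.
  assert (Hn := nb_edges_pos G HG); assert (HB := nb_edges_rebuild G x).
  split; [|split; [|split; [easy|]]].
  - split; [apply rebuild_nonempty|split].
    + intros i Hi; rewrite HB in Hi; now apply rebuild_tau.
    + intros i [Hi Hj]; rewrite HB in Hi.
      assert (E : prev (rebuild G x) i = prev G i) by (unfold prev; now rewrite HB).
      fold (tau (rebuild G x) (prev (rebuild G x) i)); fold (tau (rebuild G x) i).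
      rewrite E, !(fun i H => proj2 (rebuild_tau i H)) by (easy || now apply prev_lt).
      apply turn_neq_0; [easy|]; split; [easy|].
      destruct Hj as [Hj|Hj]; [left|now right]; now destruct G.
  - now destruct G.
  - intros i Hi; destruct (rebuild_tau i Hi) as [HN HT]; assert (HL := rebuild_level i Hi).
    assert (HE := rebuild_edge i Hi); assert (HN0 := proj1 (proj2 HG) i Hi).
    assert (HR := x_ray i Hi); unfold level, tau in *.
    destruct (edge_of G i) as [a b|d b|a d] eqn:E.
    + rewrite HE in *; split; [easy|split; [unfold normal; now rewrite HT|easy]].
    + destruct HE as [HE _]; rewrite HE in *; apply parallel_rayin; [easy|].
      simpl in *; rewrite HL; symmetry; apply HR; easy.
    + destruct HE as [HE _]; rewrite HE in *; apply parallel_rayout; [easy|].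
      simpl in *; rewrite HL; symmetry; apply HR; easy.
Qed.

End Rebuild.

(** * Facets of the Wulff shape *)

Definition flen (F : edge) : R := real (H1 F).

Lemma facet_endpoints phi F : facet phi F ->
  exists a, F = Seg a (plus a (scal (flen F) (tangent F))) /\ 0 < flen F /\
    Wulff phi a /\ Wulff phi (plus a (scal (flen F) (tangent F))).
Proof.
  destruct F as [a b|d b|a d]; [|now intros []..].
  intros (_ & Hn & _ & HF); exists a.
  assert (E : b = plus a (scal (flen (Seg a b)) (tangent (Seg a b)))).
  { transitivity (plus a (minus b a)); [destruct a, b; plane; f_equal; ring|].
    f_equal; exact (seg_vector a b Hn). }
  assert (Ha : in_edge (Seg a b) a).
  { exists 0; split; [lra|]; destruct a, b; plane; f_equal; ring. }
  assert (Hb : in_edge (Seg a b) b).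
  { exists 1; split; [lra|]; destruct a, b; plane; f_equal; ring. }
  rewrite <- E; split; [easy|split; [now apply norm_minus_pos|]].
  split; now apply HF.
Qed.

Lemma in_seg_dot (a u x : pt) L : in_edge (Seg a (plus a (scal L u))) x ->
  exists s, 0 <= s <= 1 /\ dot x u = dot a u + s * L * dot u u.
Proof.
  intros (s & Hs & ->); exists s; split; [easy|]; destruct a, u; plane; ring.
Qed.

(** Each facet is the set where the Wulff shape maximizes the product with the normal, so equal
    normals give the same segment. By symmetry one inequality is enough. *)
Lemma facet_same_length phi F F' : facet phi F -> facet phi F' -> normal F = normal F' ->
  flen F = flen F'.
Proof.
  assert (H : forall F F', facet phi F -> facet phi F' -> normal F = normal F' -> flen F <= flen F').
  { clear; intros F F' HF HF' HN.
    assert (Ht : tangent F = tangent F') by now apply rot90_inj.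
    assert (Hu : dot (tangent F) (tangent F) = 1) by now apply tangent_unit, HF.
    destruct (facet_endpoints phi F HF) as (a & EF & HL & Wa & Wb).
    destruct (facet_endpoints phi F' HF') as (a' & EF' & HL' & Wa' & Wb').
    assert (HE : dot a (normal F) = dot a' (normal F)).
    { apply Rle_antisym.
      - rewrite HN; replace a' with (base F') by now rewrite EF'.
        now apply HF'.
      - replace a with (base F) by now rewrite EF.
        now apply HF. }
    assert (HI : forall x, in_edge F x -> in_edge F' x).
    { intros x Hx; apply HF in Hx; apply HF'; split; [easy|].
      rewrite <- HN; rewrite EF' at 1; simpl base; rewrite <- HE.
      destruct Hx as [_ Hx]; rewrite Hx; rewrite EF at 1; easy. }
    set (L := flen F) in *; set (L' := flen F') in *; set (u := tangent F) in *.
    rewrite <- Ht in EF', Wb'.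
    assert (Ia : in_edge F' a).
    { apply HI; rewrite EF; exists 0; split; [lra|]; destruct a; plane; f_equal; ring. }
    assert (Ib : in_edge F' (plus a (scal L u))).
    { apply HI; rewrite EF; exists 1; split; [lra|]; destruct a, u; plane; f_equal; ring. }
    rewrite EF' in Ia, Ib; apply in_seg_dot in Ia, Ib.
    destruct Ia as (s & Hs & Ea), Ib as (s' & Hs' & Eb).
    rewrite dot_plus_l, dot_scal_l in Eb.
    rewrite Hu in *; nra. }
  intros HF HF' HN; apply Rle_antisym; now apply H.
Qed.

Lemma rot90_unit (u : pt) : dot u u = 1 -> norm (rot90 u) = 1.
Proof.
  intros H; rewrite norm_dot; replace (dot (rot90 u) (rot90 u)) with (dot u u)
    by (destruct u; plane; ring).
  rewrite H; apply sqrt_1.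
Qed.

Lemma facet_dual phi F : anisotropy phi -> facet phi F ->
  dual phi (normal F) = dot (base F) (normal F) /\ 0 < dual phi (normal F).
Proof.
  intros (_ & _ & Hh & c & C & HC & Hb) HF.
  assert (Hu : dot (tangent F) (tangent F) = 1) by now apply tangent_unit, HF.
  assert (E : dual phi (normal F) = dot (base F) (normal F)).
  { unfold dual; rewrite (is_lub_Rbar_unique _ (Finite (dot (base F) (normal F)))); [easy|].
    split.
    - intros r (y & Hy & ->); simpl; rewrite dot_comm; now apply HF.
    - intros l Hl; apply Hl; exists (base F); split; [|apply dot_comm].
      apply (proj1 (proj2 (proj2 (proj2 HF)) (base F))).
      destruct (facet_endpoints phi F HF) as (a & -> & _).
      exists 0; split; [lra|]; destruct a; plane; f_equal; ring. }
  split; [easy|]; rewrite E.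
  (* The upper bound C on [phi] puts the point [normal F] / C into the Wulff shape. *)
  apply Rlt_le_trans with (dot (scal (/ C) (normal F)) (normal F)).
  - assert (HN := norm_sqr (normal F)); unfold normal in *.
    rewrite (rot90_unit _ Hu) in HN; rewrite dot_scal_l, <- HN.
    rewrite !Rmult_1_r; apply Rinv_0_lt_compat; lra.
  - apply HF; unfold Wulff; rewrite Hh by (left; apply Rinv_0_lt_compat; lra).
    assert (Hn : norm (normal F) = 1) by now apply rot90_unit.
    destruct (Hb (normal F)) as [_ H2]; rewrite Hn, Rmult_1_r in H2.
    apply (Rmult_le_compat_l (/ C)) in H2; [|left; apply Rinv_0_lt_compat; lra].
    rewrite Rinv_l in H2; lra.
Qed.

Section Facets.

Variable phi : pt -> R.
Variable G : curve.
Variable F : nat -> edge.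
Hypothesis phi_anis : anisotropy phi.
Hypothesis HG : polygonal G.
Hypothesis HF : facets_of phi G F.

(** The support function of the Wulff shape at the normal of S_i, hence also the level of the line
    of the facet. *)
Definition supp (i : nat) : R := dual phi (rot90 (tau G i)).

Lemma facet_tangent i : (i < nb_edges G)%nat -> tangent (F i) = tau G i.
Proof.
  intros Hi; destruct (proj1 HF i Hi) as [_ H]; symmetry; now apply rot90_inj.
Qed.

Lemma supp_bound i x : (i < nb_edges G)%nat -> Wulff phi x -> dot x (rot90 (tau G i)) <= supp i.
Proof.
  intros Hi Hx; destruct (proj1 HF i Hi) as [H1 H2]; destruct (facet_dual phi _ phi_anis H1) as [H3 _].
  unfold supp; rewrite <- (facet_tangent i Hi); change (rot90 (tangent (F i))) with (normal (F i)).
  rewrite H3; now apply H1.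
Qed.

Lemma supp_pos i : (i < nb_edges G)%nat -> 0 < supp i.
Proof.
  intros Hi; destruct (proj1 HF i Hi) as [H1 H2]; destruct (facet_dual phi _ phi_anis H1) as [_ H3].
  unfold supp; rewrite <- (facet_tangent i Hi); exact H3.
Qed.

Lemma facet_ends i : (i < nb_edges G)%nat ->
  exists a, let b := plus a (scal (flen (F i)) (tau G i)) in
    F i = Seg a b /\ 0 < flen (F i) /\ Wulff phi a /\ Wulff phi b /\
    dot a (rot90 (tau G i)) = supp i.
Proof.
  intros Hi; destruct (proj1 HF i Hi) as [H1 H2].
  destruct (facet_endpoints phi _ H1) as (a & E & HL & Wa & Wb).
  rewrite (facet_tangent i Hi) in *; exists a; cbv zeta.
  split; [easy|]; do 3 (split; [easy|]).
  unfold supp; rewrite <- (facet_tangent i Hi); change (rot90 (tangent (F i))) with (normal (F i)).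
  rewrite (proj1 (facet_dual phi _ phi_anis H1)); rewrite E at 2; easy.
Qed.

Lemma dot_along (a u w : pt) L : dot (plus a (scal L u)) (rot90 w) = dot a (rot90 w) + L * cross w u.
Proof. rewrite dot_plus_l, dot_scal_l, (dot_rot90 u w); ring. Qed.

Lemma cross_self (u : pt) : cross u u = 0.
Proof. unfold cross; ring. Qed.

Lemma plus_scal_back (p q : pt) k : plus (plus p (scal k q)) (scal (- k) q) = p.
Proof. destruct p, q; plane; f_equal; ring. Qed.

(* The Wulff shape lies to the right of its oriented facets, so that a common vertex of
   consecutive facets ends the first one and starts the second one when [turn] is negative. *)
Lemma common_vertex i : joint G i -> exists v,
  v = meet (tau G (prev G i)) (tau G i) (supp (prev G i)) (supp i) /\
  Wulff phi v /\
  dot v (rot90 (tau G (prev G i))) = supp (prev G i) /\ dot v (rot90 (tau G i)) = supp i /\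
  (turn G i < 0 -> Wulff phi (plus v (scal (- flen (F (prev G i))) (tau G (prev G i)))) /\
                   Wulff phi (plus v (scal (flen (F i)) (tau G i))) /\
                   base (F i) = v) /\
  (0 < turn G i -> Wulff phi (plus v (scal (flen (F (prev G i))) (tau G (prev G i)))) /\
                   Wulff phi (plus v (scal (- flen (F i)) (tau G i))) /\
                   plus (base (F i)) (scal (flen (F i)) (tau G i)) = v /\
                   base (F (prev G i)) = v) /\
  (turn G i < 0 -> plus (base (F (prev G i))) (scal (flen (F (prev G i))) (tau G (prev G i))) = v).
Proof.
  intros Hj; assert (Hi := proj1 Hj).
  assert (Hp : (prev G i < nb_edges G)%nat) by now apply prev_lt, nb_edges_pos.
  destruct (proj2 HF i Hj) as (v & Hv1 & Hv2).
  destruct (facet_ends i Hi) as (a & E & HL & Wa & Wb & Ea).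
  destruct (facet_ends _ Hp) as (a' & E' & HL' & Wa' & Wb' & Ea').
  set (u := tau G i) in *; set (u' := tau G (prev G i)) in *.
  set (L := flen (F i)) in *; set (L' := flen (F (prev G i))) in *.
  assert (HD : turn G i = cross u' u) by easy.
  assert (HD' : cross u u' = - turn G i) by (rewrite HD; apply cross_anti).
  rewrite E' in Hv1; rewrite E in Hv2.
  assert (V1 : dot v (rot90 u') = supp (prev G i)).
  { destruct Hv1 as [->| ->]; [easy|]; rewrite dot_along, cross_self; lra. }
  assert (V2 : dot v (rot90 u) = supp i).
  { destruct Hv2 as [->| ->]; [easy|]; rewrite dot_along, cross_self; lra. }
  assert (B1 := supp_bound _ a Hp Wa); assert (B2 := supp_bound _ _ Hp Wb).
  assert (B3 := supp_bound _ a' Hi Wa'); assert (B4 := supp_bound _ _ Hi Wb').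
  fold u u' in B1, B2, B3, B4; rewrite dot_along in B2, B4; rewrite <- HD in B2; rewrite HD' in B4.
  exists v; split; [now apply meet_unique; [apply turn_neq_0|..]|].
  split; [destruct Hv2 as [->| ->]; easy|].
  split; [easy|split; [easy|]].
  (* If [v] were the opposite end of one facet, the remaining end of that facet would lie strictly
     beyond the supporting line of the other. *)
  assert (Hneg : turn G i < 0 -> v = a /\ v = plus a' (scal L' u')).
  { intros Hn; split.
    - destruct Hv2 as [Hv|Hv]; [easy|exfalso].
      rewrite Hv, dot_along, <- HD in V1; nra.
    - destruct Hv1 as [Hv|Hv]; [exfalso|easy].
      rewrite Hv in V2; nra. }
  assert (Hpos : 0 < turn G i -> v = plus a (scal L u) /\ v = a').
  { intros Hn; split.
    - destruct Hv2 as [Hv|Hv]; [exfalso|easy].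
      rewrite Hv in V1; nra.
    - destruct Hv1 as [Hv|Hv]; [easy|exfalso].
      rewrite Hv, dot_along, HD' in V2; nra. }
  assert (EB : base (F i) = a) by now rewrite E.
  assert (EB' : base (F (prev G i)) = a') by now rewrite E'.
  split; [|split].
  - intros Hn; destruct (Hneg Hn) as [N1 N2]; split; [|split].
    + rewrite N2, plus_scal_back; easy.
    + rewrite N1; easy.
    + now rewrite EB.
  - intros Hn; destruct (Hpos Hn) as [N1 N2]; split; [|split; [|split]].
    + rewrite N2; easy.
    + rewrite N1, plus_scal_back; easy.
    + now rewrite EB.
    + now rewrite EB'.
  - intros Hn; destruct (Hneg Hn) as [N1 N2]; now rewrite EB'.
Qed.

Lemma mult_neg_cases (x y : R) : x * y < 0 -> (x < 0 /\ 0 < y) \/ (0 < x /\ y < 0).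
Proof.
  intros H; destruct (Rtotal_order x 0) as [Hx|[->|Hx]]; [left|lra|right]; split; nra.
Qed.

(** At the levels [supp] the edges lie on the supporting lines of their facets and meet at vertices
    of the Wulff shape. Edge i then runs along its whole facet forwards, backwards, or from a vertex
    to itself, according to the two turns. *)
Lemma op_supp i : seg G i -> - op G supp i = transition G i * flen (F i).
Proof.
  intros Hs; destruct (seg_edge G i HG Hs) as (J1 & J2 & _).
  destruct (common_vertex i J1) as (v & EV & _ & _ & _ & N1 & P1 & _).
  destruct (common_vertex _ J2) as (w & EW & _ & _ & _ & _ & P2 & N2).
  rewrite prev_next in * by apply Hs.
  rewrite <- meet_op, <- EV, <- EW by easy.
  assert (Hu := tau_unit G i HG (proj1 Hs)); rewrite dot_minus_l.
  destruct (transition_seg G i HG Hs) as [(D1 & D2 & ->)|[(D1 & D2 & ->)|(D & ->)]].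
  - destruct (N1 D1) as (_ & _ & <-); rewrite <- (N2 D2).
    rewrite dot_plus_l, dot_scal_l, Hu; ring.
  - destruct (P1 D1) as (_ & _ & <- & _); destruct (P2 D2) as (_ & _ & _ & <-).
    rewrite dot_plus_l, dot_scal_l, Hu; ring.
  - destruct (mult_neg_cases _ _ D) as [[D1 D2]|[D1' D2]].
    + destruct (N1 D1) as (_ & _ & <-); destruct (P2 D2) as (_ & _ & _ & <-); ring.
    + destruct (P1 D1') as (_ & _ & <- & _); rewrite <- (N2 D2); ring.
Qed.

Lemma unit_parallel (u w : pt) : dot u u = 1 -> dot w w = 1 -> cross u w = 0 ->
  w = u \/ w = scal (-1) u.
Proof.
  intros Hu Hw HC.
  assert (E : w = scal (dot w u) u)
    by (apply on_line_scal; [easy|now rewrite dot_rot90]).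
  assert (HL := lagrange u w); rewrite HC, Hu, Hw in HL.
  rewrite dot_comm in HL; assert (H : (dot w u - 1) * (dot w u + 1) = 0) by nra.
  apply Rmult_integral in H; destruct H as [H|H]; [left|right]; rewrite E.
  - replace (dot w u) with 1 by lra; destruct u; plane; f_equal; ring.
  - f_equal; lra.
Qed.

(** Opposite turns make both neighbouring facets meet F_i at the same vertex. The far end of each
    lies below the supporting line of the other, which gives both signs of the cross product of the
    tangents, so they are parallel. *)
Lemma transition_0_tau i : seg G i -> transition G i = 0 ->
  tau G (next G i) = tau G (prev G i).
Proof.
  intros Hs HT; destruct (seg_edge G i HG Hs) as (J1 & J2 & _).
  assert (Hp : (prev G i < nb_edges G)%nat) by now apply prev_lt, nb_edges_pos.
  assert (Hx : (next G i < nb_edges G)%nat) by now apply next_lt, nb_edges_pos.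
  destruct (common_vertex i J1) as (v & EV & _ & V1 & _ & N1 & P1 & _).
  destruct (common_vertex _ J2) as (w & EW & _ & _ & W1 & N2' & P2 & N2).
  destruct (facet_ends _ Hp) as (_ & _ & Lp & _).
  destruct (facet_ends _ Hx) as (_ & _ & Lx & _).
  rewrite prev_next in * by apply Hs.
  assert (D : turn G i * turn G (next G i) < 0).
  { destruct (transition_seg G i HG Hs) as [(_ & _ & E)|[(_ & _ & E)|(D & _)]]; [lra|lra|easy]. }
  assert (HC : cross (tau G (prev G i)) (tau G (next G i)) = 0).
  { assert (A := cross_anti (tau G (prev G i)) (tau G (next G i))).
    destruct (mult_neg_cases _ _ D) as [[D1 D2]|[D1' D2]].
    - destruct (N1 D1) as (A1 & _ & Ev); destruct (P2 D2) as (_ & A2 & _ & Ew).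
      apply (supp_bound _ _ Hx) in A1; apply (supp_bound _ _ Hp) in A2.
      rewrite dot_along in A1, A2; rewrite <- Ev, Ew, W1 in A1; rewrite <- Ew, Ev, V1 in A2; nra.
    - destruct (P1 D1') as (A1 & _ & Ev & _); destruct (N2' D2) as (_ & A2 & _).
      assert (Ew := N2 D2).
      apply (supp_bound _ _ Hx) in A1; apply (supp_bound _ _ Hp) in A2.
      rewrite dot_along in A1, A2; rewrite <- Ev, Ew, W1 in A1; rewrite <- Ew, Ev, V1 in A2; nra. }
  destruct (unit_parallel _ _ (tau_unit G _ HG Hp) (tau_unit G _ HG Hx) HC) as [E|E]; [easy|].
  (* With opposite tangents of the neighbours the two turns would be equal. *)
  exfalso; unfold turn in D; rewrite prev_next in D by apply Hs; rewrite E in D.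
  assert (A := cross_anti (tau G i) (tau G (prev G i))).
  replace (cross (tau G i) (scal (-1) (tau G (prev G i))))
    with (- cross (tau G i) (tau G (prev G i))) in D
    by (destruct (tau G i), (tau G (prev G i)); plane; ring).
  assert (0 <= cross (tau G (prev G i)) (tau G i) ^ 2) by apply pow2_ge_0; nra.
Qed.

End Facets.

(** * Bounded Lipschitz functions of finitely many variables *)

Definition dist_sum (n : nat) (x y : nat -> R) : R := rsum n (fun j => Rabs (x j - y j)).

Definition lip (n : nat) (g : (nat -> R) -> R) : Prop :=
  exists K, 0 <= K /\ forall x y, Rabs (g x - g y) <= K * dist_sum n x y.

(** Boundedness is included because Lipschitz functions alone are not closed under products. *)
Definition tame (n : nat) (g : (nat -> R) -> R) : Prop :=
  lip n g /\ exists M, 0 <= M /\ forall x, Rabs (g x) <= M.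

Lemma dist_sum_nonneg n x y : 0 <= dist_sum n x y.
Proof. apply rsum_nonneg; intros; apply Rabs_pos. Qed.

Lemma lip_proj n j : (j < n)%nat -> lip n (fun x => x j).
Proof.
  intros Hj; exists 1; split; [lra|]; intros x y; rewrite Rmult_1_l.
  apply (rsum_term n (fun j => Rabs (x j - y j))); [intros; apply Rabs_pos|easy].
Qed.

Lemma lip_plus n f g : lip n f -> lip n g -> lip n (fun x => f x + g x).
Proof.
  intros (K & HK & Hf) (L & HL & Hg); exists (K + L); split; [lra|]; intros x y.
  replace (f x + g x - (f y + g y)) with ((f x - f y) + (g x - g y)) by ring.
  eapply Rle_trans; [apply Rabs_triang|]; specialize (Hf x y); specialize (Hg x y); lra.
Qed.

Lemma lip_scal n c f : lip n f -> lip n (fun x => c * f x).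
Proof.
  intros (K & HK & Hf); assert (0 <= Rabs c) by apply Rabs_pos.
  exists (Rabs c * K); split; [nra|]; intros x y.
  rewrite <- Rmult_minus_distr_l, Rabs_mult, Rmult_assoc.
  apply Rmult_le_compat_l; [easy|apply Hf].
Qed.

Lemma lip_ext n f g : (forall x, f x = g x) -> lip n f -> lip n g.
Proof. intros E (K & HK & H); exists K; split; [easy|]; intros x y; rewrite <- !E; apply H. Qed.

Lemma tame_ext n f g : (forall x, f x = g x) -> tame n f -> tame n g.
Proof.
  intros E (H & M & HM & HM'); split; [now apply (lip_ext n f)|].
  exists M; split; [easy|]; intros x; rewrite <- E; apply HM'.
Qed.

Lemma tame_const n c : tame n (fun _ => c).
Proof.
  split; [|exists (Rabs c); split; [apply Rabs_pos|intros; lra]].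
  exists 0; split; [lra|]; intros x y; rewrite Rminus_diag, Rabs_R0; lra.
Qed.

Lemma tame_plus n f g : tame n f -> tame n g -> tame n (fun x => f x + g x).
Proof.
  intros (Hf & M & HM & Hf') (Hg & N & HN & Hg'); split; [now apply lip_plus|].
  exists (M + N); split; [lra|]; intros x.
  eapply Rle_trans; [apply Rabs_triang|]; specialize (Hf' x); specialize (Hg' x); lra.
Qed.

Lemma tame_mult n f g : tame n f -> tame n g -> tame n (fun x => f x * g x).
Proof.
  intros ((K & HK & Hf) & M & HM & Hf') ((L & HL & Hg) & N & HN & Hg'); split.
  - exists (K * N + M * L); split; [nra|]; intros x y.
    replace (f x * g x - f y * g y) with ((f x - f y) * g x + f y * (g x - g y)) by ring.
    eapply Rle_trans; [apply Rabs_triang|]; rewrite !Rabs_mult, Rmult_plus_distr_r.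
    assert (D := dist_sum_nonneg n x y).
    specialize (Hf x y); specialize (Hg x y); specialize (Hf' y); specialize (Hg' x).
    apply Rplus_le_compat.
    + replace (K * N * dist_sum n x y) with (K * dist_sum n x y * N) by ring.
      apply Rmult_le_compat; [apply Rabs_pos|apply Rabs_pos|easy|easy].
    + rewrite Rmult_assoc; apply Rmult_le_compat; [apply Rabs_pos|apply Rabs_pos|easy|easy].
  - exists (M * N); split; [nra|]; intros x; rewrite Rabs_mult.
    apply Rmult_le_compat; [apply Rabs_pos|apply Rabs_pos|apply Hf'|apply Hg'].
Qed.

Lemma Rmax_lip m a b : Rabs (Rmax m a - Rmax m b) <= Rabs (a - b).
Proof.
  unfold Rmax; destruct (Rle_dec m a), (Rle_dec m b); unfold Rabs;
    repeat destruct Rcase_abs; lra.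
Qed.

Lemma tame_inv_Rmax n m g : 0 < m -> lip n g -> tame n (fun x => / Rmax m (g x)).
Proof.
  intros Hm (K & HK & Hg).
  assert (HP : forall x, m <= Rmax m (g x)) by (intros; apply Rmax_l).
  assert (HI : 0 < / m) by now apply Rinv_0_lt_compat.
  assert (HB : forall x, 0 < / Rmax m (g x) <= / m).
  { intros x; specialize (HP x); split; [apply Rinv_0_lt_compat; lra|now apply Rinv_le_contravar]. }
  split.
  - exists (/ m * / m * K); split; [apply Rmult_le_pos; nra|]; intros x y.
    assert (Hx := HP x); assert (Hy := HP y).
    replace (/ Rmax m (g x) - / Rmax m (g y))
      with (/ Rmax m (g x) * / Rmax m (g y) * (Rmax m (g y) - Rmax m (g x))) by (field; lra).
    rewrite 2!Rabs_mult, !(Rabs_pos_eq (/ _)) by (left; apply HB).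
    rewrite Rmult_assoc with (r3 := dist_sum n x y).
    assert (H1 := HB x); assert (H2 := HB y).
    apply Rmult_le_compat.
    + apply Rmult_le_pos; lra.
    + apply Rabs_pos.
    + apply Rmult_le_compat; lra.
    + rewrite Rabs_minus_sym; eapply Rle_trans; [apply Rmax_lip|apply Hg].
  - exists (/ m); split; [lra|]; intros x; rewrite Rabs_pos_eq; [|left]; apply HB.
Qed.

Lemma tame_uniform n (f : (nat -> R) -> nat -> R) (k : nat) :
  (forall i, (i < k)%nat -> tame n (fun x => f x i)) ->
  exists K M, 0 <= K /\ 0 <= M /\ forall i, (i < k)%nat ->
    (forall x y, Rabs (f x i - f y i) <= K * dist_sum n x y) /\ (forall x, Rabs (f x i) <= M).
Proof.
  induction k as [|k IH]; intros H; [exists 0, 0; repeat split; lra || lia|].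
  destruct IH as (K & M & HK & HM & HI); [intros; apply H; lia|].
  destruct (H k ltac:(lia)) as ((K' & HK' & H1) & M' & HM' & H2).
  exists (K + K'), (M + M'); split; [lra|split; [lra|]]; intros i Hi.
  destruct (Nat.eq_dec i k) as [->|Hk].
  - split; [intros x y; specialize (H1 x y); assert (D := dist_sum_nonneg n x y); nra|].
    intros x; specialize (H2 x); lra.
  - destruct (HI i ltac:(lia)) as [H3 H4].
    split; [intros x y; specialize (H3 x y); assert (D := dist_sum_nonneg n x y); nra|].
    intros x; specialize (H4 x); lra.
Qed.

Lemma continuous_Rmax_0 t : continuous (fun s => Rmax 0 s) t.
Proof.
  apply lipschitz_continuous with (L := 1); intros s u; rewrite Rmult_1_l; apply Rmax_lip.
Qed.

Lemma locally_Rbar_lt (t : R) T : Rbar_lt t T -> locally t (fun s => Rbar_lt s T).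
Proof.
  destruct T as [T| |]; simpl; [apply (open_lt T)| |easy].
  intros _; exists (mkposreal 1 Rlt_0_1); easy.
Qed.

Lemma Rmax_0_lt (t : R) (T : Rbar) : Rbar_lt 0 T -> Rbar_lt t T -> Rbar_lt (Rmax 0 t) T.
Proof. intros H0 Ht; unfold Rmax; destruct (Rle_dec 0 t); [exact Ht|exact H0]. Qed.

(** * The equation for the levels *)

Definition len (G : curve) (x : nat -> R) (i : nat) : R := - op G x i.

(** Minus the derivative of the elastic energy c_j^2 delta_j / l_j with respect to the length. *)
Definition weight (phi : pt -> R) (F : nat -> edge) (G : curve) (l : nat -> R) (j : nat) : R :=
  transition G j ^ 2 * delta phi F G j / l j ^ 2.

(** The flow law solved for h_i', as a function of arbitrary lengths [l], so that truncated lengths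
    can be inserted. *)
Definition velocity (phi : pt -> R) (alpha : R) (F : nat -> edge) (G : curve)
    (l : nat -> R) (i : nat) : R :=
  supp phi G i * (- (transition G i * flen (F i)) - alpha * op G (weight phi F G l) i) / l i.

Lemma op_ext G x y i : (i < nb_edges G)%nat ->
  (forall j, (j < nb_edges G)%nat -> x j = y j) -> op G x i = op G y i.
Proof.
  intros Hi H; unfold op; rewrite !H; [easy|now apply next_lt; lia|easy|now apply prev_lt; lia].
Qed.

(** The values of [l] on half-lines do not matter, because c_j = 0 removes their weights. *)
Lemma velocity_ext phi alpha F G l l' i : seg G i ->
  (forall j, seg G j -> l j = l' j) ->
  velocity phi alpha F G l i = velocity phi alpha F G l' i.
Proof.
  intros Hs H; unfold velocity; rewrite H by easy.
  rewrite (op_ext G _ (weight phi F G l')); [easy|apply Hs|].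
  intros j Hj; unfold weight; destruct (classic (is_seg (edge_of G j))) as [Hj'|Hj'].
  - now rewrite H by (split; easy).
  - rewrite transition_not_seg by easy; unfold Rdiv; ring.
Qed.

Lemma op_lip G j : (j < nb_edges G)%nat -> lip (nb_edges G) (fun x => op G x j).
Proof.
  intros Hj.
  apply (lip_ext _ (fun x => / turn G j * x (prev G j)
    + (- (dot (tau G (prev G j)) (tau G j) / turn G j
          + dot (tau G j) (tau G (next G j)) / turn G (next G j)) * x j
    + / turn G (next G j) * x (next G j)))).
  - intros x; unfold op, Rdiv; ring.
  - repeat apply lip_plus; apply lip_scal, lip_proj; [apply prev_lt|easy|apply next_lt]; lia.
Qed.

Lemma continuous_op G (x : R -> nat -> R) t i : (i < nb_edges G)%nat ->
  (forall j, (j < nb_edges G)%nat -> continuous (fun s => x s j) t) ->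
  continuous (fun s => op G (x s) i) t.
Proof.
  intros Hi H; unfold op, Rdiv.
  apply (continuous_plus (V := R_NormedModule)); [apply (continuous_minus (V := R_NormedModule))|];
    apply (continuous_mult (K := R_AbsRing)); try apply continuous_const; apply H;
    [apply prev_lt|easy|apply next_lt]; lia.
Qed.

Lemma continuous_len G (x : R -> nat -> R) t i : (i < nb_edges G)%nat ->
  (forall j, (j < nb_edges G)%nat -> continuous (fun s => x s j) t) ->
  continuous (fun s => len G (x s) i) t.
Proof.
  intros Hi H; unfold len; apply (continuous_opp (V := R_NormedModule)); now apply continuous_op.
Qed.

Lemma continuous_velocity phi alpha F G (l : R -> nat -> R) t i : seg G i ->
  (forall j, seg G j -> continuous (fun s => l s j) t /\ l t j <> 0) ->
  continuous (fun s => velocity phi alpha F G (l s) i) t.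
Proof.
  intros Hs H; unfold velocity, Rdiv.
  apply (continuous_mult (K := R_AbsRing)); [|now apply continuous_Rinv_comp; apply H].
  apply (continuous_mult (K := R_AbsRing)); [apply continuous_const|].
  apply (continuous_minus (V := R_NormedModule)); [apply continuous_const|].
  apply (continuous_mult (K := R_AbsRing)); [apply continuous_const|].
  apply (continuous_op G (fun s => weight phi F G (l s))); [apply Hs|]; intros j Hj.
  unfold weight; destruct (classic (is_seg (edge_of G j))) as [Hj'|Hj'].
  - destruct (H j (conj Hj Hj')) as [H1 H2]; unfold Rdiv.
    apply (continuous_mult (K := R_AbsRing)); [apply continuous_const|].
    apply continuous_Rinv_comp; [|now apply pow_nonzero].
    simpl; apply (continuous_mult (K := R_AbsRing)); [easy|].
    apply (continuous_mult (K := R_AbsRing)); [easy|apply continuous_const].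
  - apply (continuous_ext (fun _ => 0)); [|apply continuous_const].
    intros s; change (0 = transition G j ^ 2 * delta phi F G j / l s j ^ 2).
    rewrite transition_not_seg by easy; unfold Rdiv; ring.
Qed.

Lemma tame_velocity phi alpha F G m i : seg G i -> 0 < m ->
  tame (nb_edges G) (fun x => velocity phi alpha F G (fun j => Rmax m (len G x j)) i).
Proof.
  intros Hs Hm; assert (Hi := proj1 Hs).
  assert (HI : forall j, (j < nb_edges G)%nat ->
               tame (nb_edges G) (fun x => / Rmax m (len G x j))).
  { intros j Hj; apply tame_inv_Rmax; [easy|].
    apply (lip_ext _ (fun x => -1 * op G x j)); [intros; unfold len; ring|].
    now apply lip_scal, op_lip. }
  assert (HW : forall j, (j < nb_edges G)%nat ->
               tame (nb_edges G) (fun x => weight phi F G (fun j => Rmax m (len G x j)) j)).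
  { intros j Hj.
    apply (tame_ext _ (fun x => transition G j ^ 2 * delta phi F G j
                                * (/ Rmax m (len G x j) * / Rmax m (len G x j)))).
    - intros x; unfold weight, Rdiv; rewrite <- Rinv_mult; simpl; now rewrite !Rmult_1_r.
    - apply tame_mult; [apply tame_const|apply tame_mult; now apply HI]. }
  unfold velocity, Rdiv, Rminus.
  apply (tame_mult _ (fun x => supp phi G i * (- (transition G i * flen (F i))
    + - (alpha * op G (weight phi F G (fun j => Rmax m (len G x j))) i)))); [|now apply HI].
  apply tame_mult; [apply tame_const|].
  apply tame_plus; [apply tame_const|].
  unfold op; set (p := prev G i); set (q := next G i).
  assert (Hp : (p < nb_edges G)%nat) by (apply prev_lt; lia).
  assert (Hq : (q < nb_edges G)%nat) by (apply next_lt; lia).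
  set (b := _ + _).
  apply (tame_ext _ (fun x =>
    - alpha / turn G i * weight phi F G (fun j => Rmax m (len G x j)) p
    + (alpha * b * weight phi F G (fun j => Rmax m (len G x j)) i
       + - alpha / turn G q * weight phi F G (fun j => Rmax m (len G x j)) q))).
  - intros x; unfold Rdiv; ring.
  - repeat apply tame_plus; (apply tame_mult; [apply tame_const|now apply HW]).
Qed.

(** Negative times are included in the continuity clause: levels are thought of as frozen before
    time 0, which replaces one-sided continuity at 0 by ordinary continuity. *)
Definition solution (phi : pt -> R) (alpha : R) (F : nat -> edge) (G0 : curve)
    (T : Rbar) (x : R -> nat -> R) : Prop :=
  (forall i, (i < nb_edges G0)%nat -> x 0 i = level G0 i) /\
  (forall i, (i < nb_edges G0)%nat -> forall t : R, Rbar_lt t T -> continuous (fun s => x s i) t) /\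
  (forall i, (i < nb_edges G0)%nat -> ~ is_seg (edge_of G0 i) ->
     forall t : R, Rbar_lt t T -> x t i = level G0 i) /\
  (forall i, seg G0 i -> forall t, 0 <= t -> Rbar_lt t T -> 0 < len G0 (x t) i) /\
  (forall i, seg G0 i -> forall t, 0 < t -> Rbar_lt t T ->
     is_derive (fun s => x s i) t (velocity phi alpha F G0 (len G0 (x t)) i)).

(** Each flow comes with its own choice of facets; the equation sees only their lengths, which the
    normals determine. *)
Lemma velocity_facets phi alpha F F' G l i : seg G i ->
  facets_of phi G F -> facets_of phi G F' ->
  velocity phi alpha F G l i = velocity phi alpha F' G l i.
Proof.
  intros Hs HF HF'.
  assert (HE : forall j, (j < nb_edges G)%nat -> flen (F j) = flen (F' j)).
  { intros j Hj; destruct (proj1 HF j Hj) as [H1 H2]; destruct (proj1 HF' j Hj) as [H3 H4].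
    apply (facet_same_length phi); try easy; congruence. }
  unfold velocity; rewrite HE by apply Hs; rewrite (op_ext G _ (weight phi F' G l)); [easy|apply Hs|].
  intros j Hj; unfold weight, delta; change (real (H1 (F j))) with (flen (F j)).
  now rewrite HE.
Qed.

(** By [theta_spec], 1 / sin and cot of the angles are the coefficients of [op], so the elastic
    bracket is [op] applied to the weights. Multiplying by phi° of the normal, which is positive,
    gives the equivalence. *)
Lemma flow_equation phi alpha F G0 G i d : anisotropy phi -> polygonal G0 -> facets_of phi G0 F ->
  parallel G0 G -> seg G0 i ->
  (d / dual phi (normal (edge_of G i)) =
     - curvature F G i - alpha / real (H1 (edge_of G i)) * elastic_term phi F G i <->
   d = velocity phi alpha F G0 (len G0 (level G)) i).
Proof.
  intros Hphi HG0 HF HP Hs; assert (Hi := proj1 Hs).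
  assert (Hn := nb_edges_pos G0 HG0).
  destruct (seg_edge G0 i HG0 Hs) as (J1 & J2 & _).
  assert (Hp : (prev G0 i < nb_edges G0)%nat) by now apply prev_lt.
  assert (Hx : (next G0 i < nb_edges G0)%nat) by now apply next_lt.
  assert (HGP := proj1 HP).
  (* The factor [s] is the sine of an angle or 1. On a half-line the length is a default value, but
     both sides vanish through the transition number. *)
  assert (HW : forall j s, (j < nb_edges G0)%nat ->
    transition G j ^ 2 * delta phi F G j / (real (H1 (edge_of G j)) ^ 2 * s) =
    weight phi F G0 (len G0 (level G)) j / s).
  { intros j s Hj; rewrite (parallel_transition G0 G HG0 HP j Hj); unfold weight, delta.
    destruct (classic (is_seg (edge_of G0 j))) as [Hj'|Hj'].
    - rewrite (proj1 (parallel_length G0 G HG0 HP j (conj Hj Hj'))); simpl real.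
      unfold normal; fold (tau G j) (tau G0 j); rewrite (parallel_tau G0 G HP j Hj).
      change (- op G0 (level G) j) with (len G0 (level G) j).
      unfold Rdiv; rewrite Rinv_mult; ring.
    - rewrite transition_not_seg by easy; unfold Rdiv; ring. }
  assert (HE : elastic_term phi F G i = op G0 (weight phi F G0 (len G0 (level G))) i).
  { unfold elastic_term; rewrite (parallel_prev G0 G HP), (parallel_next G0 G HP).
    rewrite !HW by easy.
    assert (JJ1 := proj2 (parallel_joint G0 G HP i) J1).
    assert (JJ2 := proj2 (parallel_joint G0 G HP _) J2).
    destruct (theta_spec G i HGP JJ1) as (S1 & C1 & _).
    destruct (theta_spec G _ HGP JJ2) as (S2 & C2 & _).
    unfold cot; rewrite S1, S2, C1, C2.
    rewrite !(parallel_turn G0 G HG0 HP), !(parallel_prev G0 G HP) by easy.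
    rewrite prev_next by easy; rewrite !(parallel_tau G0 G HP) by easy.
    assert (HWi := HW i 1 Hi); rewrite Rmult_1_r, Rdiv_1_r in HWi.
    unfold op; rewrite <- HWi; unfold Rdiv; ring. }
  rewrite HE; unfold curvature, velocity.
  change (normal (edge_of G i)) with (rot90 (tau G i)); rewrite (parallel_tau G0 G HP) by easy.
  fold (supp phi G0 i); change (real (H1 (F i))) with (flen (F i)).
  destruct (parallel_length G0 G HG0 HP i Hs) as [-> HL]; simpl real.
  fold (len G0 (level G) i) in *; rewrite (parallel_transition G0 G HG0 HP) by easy.
  assert (HS := supp_pos phi G0 F Hphi HF i Hi).
  set (l := len G0 (level G) i) in *; set (a := op _ _ _).
  split; intros E.
  - apply (f_equal (Rmult (supp phi G0 i))) in E.
    replace (supp phi G0 i * (d / supp phi G0 i)) with d in E by (field; lra).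
    rewrite E; field; lra.
  - rewrite E; field; lra.
Qed.

(** * Correspondence between flows and solutions of the level equation *)

Section Flow.

Variable phi : pt -> R.
Variable alpha : R.
Variable F : nat -> edge.
Variable G0 : curve.
Hypothesis phi_anis : anisotropy phi.
Hypothesis HG0 : polygonal G0.
Hypothesis HF : facets_of phi G0 F.

Lemma flow_solution T G : elastic_flow phi alpha G0 T G ->
  solution phi alpha F G0 T (fun t => level (G (Rmax 0 t))).
Proof.
  intros (HT & HP & F' & HF' & H).
  assert (HM : forall t : R, Rbar_lt t T -> parallel G0 (G (Rmax 0 t)))
    by (intros t Ht; apply HP; [apply Rmax_l|now apply Rmax_0_lt]).
  assert (HH : forall i (t : R), (i < nb_edges G0)%nat -> Rbar_lt t T ->
    height (edge_of G0 i) (edge_of (G (Rmax 0 t)) i) + level G0 i = level (G (Rmax 0 t)) i)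
    by (intros i t Hi Ht; rewrite (parallel_height G0 _ HG0 (HM t Ht)) by easy; ring).
  split; [|split; [|split; [|split]]].
  - intros i Hi; rewrite <- HH by easy.
    destruct (H i Hi) as (_ & _ & H0 & _); rewrite Rmax_left by lra; rewrite H0; ring.
  - intros i Hi t Ht.
    apply (continuous_ext_loc _
      (fun s => height (edge_of G0 i) (edge_of (G (Rmax 0 s)) i) + level G0 i)).
    { generalize (locally_Rbar_lt t T Ht); apply filter_imp; intros s Hs; now apply HH. }
    apply (continuous_plus (V := R_NormedModule)); [|apply continuous_const].
    destruct (H i Hi) as (Hc & _).
    assert (Hc' := Hc (Rmax 0 t) (conj (Rmax_l 0 t) (Rmax_0_lt t T HT Ht))).
    (* Near t the map [Rmax 0] takes values in [0, T), so composing with it turns continuity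
       relative to [0, T) into two-sided continuity, also at 0. *)
    intros P HP'; assert (H1 := continuous_Rmax_0 t _ (Hc' P HP')); clear HP'.
    change (locally t (fun s => 0 <= Rmax 0 s /\ Rbar_lt (Rmax 0 s) T ->
              P (height (edge_of G0 i) (edge_of (G (Rmax 0 s)) i)))) in H1.
    change (locally t (fun s => P (height (edge_of G0 i) (edge_of (G (Rmax 0 s)) i)))).
    generalize (filter_and _ _ H1 (locally_Rbar_lt t T Ht)); apply filter_imp.
    intros s [Hs1 Hs2]; exact (Hs1 (conj (Rmax_l 0 s) (Rmax_0_lt s T HT Hs2))).
  - intros i Hi Hr t Ht; apply parallel_level_ray; [easy|now apply HM|easy|easy].
  - intros i Hs t H0 Ht; now apply (parallel_length G0 _ HG0 (HM t Ht)).
  - intros i Hs t H0 Ht; assert (Hi := proj1 Hs); destruct (H i Hi) as (_ & Hd & _ & Heq & _).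
    specialize (Heq (proj2 Hs) t H0 Ht).
    rewrite (Rmax_right 0 t) by lra.
    apply (flow_equation phi alpha F' G0 (G t)) in Heq; try easy; [|apply HP; [lra|easy]].
    rewrite (velocity_facets phi alpha F F'), <- Heq by easy.
    apply (is_derive_ext_loc (V := R_NormedModule)
      (fun s => height (edge_of G0 i) (edge_of (G s) i) + level G0 i)).
    + generalize (filter_and _ _ (locally_Rbar_lt t T Ht) (open_gt 0 t H0)); apply filter_imp.
      intros s [Hs1 Hs2]; rewrite <- HH by easy; now rewrite Rmax_right by lra.
    + rewrite <- (Rplus_0_r (Derive _ t)).
      apply (is_derive_plus (V := R_NormedModule)); [|apply (is_derive_const (V := R_NormedModule))].
      now apply Derive_correct, Hd.
Qed.

Lemma solution_rebuild T x t : solution phi alpha F G0 T x -> 0 <= t -> Rbar_lt t T ->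
  parallel G0 (rebuild G0 (x t)) /\
  forall i, (i < nb_edges G0)%nat -> level (rebuild G0 (x t)) i = x t i.
Proof.
  intros (H0 & _ & Hr & Hl & _) Ht HT.
  assert (A1 : forall i, seg G0 i -> 0 < - op G0 (x t) i) by (intros; now apply Hl).
  assert (A2 : forall i, (i < nb_edges G0)%nat -> ~ is_seg (edge_of G0 i) -> x t i = level G0 i)
    by (intros; now apply Hr).
  split; [now apply rebuild_parallel|intros; now apply rebuild_level].
Qed.

Lemma solution_flow T x : Rbar_lt 0 T -> solution phi alpha F G0 T x ->
  elastic_flow phi alpha G0 T (fun t => rebuild G0 (x t)).
Proof.
  intros HT Hsol; assert (HR := fun t => solution_rebuild T x t Hsol).
  destruct Hsol as (H0 & Hc & Hr & Hl & Hd).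
  split; [easy|split; [intros t Ht HT'; now apply HR|]].
  exists F; split; [easy|]; intros i Hi h.
  assert (Hh : forall t, 0 <= t -> Rbar_lt t T -> h t = x t i - level G0 i).
  { intros t Ht HT'; destruct (HR t Ht HT') as [HP HL]; unfold h.
    rewrite (parallel_height G0 _ HG0 HP) by easy; now rewrite HL. }
  assert (Hloc : forall t, 0 < t -> Rbar_lt t T -> locally t (fun s => 0 < s /\ Rbar_lt s T))
    by (intros t Ht HT'; apply filter_and; [now apply (open_gt 0)|now apply locally_Rbar_lt]).
  assert (Hder : forall t d, 0 < t -> Rbar_lt t T ->
                 is_derive (fun s => x s i) t d -> is_derive h t d).
  { intros t d Ht HT' Hx.
    apply (is_derive_ext_loc (V := R_NormedModule) (fun s => x s i - level G0 i)).
    - generalize (Hloc t Ht HT'); apply filter_imp; intros s [Hs1 Hs2]; rewrite Hh by (lra || easy); easy.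
    - rewrite <- (Rminus_0_r d); apply (is_derive_minus (V := R_NormedModule)); [easy|].
      apply (is_derive_const (V := R_NormedModule)). }
  assert (Hseg : is_seg (edge_of G0 i) -> forall t, 0 < t -> Rbar_lt t T ->
                 is_derive h t (velocity phi alpha F G0 (len G0 (x t)) i)).
  { intros Hs t Ht HT'; apply Hder; [easy|easy|]; now apply Hd. }
  split; [|split; [|split; [|split]]].
  - intros t [Ht HT']; unfold filterlim, filter_le, filtermap, within; rewrite Hh by easy.
    intros P HP.
    assert (Hcx : continuous (fun s => x s i - level G0 i) t)
      by (apply (continuous_minus (V := R_NormedModule)); [now apply Hc|apply continuous_const]).
    assert (HP' := Hcx P HP); change (locally t (fun s => P (x s i - level G0 i))) in HP'.
    revert HP'; apply filter_imp; intros s Hs [Hs1 Hs2]; now rewrite Hh.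
  - intros t Ht HT'; destruct (classic (is_seg (edge_of G0 i))) as [Hs|Hs].
    + split; [eexists; now apply Hseg|].
      apply (continuous_ext_loc _ (fun s => velocity phi alpha F G0 (len G0 (x s)) i)).
      * generalize (Hloc t Ht HT'); apply filter_imp; intros s [Hs1 Hs2].
        symmetry; apply is_derive_unique; now apply Hseg.
      * apply continuous_velocity; [easy|]; intros j Hj; split.
        -- apply continuous_len; [apply Hj|]; intros k Hk; now apply Hc.
        -- assert (H1 := Hl j Hj t ltac:(lra) HT'); lra.
    + assert (Hz : forall t, 0 < t -> Rbar_lt t T -> is_derive h t 0).
      { intros s Hs1 Hs2; apply Hder; [easy|easy|].
        apply (is_derive_ext_loc (V := R_NormedModule) (fun _ => level G0 i)).
        - generalize (Hloc s Hs1 Hs2); apply filter_imp; intros u [_ Hu]; symmetry; now apply Hr.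
        - apply (is_derive_const (V := R_NormedModule)). }
      split; [eexists; now apply Hz|].
      apply (continuous_ext_loc _ (fun s => 0)); [|apply continuous_const].
      generalize (Hloc t Ht HT'); apply filter_imp; intros s [Hs1 Hs2].
      symmetry; apply is_derive_unique; now apply Hz.
  - rewrite Hh by (easy || lra); rewrite H0 by easy; ring.
  - intros Hs t Ht HT'; destruct (HR t ltac:(lra) HT') as [HP HL].
    apply (flow_equation phi alpha F G0); [easy..|].
    rewrite (is_derive_unique h t _ (Hseg Hs t Ht HT')).
    apply velocity_ext; [easy|]; intros j Hj; unfold len.
    rewrite (op_ext G0 (level (rebuild G0 (x t))) (x t)); [easy|apply Hj|easy].
  - intros Hs t Ht HT'; rewrite Hh, Hr by easy; ring.
Qed.

(** * The truncated equation, uniqueness and local existence *)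

Definition truncated (m : R) (x : nat -> R) (i : nat) : R :=
  if excluded_middle_informative (seg G0 i)
  then velocity phi alpha F G0 (fun j => Rmax m (len G0 x j)) i else 0.

Lemma truncated_lip m : 0 < m -> exists K M,
  (forall x y i, Rabs (truncated m x i - truncated m y i) <= K * dist_sum (nb_edges G0) x y) /\
  (forall x i, Rabs (truncated m x i) <= M).
Proof.
  intros Hm.
  destruct (tame_uniform (nb_edges G0) (truncated m) (nb_edges G0)) as (K & M & HK & HM & H).
  - intros i Hi; unfold truncated; destruct (excluded_middle_informative (seg G0 i)) as [Hs|Hs];
      [now apply tame_velocity|apply tame_const].
  (* [picard_exists] asks for bounds at every index, including those beyond the edges. *)
  - assert (HZ : forall x i, ~ (i < nb_edges G0)%nat -> truncated m x i = 0).
    { intros x i Hi; unfold truncated.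
      destruct (excluded_middle_informative (seg G0 i)) as [[Hs _]|Hs]; easy. }
    exists K, M; split.
    + intros x y i; destruct (lt_dec i (nb_edges G0)) as [Hi|Hi]; [now apply H|].
      rewrite !HZ, Rminus_diag, Rabs_R0 by easy.
      assert (D := dist_sum_nonneg (nb_edges G0) x y); nra.
    + intros x i; destruct (lt_dec i (nb_edges G0)) as [Hi|Hi]; [now apply H|].
      rewrite HZ, Rabs_R0 by easy; easy.
Qed.

Lemma truncated_eq m x i : seg G0 i -> (forall j, seg G0 j -> m <= len G0 x j) ->
  truncated m x i = velocity phi alpha F G0 (len G0 x) i.
Proof.
  intros Hs H; unfold truncated.
  destruct (excluded_middle_informative (seg G0 i)) as [_|Hs']; [|easy].
  apply velocity_ext; [easy|]; intros j Hj; apply Rmax_right; now apply H.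
Qed.

Lemma truncated_exists m : 0 < m -> exists y : R -> nat -> R,
  (forall i, y 0 i = level G0 i) /\
  (forall i t, continuous (fun s => y s i) t) /\
  (forall i t, 0 < t -> is_derive (fun s => y s i) t (truncated m (y t) i)) /\
  (forall i, ~ seg G0 i -> forall t, y t i = level G0 i).
Proof.
  intros Hm; destruct (truncated_lip m Hm) as (K & M & HK & HM).
  destruct (picard_exists _ _ K M HK HM (level G0)) as (y & Y0 & Yc & Yd).
  exists (fun t => y (Rmax 0 t)); split; [|split; [|split]].
  - intros i; rewrite Rmax_left by lra; apply Y0.
  - intros i t; apply (continuous_comp (fun t => Rmax 0 t) (fun t => y t i));
      [apply continuous_Rmax_0|apply Yc].
  - intros i t Ht; rewrite (Rmax_right 0 t) by lra.
    apply (is_derive_ext_loc (V := R_NormedModule) (fun s => y s i)); [|now apply Yd].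
    generalize (open_gt 0 t Ht); apply filter_imp; intros s Hs; now rewrite Rmax_right by lra.
  (* The field vanishes off the segments, so levels of half-lines have zero derivative and stay
     constant. *)
  - intros i Hi t; rewrite <- Y0.
    assert (H := Rmax_l 0 t); set (b := Rmax 0 t) in *.
    assert (HA : Rabs (y b i - y 0 i) <= 0 - 0).
    { apply (derive_abs_le (fun s => y s i) (fun _ => 0) (fun _ => 0) (fun _ => 0)); [easy| |].
      - intros s _; split; [apply Yc|apply continuous_const].
      - intros s Hs; split; [|split; [apply (is_derive_const (V := R_NormedModule))|rewrite Rabs_R0; lra]].
        assert (HD := Yd i s ltac:(lra)); unfold truncated in HD.
        now destruct (excluded_middle_informative (seg G0 i)). }
    assert (0 <= Rabs (y b i - y 0 i)) by apply Rabs_pos.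
    assert (HZ : Rabs (y b i - y 0 i) = 0) by lra.
    apply Rminus_diag_uniq; revert HZ; unfold Rabs; destruct Rcase_abs; lra.
Qed.

Lemma truncated_solution m y T :
  (forall i, y 0 i = level G0 i) ->
  (forall i t, continuous (fun s => y s i) t) ->
  (forall i t, 0 < t -> is_derive (fun s => y s i) t (truncated m (y t) i)) ->
  (forall i, ~ seg G0 i -> forall t, y t i = level G0 i) ->
  0 < m ->
  (forall i t, seg G0 i -> 0 <= t -> Rbar_lt t T -> m <= len G0 (y t) i) ->
  solution phi alpha F G0 T y.
Proof.
  intros Y0 Yc Yd Yr Hm HL; split; [|split; [|split; [|split]]].
  - easy.
  - easy.
  - intros i Hi Hs t _; apply Yr; now intros [_ H].
  - intros i Hs t Ht HT; assert (H := HL i t Hs Ht HT); lra.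
  - intros i Hs t Ht HT; rewrite <- (truncated_eq m); [now apply Yd|easy|].
    intros j Hj; apply HL; [easy|lra|easy].
Qed.

Lemma positive_min (f : nat -> R -> R) (P : nat -> Prop) (b : R) k : 0 <= b ->
  (forall i t, (i < k)%nat -> P i -> 0 <= t <= b -> continuous (f i) t /\ 0 < f i t) ->
  exists m, 0 < m /\ forall i t, (i < k)%nat -> P i -> 0 <= t <= b -> m <= f i t.
Proof.
  intros Hb; induction k as [|k IH]; intros H; [exists 1; split; [lra|lia]|].
  destruct IH as (m & Hm & H'); [intros; apply H; easy || lia|].
  destruct (classic (P k)) as [Hk|Hk].
  - destruct (continuity_ab_min (f k) 0 b Hb) as (c & Hc1 & Hc2).
    { intros t Ht; apply continuity_pt_filterlim; apply H; easy || lia. }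
    exists (Rmin m (f k c)); split.
    + apply Rmin_glb_lt; [easy|apply H; easy || lia].
    + intros i t Hi HP Ht; destruct (Nat.eq_dec i k) as [->|Hik].
      * eapply Rle_trans; [apply Rmin_r|now apply Hc1].
      * eapply Rle_trans; [apply Rmin_l|apply H'; easy || lia].
  - exists m; split; [easy|]; intros i t Hi HP Ht; apply H'; try easy.
    destruct (Nat.eq_dec i k) as [->|]; [easy|lia].
Qed.

Lemma solution_min_len T x b : solution phi alpha F G0 T x -> 0 <= b -> Rbar_lt b T ->
  exists m, 0 < m /\ forall i t, seg G0 i -> 0 <= t <= b -> m <= len G0 (x t) i.
Proof.
  intros (_ & Hc & _ & Hl & _) Hb HT.
  assert (Hlt : forall t, t <= b -> Rbar_lt t T) by (intros t Ht; eapply Rbar_le_lt_trans; [|apply HT]; easy).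
  destruct (positive_min (fun i t => len G0 (x t) i) (seg G0) b (nb_edges G0) Hb) as (m & Hm & H).
  - intros i t Hi Hs Ht; split; [|apply Hl; [easy|lra|apply Hlt; lra]].
    apply continuous_len; [easy|]; intros j Hj; apply Hc; [easy|apply Hlt; lra].
  - exists m; split; [easy|]; intros i t Hs Ht; apply H; [apply Hs|easy|easy].
Qed.

Lemma solution_truncated (T : Rbar) x (m b : R) : solution phi alpha F G0 T x -> Rbar_lt b T ->
  (forall i t, seg G0 i -> 0 <= t <= b -> m <= len G0 (x t) i) ->
  (forall i t, (i < nb_edges G0)%nat -> 0 <= t <= b -> continuous (fun s => x s i) t) /\
  (forall i t, (i < nb_edges G0)%nat -> 0 < t < b ->
     is_derive (fun s => x s i) t (truncated m (x t) i)).
Proof.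
  intros (H0 & Hc & Hr & Hl & Hd) HT HM.
  assert (Hlt : forall t, t <= b -> Rbar_lt t T)
    by (intros t Ht; eapply Rbar_le_lt_trans; [|apply HT]; easy).
  split; [intros i t Hi Ht; apply Hc; [easy|apply Hlt; lra]|].
  intros i t Hi Ht; destruct (classic (seg G0 i)) as [Hs|Hs].
  - rewrite truncated_eq by (easy || (intros j Hj; apply HM; [easy|lra])).
    apply Hd; [easy|lra|apply Hlt; lra].
  - unfold truncated; destruct (excluded_middle_informative (seg G0 i)) as [|_]; [easy|].
    apply (is_derive_ext_loc (V := R_NormedModule) (fun _ => level G0 i));
      [|apply (is_derive_const (V := R_NormedModule))].
    generalize (locally_Rbar_lt t T (Hlt t ltac:(lra))); apply filter_imp.
    intros s Hs'; symmetry; apply Hr; [easy| |easy]; intros Hs''; now apply Hs.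
Qed.

(** On the compact interval [0, b] the lengths of both solutions have a common positive lower bound;
    truncating there, both solve the same globally Lipschitz equation. *)
Lemma solution_unique T T' x y b :
  solution phi alpha F G0 T x -> solution phi alpha F G0 T' y ->
  0 <= b -> Rbar_lt b T -> Rbar_lt b T' ->
  forall i, (i < nb_edges G0)%nat -> x b i = y b i.
Proof.
  intros Hx Hy Hb HT HT'.
  destruct (solution_min_len T x b Hx Hb HT) as (m & Hm & Mx).
  destruct (solution_min_len T' y b Hy Hb HT') as (m' & Hm' & My).
  set (mm := Rmin m m'); assert (Hmm : 0 < mm) by now apply Rmin_glb_lt.
  assert (mm <= m) by apply Rmin_l; assert (mm <= m') by apply Rmin_r.
  destruct (truncated_lip mm Hmm) as (K & M & HK & _).
  destruct (solution_truncated T x mm b Hx HT) as [Cx Dx]; [intros i t Hs Ht; specialize (Mx i t Hs Ht); lra|].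
  destruct (solution_truncated T' y mm b Hy HT') as [Cy Dy]; [intros i t Hs Ht; specialize (My i t Hs Ht); lra|].
  apply (ode_unique (nb_edges G0) (truncated mm) K b x y Hb).
  - intros i Hi; rewrite (proj1 Hx), (proj1 Hy) by easy; easy.
  - intros i t Hi Ht; split; [now apply Cx|now apply Cy].
  - intros i t Hi Ht; split; [now apply Dx|split; [now apply Dy|apply HK]].
Qed.

Lemma solution_restrict T T' x :
  solution phi alpha F G0 T x -> Rbar_le T' T -> solution phi alpha F G0 T' x.
Proof.
  intros (H0 & Hc & Hr & Hl & Hd) HT.
  assert (Hlt : forall t : R, Rbar_lt t T' -> Rbar_lt t T)
    by (intros t Ht; eapply Rbar_lt_le_trans; [apply Ht|easy]).
  split; [easy|split; [|split; [|split]]]; intros; auto.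
Qed.

(** Truncating at half the smallest initial length leaves room: by continuity the lengths stay above
    the threshold for a short time, during which the truncation is inactive. *)
Lemma solution_local : exists (eps : R) x, 0 < eps /\ solution phi alpha F G0 eps x.
Proof.
  destruct (positive_min (fun i _ => len G0 (level G0) i) (seg G0) 0 (nb_edges G0))
    as (m & Hm & HL); [lra| |].
  { intros i t Hi Hs _; split; [apply continuous_const|now apply seg_length_op]. }
  assert (Hm2 : 0 < m / 2) by lra.
  destruct (truncated_exists (m / 2) Hm2) as (y & Y0 & Yc & Yd & Yr).
  assert (Hnear : forall k, locally 0 (fun t => forall i, (i < k)%nat -> seg G0 i -> m / 2 < len G0 (y t) i)).
  { induction k as [|k IH]; [exists (mkposreal 1 Rlt_0_1); intros; lia|].
    destruct (classic (seg G0 k)) as [Hs|Hs].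
    - assert (HC : continuous (fun t => len G0 (y t) k) 0)
        by (apply continuous_len; [apply Hs|intros; apply Yc]).
      assert (H0 : m / 2 < len G0 (y 0) k).
      { unfold len; rewrite (op_ext G0 (y 0) (level G0)) by (apply Hs || easy).
        assert (H1 := HL k 0 (proj1 Hs) Hs ltac:(lra)); unfold len in H1; lra. }
      generalize (filter_and _ _ IH (HC _ (open_gt (m / 2) _ H0))); apply filter_imp.
      intros t [H1 H2] i Hi Hsi; destruct (Nat.eq_dec i k) as [->|]; [easy|apply H1; easy || lia].
    - revert IH; apply filter_imp; intros t H1 i Hi Hsi.
      destruct (Nat.eq_dec i k) as [->|]; [easy|apply H1; easy || lia]. }
  destruct (Hnear (nb_edges G0)) as [eps Heps].
  exists eps, y; split; [apply cond_pos|].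
  apply (truncated_solution (m / 2)); try easy.
  intros i t Hs Ht HT; left; apply (Heps t); [|apply Hs|easy].
  unfold ball; simpl; unfold AbsRing_ball, minus, plus, opp, abs; simpl in *.
  rewrite Ropp_0, Rplus_0_r, Rabs_pos_eq; easy.
Qed.

(** * The maximal time and the maximal solution *)

Definition existence_times (T : R) : Prop := 0 < T /\ exists x, solution phi alpha F G0 T x.

Definition max_time : Rbar := Lub_Rbar existence_times.

(** A choice of the value at t of some solution living beyond t; uniqueness makes it independent of
    that solution at the indices of edges. [Rmax 0 t] freezes it at negative times. *)
Definition max_solution (t : R) (i : nat) : R :=
  epsilon (inhabits 0) (fun v => exists (T : R) x,
    solution phi alpha F G0 T x /\ Rmax 0 t < T /\ v = x (Rmax 0 t) i).

Lemma max_time_lub : is_lub_Rbar existence_times max_time.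
Proof. apply Lub_Rbar_correct. Qed.

Lemma max_time_pos : Rbar_lt 0 max_time.
Proof.
  destruct solution_local as (eps & x & He & Hx).
  apply Rbar_lt_le_trans with eps; [easy|].
  apply max_time_lub; split; [easy|now exists x].
Qed.

Lemma max_solution_spec T x t i : solution phi alpha F G0 T x -> Rbar_lt (Rmax 0 t) T ->
  (i < nb_edges G0)%nat -> max_solution t i = x (Rmax 0 t) i.
Proof.
  intros Hx Ht Hi.
  assert (HE : exists v, exists (T : R) x,
    solution phi alpha F G0 T x /\ Rmax 0 t < T /\ v = x (Rmax 0 t) i).
  { destruct T as [T| |]; [|exists (x (Rmax 0 t) i), (Rmax 0 t + 1), x|easy].
    - exists (x (Rmax 0 t) i), T, x; easy.
    - split; [|split; [lra|easy]]; now apply (solution_restrict p_infty). }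
  destruct (epsilon_spec (inhabits 0) _ HE) as (T' & x' & Hx' & Ht' & E).
  unfold max_solution; rewrite E.
  apply (solution_unique T' T); try easy; apply Rmax_l.
Qed.

Lemma below_max_time (t : R) : Rbar_lt t max_time -> exists (T : R) x,
  solution phi alpha F G0 T x /\ t < T.
Proof.
  intros Ht; apply NNPP; intros Hn.
  apply (Rbar_lt_not_le _ _ Ht); apply max_time_lub; intros T [HT (x & Hx)]; simpl.
  apply Rnot_lt_le; intros HT'; apply Hn; now exists T, x.
Qed.

Lemma max_solution_solution : solution phi alpha F G0 max_time max_solution.
Proof.
  assert (HB : forall t : R, Rbar_lt t max_time -> exists (T : R) x, solution phi alpha F G0 T x /\
    t < T /\ 0 < T /\ forall i, (i < nb_edges G0)%nat ->
      locally t (fun s => x (Rmax 0 s) i = max_solution s i)).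
  { intros t Ht.
    destruct (below_max_time (Rmax 0 t)) as (T & x & Hx & HT);
      [apply Rmax_0_lt; [apply max_time_pos|easy]|].
    assert (H0 := Rmax_l 0 t); assert (H1 := Rmax_r 0 t).
    exists T, x; split; [easy|split; [lra|split; [lra|]]]; intros i Hi.
    assert (Ht' : t < T) by lra.
    generalize (open_lt T t Ht'); apply filter_imp; intros s Hs; symmetry.
    apply (max_solution_spec T); [easy| |easy]; apply Rmax_0_lt; simpl; lra. }
  assert (HV : forall t T x, solution phi alpha F G0 (Finite T) x -> 0 <= t < T ->
    forall i, (i < nb_edges G0)%nat -> max_solution t i = x t i).
  { intros t T x Hx Ht i Hi; rewrite (max_solution_spec T x); try easy;
      rewrite Rmax_right by lra; [easy|simpl; lra]. }
  split; [|split; [|split; [|split]]].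
  - intros i Hi; destruct (HB 0 max_time_pos) as (T & x & Hx & HT & _).
    rewrite (HV 0 T x Hx ltac:(lra) i Hi); exact (proj1 Hx i Hi).
  - intros i Hi t Ht; destruct (HB t Ht) as (T & x & Hx & HT & HT0 & HE).
    apply (continuous_ext_loc _ (fun s => x (Rmax 0 s) i)); [now apply HE|].
    apply (continuous_comp (fun t => Rmax 0 t) (fun t => x t i)); [apply continuous_Rmax_0|].
    destruct Hx as (_ & Hc & _); apply Hc; [easy|]; apply Rmax_0_lt; easy.
  - intros i Hi Hs t Ht; destruct (HB t Ht) as (T & x & Hx & HT & HT0 & HE).
    rewrite <- (locally_singleton _ _ (HE i Hi)).
    destruct Hx as (_ & _ & Hr & _); apply Hr; [easy|easy|]; apply Rmax_0_lt; easy.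
  - intros i Hs t H0 Ht; destruct (HB t Ht) as (T & x & Hx & HT & _).
    unfold len; rewrite (op_ext G0 _ (x t)); [|apply Hs|now apply (HV t T)].
    destruct Hx as (_ & _ & _ & Hl & _); now apply (Hl i Hs t).
  - intros i Hs t H0 Ht; destruct (HB t Ht) as (T & x & Hx & HT & _ & HE).
    rewrite (velocity_ext _ _ _ _ _ (len G0 (x t))); [|easy|].
    + apply (is_derive_ext_loc (V := R_NormedModule) (fun s => x s i)).
      * generalize (filter_and _ _ (HE i (proj1 Hs)) (open_gt 0 t H0)); apply filter_imp.
        intros s [E Hs']; rewrite Rmax_right in E by lra; easy.
      * destruct Hx as (_ & _ & _ & _ & Hd); now apply Hd.
    + intros j Hj; unfold len; rewrite (op_ext G0 _ (x t)); [easy|apply Hj|].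
      apply (HV t T); [easy|lra].
Qed.

(** Any competing flow yields a solution, so its lifetime is at most the supremum, and
    [max_solution_spec] gives its levels; [parallel_eq] upgrades equal levels to equal curves. *)
Lemma maximal_flow_exists :
  maximal_flow phi alpha G0 max_time (fun t => rebuild G0 (max_solution t)).
Proof.
  split; [apply solution_flow; [apply max_time_pos|apply max_solution_solution]|].
  intros T' G' HG'; assert (Hx := flow_solution T' G' HG').
  destruct HG' as (HT' & HP & _).
  split.
  - destruct T' as [T'| |]; [|destruct max_time eqn:E; [exfalso|easy|]|easy].
    + apply max_time_lub; split; [exact HT'|eexists; exact Hx].
    + assert (H : Rbar_le (Rmax 0 r + 1) max_time).
      { apply max_time_lub; split; [assert (A := Rmax_l 0 r); lra|].
        eexists; now apply (solution_restrict p_infty); [exact Hx|]. }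
      rewrite E in H; simpl in H; assert (A := Rmax_r 0 r); lra.
    + assert (A := max_time_pos); now rewrite E in A.
  - intros t Ht HtT'.
    assert (HtT : Rbar_lt (Rmax 0 t) T') by now apply Rmax_0_lt.
    assert (Hv : forall i, (i < nb_edges G0)%nat -> max_solution t i = level (G' t) i).
    { intros i Hi; rewrite (max_solution_spec T' _ t i Hx HtT Hi).
      now rewrite !(Rmax_right 0 t) by lra. }
    (* The lengths are positive because the levels are those of the curve [G' t]. *)
    assert (HPR : parallel G0 (rebuild G0 (max_solution t)) /\
      forall i, (i < nb_edges G0)%nat -> level (rebuild G0 (max_solution t)) i = max_solution t i).
    { assert (HPt := HP t Ht HtT').
      assert (A1 : forall i, seg G0 i -> 0 < - op G0 (max_solution t) i).
      { intros i Hs; rewrite (op_ext G0 _ (level (G' t))); [|apply Hs|easy].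
        now apply parallel_length. }
      assert (A2 : forall i, (i < nb_edges G0)%nat -> ~ is_seg (edge_of G0 i) ->
                   max_solution t i = level G0 i)
        by (intros i Hi Hs; rewrite Hv by easy; now apply parallel_level_ray).
      split; [now apply rebuild_parallel|intros; now apply rebuild_level]. }
    apply (parallel_eq G0); [easy|now apply HP|apply HPR|].
    intros i Hi; rewrite (proj2 HPR), Hv by easy; easy.
Qed.

End Flow.

(** * Restarting the flow *)

(** Rebuilding uses only the tangents of the curve, which parallel curves share. *)
Lemma rebuild_rebuild G x y : polygonal G -> parallel G (rebuild G x) ->
  rebuild (rebuild G x) y = rebuild G y.
Proof.
  intros HG HP.
  assert (HM : forall i, (i < nb_edges G)%nat -> meet_at (rebuild G x) y i = meet_at G y i).
  { intros i Hi; assert (Hp : (prev G i < nb_edges G)%nat) by (apply prev_lt; lia).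
    unfold meet_at; rewrite (parallel_prev G _ HP), !(parallel_tau G _ HP) by easy; easy. }
  destruct G as [p|d p e]; unfold rebuild in *; rewrite length_map, length_seq;
    f_equal; apply map_ext_in; intros i Hi; apply in_seq in Hi; apply HM; simpl; lia.
Qed.

Lemma facets_parallel phi F G G' : polygonal G -> parallel G G' ->
  facets_of phi G F -> facets_of phi G' F.
Proof.
  intros HG HP [H1 H2]; assert (HN := proj1 (proj2 (proj2 HP))); split.
  - intros i Hi; rewrite HN in Hi; destruct (H1 i Hi) as [H3 H4]; split; [easy|].
    rewrite <- H4; unfold normal; fold (tau G' i) (tau G i); now rewrite (parallel_tau G G' HP).
  - intros i Hi; rewrite (parallel_prev G G' HP); apply H2; now apply (parallel_joint G G' HP).
Qed.

Lemma velocity_parallel phi alpha F G G' l i : polygonal G -> parallel G G' -> seg G i ->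
  velocity phi alpha F G' l i = velocity phi alpha F G l i.
Proof.
  intros HG HP Hs; assert (Hi := proj1 Hs); unfold velocity, supp.
  rewrite (parallel_tau G G' HP), (parallel_transition G G' HG HP), (parallel_op G G' HG HP) by easy.
  rewrite (op_ext G _ (weight phi F G l)); [easy|easy|].
  intros j Hj; unfold weight, delta, normal; fold (tau G' j) (tau G j).
  now rewrite (parallel_tau G G' HP), (parallel_transition G G' HG HP).
Qed.

Lemma Rbar_lt_minus_r (t s : R) T : Rbar_lt t (Rbar_minus T s) <-> Rbar_lt (t + s) T.
Proof. destruct T as [T| |]; simpl; try easy; split; intros; lra. Qed.

Lemma solution_shift phi alpha F G0 T x s : polygonal G0 ->
  solution phi alpha F G0 T x -> 0 <= s -> Rbar_lt s T ->
  solution phi alpha F (rebuild G0 (x s)) (Rbar_minus T s) (fun t => x (t + s)).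
Proof.
  intros HG0 Hx Hs HT; destruct (solution_rebuild phi alpha F G0 HG0 T x s Hx Hs HT) as [HP HL].
  destruct Hx as (H0 & Hc & Hr & Hl & Hd).
  set (G1 := rebuild G0 (x s)) in *.
  assert (HN : nb_edges G1 = nb_edges G0) by apply HP.
  assert (HS := parallel_seg G0 G1 HP).
  split; [|split; [|split; [|split]]].
  - intros i Hi; rewrite HN in Hi; now rewrite Rplus_0_l, HL.
  - intros i Hi t Ht; rewrite HN in Hi; apply Rbar_lt_minus_r in Ht.
    apply (continuous_comp (fun t => t + s) (fun t => x t i)); [|now apply Hc].
    apply (continuous_plus (V := R_NormedModule)); [apply continuous_id|apply continuous_const].
  - intros i Hi Hray t Ht; rewrite HN in Hi; apply Rbar_lt_minus_r in Ht.
    assert (Hray' : ~ is_seg (edge_of G0 i)) by (intros H; apply Hray, HS; split; easy).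
    rewrite HL by easy; rewrite !Hr by easy; easy.
  - intros i Hi t H1 Ht; apply HS in Hi; apply Rbar_lt_minus_r in Ht.
    unfold len; rewrite (parallel_op G0 G1 HG0 HP) by apply Hi; apply Hl; [easy|lra|easy].
  - intros i Hi t H1 Ht; apply HS in Hi; apply Rbar_lt_minus_r in Ht.
    rewrite (velocity_parallel phi alpha F G0 G1) by easy.
    rewrite (velocity_ext _ _ _ _ _ (len G0 (x (t + s))));
      [|easy|intros j Hj; unfold len; now rewrite (parallel_op G0 G1 HG0 HP) by apply Hj].
    assert (HD := Hd i Hi (t + s) ltac:(lra) Ht).
    evar_last; [apply (is_derive_comp (fun t => x t i) (fun t => t + s)); [exact HD|]|].
    + auto_derive; easy.
    + apply Rmult_1_l.
Qed.

(** The equation is autonomous and the same for parallel curves, so the time-shifted solution is a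
    flow from the curve at time s, hence a restriction of the maximal one. *)
Lemma flow_semigroup phi alpha F G0 T x s t : anisotropy phi -> polygonal G0 -> facets_of phi G0 F ->
  solution phi alpha F G0 T x -> 0 <= s -> 0 <= t -> Rbar_lt (t + s) T ->
  exists (T' : Rbar) G', maximal_flow phi alpha (rebuild G0 (x s)) T' G' /\
    Rbar_lt t T' /\ rebuild G0 (x (t + s)) = G' t.
Proof.
  intros Hphi HG0 HF Hx Hs Ht HT.
  assert (HsT : Rbar_lt s T) by (eapply Rbar_le_lt_trans; [|apply HT]; simpl; lra).
  destruct (solution_rebuild phi alpha F G0 HG0 T x s Hx Hs HsT) as [HP HL].
  assert (HG1 := proj1 HP); assert (HF1 := facets_parallel phi F G0 _ HG0 HP HF).
  assert (Hsol := solution_shift phi alpha F G0 T x s HG0 Hx Hs HsT).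
  assert (HM := maximal_flow_exists phi alpha F _ Hphi HG1 HF1).
  eexists; eexists; split; [exact HM|].
  destruct HM as [_ HM]; edestruct HM as [HM1 HM2].
  - apply (solution_flow phi alpha F); try easy; [|exact Hsol].
    apply Rbar_lt_minus_r; now rewrite Rplus_0_l.
  - assert (Htt : Rbar_lt t (Rbar_minus T s)) by now apply Rbar_lt_minus_r.
    split; [now apply Rbar_lt_le_trans with (2 := HM1)|].
    rewrite <- HM2 by easy; symmetry; now apply rebuild_rebuild.
Qed.

(** * Closed curves: the energy *)

Lemma closed_seg G i : is_closed G -> (i < nb_edges G)%nat -> seg G i.
Proof. now destruct G. Qed.

(** The coefficient coupling i with its successor is 1 / [turn] at their joint, seen from either
    side; a cyclic shift of the sum exchanges the two off-diagonal parts. *)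
Lemma op_symmetric G a b : 
  rsum (nb_edges G) (fun i => a i * op G b i) = rsum (nb_edges G) (fun i => b i * op G a i).
Proof.
  set (n := nb_edges G).
  assert (H : forall a b, rsum n (fun i => a i * (b (next G i) / turn G (next G i))) =
                          rsum n (fun i => b i * (a (prev G i) / turn G i))).
  { clear; intros a b; rewrite <- (rsum_cyclic n (fun i => b i * (a (prev G i) / turn G i))).
    apply rsum_ext; intros i Hi; change ((i + 1) mod n)%nat with (next G i); rewrite prev_next by easy; unfold Rdiv; ring. }
  set (k := fun i => dot (tau G (prev G i)) (tau G i) / turn G i
                     + dot (tau G i) (tau G (next G i)) / turn G (next G i)).
  assert (HE : forall a b, rsum n (fun i => a i * op G b i) =
    rsum n (fun i => a i * (b (prev G i) / turn G i)) + - rsum n (fun i => a i * b i * k i)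
    + rsum n (fun i => a i * (b (next G i) / turn G (next G i)))).
  { clear; intros a b.
    transitivity (rsum n (fun i => (a i * (b (prev G i) / turn G i) + -1 * (a i * b i * k i))
                             + a i * (b (next G i) / turn G (next G i)))).
    - apply rsum_ext; intros i _; unfold op; fold (k i); ring.
    - rewrite !rsum_plus, rsum_scal; ring. }
  rewrite !HE, !H.
  rewrite (rsum_ext n (fun i => a i * b i * k i) (fun i => b i * a i * k i)) by (intros; ring).
  ring.
Qed.

Lemma op_linear G a b c i : op G (fun j => a j + c * b j) i = op G a i + c * op G b i.
Proof. unfold op, Rdiv; ring. Qed.

Lemma op_bound G : exists K, 0 <= K /\ forall x B i, (i < nb_edges G)%nat -> 0 <= B ->
  (forall j, (j < nb_edges G)%nat -> Rabs (x j) <= B) -> Rabs (op G x i) <= K * B.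
Proof.
  set (n := nb_edges G).
  assert (H : forall k, (k <= n)%nat -> exists K, 0 <= K /\ forall i x B, (i < k)%nat -> 0 <= B ->
    (forall j, (j < n)%nat -> Rabs (x j) <= B) -> Rabs (op G x i) <= K * B).
  { induction k as [|k IH]; intros Hk; [exists 0; split; [lra|lia]|].
    destruct IH as (K & HK & H); [lia|].
    destruct (op_lip G k) as (L & HL & HLip); [unfold n in Hk; lia|].
    assert (HLn : 0 <= L * INR n) by (apply Rmult_le_pos; [easy|apply pos_INR]).
    exists (K + L * INR n); split; [lra|]; intros i x B Hi HB Hx.
    destruct (Nat.eq_dec i k) as [->|Hik].
    - assert (H0 := HLip x (fun _ => 0)); replace (op G (fun _ => 0) k) with 0 in H0
        by (unfold op, Rdiv; ring).
      rewrite Rminus_0_r in H0.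
      assert (HD : dist_sum (nb_edges G) x (fun _ => 0) <= INR n * B)
        by (apply rsum_le_const; intros j Hj; rewrite Rminus_0_r; now apply Hx).
      apply (Rmult_le_compat_l L) in HD; [|easy]; nra.
    - assert (H0 := H i x B ltac:(lia) HB Hx); nra. }
  destruct (H n (le_n n)) as (K & HK & HH); exists K; split; [easy|]; intros; now apply HH.
Qed.

(** Replaces constants found edge by edge by a single positive one. *)
Lemma uniform_bound n (P : nat -> R -> Prop) :
  (forall i C C', (i < n)%nat -> C <= C' -> P i C -> P i C') ->
  (forall i, (i < n)%nat -> exists C, P i C) ->
  exists C, 0 < C /\ forall i, (i < n)%nat -> P i C.
Proof.
  induction n as [|n IH]; intros HM H; [exists 1; split; [lra|lia]|].
  destruct IH as (C & HC & HP); [intros i C C' Hi; apply HM; lia|intros; apply H; lia|].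
  destruct (H n ltac:(lia)) as (C' & HP').
  exists (Rmax C C'); split; [eapply Rlt_le_trans; [apply HC|apply Rmax_l]|].
  intros i Hi; destruct (Nat.eq_dec i n) as [->|Hn].
  - apply (HM n C'); [lia|apply Rmax_r|easy].
  - apply (HM i C); [lia|apply Rmax_l|apply HP; lia].
Qed.

Lemma Rle_mult_div (a b c : R) : 0 < c -> a * c <= b -> a <= b / c.
Proof.
  intros Hc H; apply (Rmult_le_reg_r c); [easy|]; unfold Rdiv.
  rewrite Rmult_assoc, Rinv_l by lra; lra.
Qed.

Lemma transition_sqr G i : transition G i ^ 2 = 0 \/ transition G i ^ 2 = 1.
Proof.
  unfold transition; destruct (edge_of G i); [|left; ring..].
  repeat destruct Rlt_dec; simpl; lra.
Qed.

(** * A smoothed absolute value *)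

Definition root (e y : R) : R := sqrt (y ^ 2 + e ^ 2).

Lemma root_sqr e y : root e y * root e y = y ^ 2 + e ^ 2.
Proof. apply sqrt_sqrt; nra. Qed.

Lemma root_bounds e y : 0 <= e -> Rabs y <= root e y <= Rabs y + e /\ e <= root e y.
Proof.
  intros He; assert (HR := root_sqr e y); assert (HP : 0 <= root e y) by apply sqrt_pos.
  assert (HA := Rabs_pos y); rewrite <- (pow2_abs y) in HR; nra.
Qed.

Lemma root_pos e y : 0 < e -> 0 < root e y.
Proof. intros He; destruct (root_bounds e y ltac:(lra)); lra. Qed.

(** The derivative of [root e], a smoothed sign. *)
Definition slope (e y : R) : R := y / root e y.

Lemma slope_opp e y : slope e (- y) = - slope e y.
Proof. unfold slope, root; replace ((- y) ^ 2) with (y ^ 2) by ring; unfold Rdiv; ring. Qed.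

Lemma slope_0 e : slope e 0 = 0.
Proof. unfold slope, Rdiv; ring. Qed.

Lemma slope_bound e y : 0 < e -> Rabs (slope e y) <= 1.
Proof.
  intros He; assert (HR := root_pos e y He); destruct (root_bounds e y ltac:(lra)) as [[HB _] _].
  unfold slope; rewrite Rabs_div, (Rabs_pos_eq (root e y)) by lra.
  apply (Rmult_le_reg_r (root e y)); [easy|]; unfold Rdiv.
  rewrite Rmult_assoc, Rinv_l by lra; lra.
Qed.

Lemma slope_mono e y z : 0 < e -> y <= z -> slope e y <= slope e z.
Proof.
  intros He Hyz.
  assert (H : forall y z, 0 <= y <= z -> slope e y <= slope e z).
  { clear y z Hyz; intros y z Hyz.
    assert (Hy := root_pos e y He); assert (Hz := root_pos e z He).
    unfold slope; apply Rle_mult_div; [easy|].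
    apply (Rmult_le_reg_r (root e y)); [easy|].
    replace (y / root e y * root e z * root e y) with (y * root e z) by (field; lra).
    apply Rsqr_incr_0_var; [|apply Rmult_le_pos; lra]; unfold Rsqr.
    replace (y * root e z * (y * root e z)) with (y ^ 2 * (root e z * root e z)) by ring.
    replace (z * root e y * (z * root e y)) with (z ^ 2 * (root e y * root e y)) by ring.
    rewrite !root_sqr; assert (y ^ 2 <= z ^ 2) by nra.
    assert (e ^ 2 * y ^ 2 <= e ^ 2 * z ^ 2) by (apply Rmult_le_compat_l; [apply pow2_ge_0|easy]); lra. }
  destruct (Rle_dec 0 y) as [Hy|Hy]; [apply H; lra|].
  destruct (Rle_dec 0 z) as [Hz|Hz].
  - apply Rle_trans with 0.
    + rewrite <- (Ropp_involutive y), slope_opp, <- (slope_0 e).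
      assert (A := H 0 (- y) ltac:(lra)); rewrite slope_0 in *; lra.
    + rewrite <- (slope_0 e); apply H; lra.
  - rewrite <- (Ropp_involutive y), <- (Ropp_involutive z), (slope_opp e (- y)), (slope_opp e (- z)).
    apply Ropp_le_contravar, H; lra.
Qed.

(** The right side equals [root e y] - e^2 / [root e y], and [root e y] is at least both |y| and
    e. *)
Lemma mult_slope e y : 0 < e -> Rabs y - e <= y * slope e y.
Proof.
  intros He; assert (HR := root_pos e y He); destruct (root_bounds e y ltac:(lra)) as [[HB _] HB'].
  assert (HS := root_sqr e y); unfold slope.
  replace (y * (y / root e y)) with (root e y - e * (e / root e y)).
  - assert (e / root e y <= 1); [|nra].
    apply (Rmult_le_reg_r (root e y)); [easy|]; unfold Rdiv; rewrite Rmult_assoc, Rinv_l by lra; lra.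
  - apply (Rmult_eq_reg_r (root e y)); [|lra].
    transitivity (root e y * root e y - e ^ 2); [field; lra|].
    rewrite HS; field; lra.
Qed.

Lemma is_derive_root (e : R) (f : R -> R) (f' t : R) : 0 < e -> is_derive f t f' ->
  is_derive (fun s => root e (f s)) t (f' * slope e (f t)).
Proof.
  intros He Hf; unfold root.
  assert (HP : 0 < f t ^ 2 + e ^ 2) by nra.
  evar_last.
  - apply (is_derive_sqrt (fun s => f s ^ 2 + e ^ 2)); [|exact HP].
    apply (is_derive_plus (V := R_NormedModule)); [apply is_derive_pow, Hf|].
    apply (is_derive_const (V := R_NormedModule)).
  - unfold slope, root, plus, zero; simpl.
    assert (sqrt (f t ^ 2 + e ^ 2) <> 0) by (apply Rgt_not_eq, sqrt_lt_R0, HP).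
    simpl in *; field; easy.
Qed.

Lemma continuous_root (e : R) (f : R -> R) (t : R) : 0 < e -> continuous f t -> continuous (fun s => root e (f s)) t.
Proof.
  intros He Hf; apply (continuous_comp f (root e)); [easy|].
  apply (ex_derive_continuous (V := R_NormedModule)); eexists.
  apply (is_derive_root e (fun y => y)); [easy|apply (is_derive_id (K := R_AbsRing))].
Qed.

(* The smoothing costs only [O(e)] because the difference of the weights vanishes with [a - b]. *)
Lemma weight_slope_bound d a b ga gb e m Lam :
  0 < d -> 0 < m -> 0 < e -> m <= a <= Lam -> m <= b <= Lam ->
  (a <= b -> slope e (b - a) <= gb - ga) -> (b <= a -> slope e (a - b) <= ga - gb) ->
  (d / a ^ 2 - d / b ^ 2) * (ga - gb) <= - Rabs (d / a ^ 2 - d / b ^ 2) + d * (2 * Lam) / m ^ 4 * e.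
Proof.
  intros Hd Hm He Ha Hb H1 H2.
  assert (H : forall a b ga gb, m <= a <= Lam -> m <= b <= Lam -> a <= b ->
    slope e (b - a) <= gb - ga ->
    (d / a ^ 2 - d / b ^ 2) * (ga - gb) <=
    - Rabs (d / a ^ 2 - d / b ^ 2) + d * (2 * Lam) / m ^ 4 * e).
  { clear - Hd Hm He; intros a b ga gb Ha Hb Hab Hg.
    (* The difference of the weights factors as k (b - a), with k at most 2 d Lam / m^4. *)
    set (k := d * (a + b) * (/ a ^ 2 * / b ^ 2)).
    assert (Hia : 0 < / a ^ 2 <= / m ^ 2).
    { split; [apply Rinv_0_lt_compat; nra|apply Rinv_le_contravar; nra]. }
    assert (Hib : 0 < / b ^ 2 <= / m ^ 2).
    { split; [apply Rinv_0_lt_compat; nra|apply Rinv_le_contravar; nra]. }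
    assert (Hk : 0 <= k <= d * (2 * Lam) / m ^ 4).
    { unfold k; split; [apply Rmult_le_pos; nra|].
      replace (d * (2 * Lam) / m ^ 4) with (d * (2 * Lam) * (/ m ^ 2 * / m ^ 2)) by (field; lra).
      apply Rmult_le_compat; [nra|nra|nra|]; apply Rmult_le_compat; lra. }
    assert (HE : d / a ^ 2 - d / b ^ 2 = k * (b - a)) by (unfold k; field; lra).
    rewrite HE, Rabs_pos_eq by (apply Rmult_le_pos; lra).
    assert (HM := mult_slope e (b - a) He); rewrite Rabs_pos_eq in HM by lra.
    assert (A : (b - a) * slope e (b - a) <= (b - a) * (gb - ga)) by (apply Rmult_le_compat_l; lra).
    assert (B : k * (b - a - e) <= k * ((b - a) * (gb - ga))) by (apply Rmult_le_compat_l; lra).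
    assert (C : k * e <= d * (2 * Lam) / m ^ 4 * e) by (apply Rmult_le_compat_r; lra).
    lra. }
  destruct (Rle_dec a b) as [Hab|Hab]; [apply H; auto|].
  assert (A := H b a gb ga Hb Ha ltac:(lra) (H2 ltac:(lra))).
  rewrite Rabs_minus_sym in A; lra.
Qed.

Lemma rsum_swap n m (f : nat -> nat -> R) :
  rsum n (fun j => rsum m (f j)) = rsum m (fun k => rsum n (fun j => f j k)).
Proof.
  induction n as [|n IH]; simpl; [rewrite rsum_const; ring|].
  now rewrite IH, <- rsum_plus.
Qed.

(** * Energy, potential and finite variation of the levels on closed curves *)

Section Closed.

Variable phi : pt -> R.
Variable alpha : R.
Variable F : nat -> edge.
Variable G0 : curve.
Hypothesis phi_anis : anisotropy phi.
Hypothesis alpha_pos : 0 < alpha.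
Hypothesis HG0 : polygonal G0.
Hypothesis HF : facets_of phi G0 F.
Hypothesis G0_closed : is_closed G0.
Variable T : R.
Hypothesis T_pos : 0 < T.
Variable x : R -> nat -> R.
Hypothesis Hx : solution phi alpha F G0 T x.

Let n := nb_edges G0.
Let L (t : R) (i : nat) : R := len G0 (x t) i.
Let v (t : R) (i : nat) : R := velocity phi alpha F G0 (L t) i.
Let w (t : R) (i : nat) : R := weight phi F G0 (L t) i.
Let u (i : nat) : R := transition G0 i ^ 2.

Lemma L_pos t i : (i < n)%nat -> 0 <= t < T -> 0 < L t i.
Proof.
  intros Hi Ht; destruct Hx as (_ & _ & _ & Hl & _).
  apply Hl; [now apply closed_seg|easy|easy].
Qed.

Lemma x_continuous t i : (i < n)%nat -> t < T -> continuous (fun s => x s i) t.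
Proof. intros Hi Ht; destruct Hx as (_ & Hc & _); now apply Hc. Qed.

Lemma L_continuous t i : (i < n)%nat -> t < T -> continuous (fun s => L s i) t.
Proof. intros Hi Ht; apply continuous_len; [easy|]; intros j Hj; now apply x_continuous. Qed.

Lemma x_derive t i : (i < n)%nat -> 0 < t < T -> is_derive (fun s => x s i) t (v t i).
Proof.
  intros Hi Ht; destruct Hx as (_ & _ & _ & _ & Hd).
  apply Hd; [now apply closed_seg|easy|easy].
Qed.

Lemma n_pos : (0 < n)%nat.
Proof. now apply nb_edges_pos. Qed.

Lemma L_derive t i : (i < n)%nat -> 0 < t < T ->
  is_derive (fun s => L s i) t (- op G0 (v t) i).
Proof.
  intros Hi Ht; assert (Hn := n_pos).
  assert (D1 := x_derive t i Hi Ht).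
  assert (D2 := x_derive t (prev G0 i) (prev_lt G0 i Hn) Ht).
  assert (D3 := x_derive t (next G0 i) (next_lt G0 i Hn) Ht).
  unfold L, len, op.
  set (a := turn G0 i); set (b := turn G0 (next G0 i)); set (c := _ / a + _ / b).
  apply (is_derive_ext (V := R_NormedModule)
    (fun s => - (/ a * x s (prev G0 i) - c * x s i + / b * x s (next G0 i)))).
  - intros s; change (- (/ a * x s (prev G0 i) - c * x s i + / b * x s (next G0 i)) =
      - (x s (prev G0 i) / a - x s i * c + x s (next G0 i) / b)); unfold Rdiv; ring.
  - replace (- (v t (prev G0 i) / a - v t i * c + v t (next G0 i) / b))
      with (- (/ a * v t (prev G0 i) - c * v t i + / b * v t (next G0 i)))
      by (unfold Rdiv; ring).
    apply (is_derive_opp (V := R_NormedModule)).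
    apply (is_derive_plus (V := R_NormedModule)); [apply (is_derive_minus (V := R_NormedModule))|];
      now apply is_derive_scal.
Qed.

Lemma delta_nonneg j : (j < n)%nat -> 0 < delta phi F G0 j.
Proof.
  intros Hj; destruct (facet_ends phi G0 F phi_anis HF j Hj) as (_ & _ & HL & _).
  assert (HS := supp_pos phi G0 F phi_anis HF j Hj).
  unfold delta; change (real (H1 (F j))) with (flen (F j)).
  change (dual phi (normal (edge_of G0 j))) with (supp phi G0 j).
  apply Rmult_lt_0_compat; [now apply pow_lt|easy].
Qed.

(** The gradient-flow form of the law: [supp] - alpha [w] is the derivative of the energy in the
    lengths, and [op_supp] has turned the curvature term into [op] of [supp]. *)
Lemma v_energy t i : (i < n)%nat -> 0 < t < T ->
  op G0 (supp phi G0) i - alpha * op G0 (w t) i = v t i * L t i / supp phi G0 i.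
Proof.
  intros Hi Ht; assert (Hs := closed_seg G0 i G0_closed Hi).
  assert (HO := op_supp phi G0 F phi_anis HG0 HF i Hs).
  assert (HL := L_pos t i Hi ltac:(lra)); assert (HS := supp_pos phi G0 F phi_anis HF i Hi).
  unfold v, velocity; change (weight phi F G0 (L t)) with (w t); rewrite <- HO; set (a := op G0 (w t) i); field; lra.
Qed.

Definition energy_term (t : R) (i : nat) : R :=
  supp phi G0 i * L t i + alpha * (u i * delta phi F G0 i) * / L t i.

(** By the chain rule the derivative pairs [supp] - alpha [w] with [- op] of the velocities;
    symmetry moves [op] to the first factor, where [v_energy] applies. *)
Lemma energy_derive t : 0 < t < T ->
  is_derive (fun s => rsum n (energy_term s)) t
    (- rsum n (fun i => v t i * (v t i * L t i / supp phi G0 i))).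
Proof.
  intros Ht.
  evar_last.
  - apply (is_derive_rsum n (fun i s => energy_term s i)
      (fun i => (supp phi G0 i - alpha * w t i) * - op G0 (v t) i)).
    intros i Hi; unfold energy_term.
    assert (HD := L_derive t i Hi Ht); assert (HL := L_pos t i Hi ltac:(lra)).
    evar_last; [apply (is_derive_plus (V := R_NormedModule)); apply is_derive_scal;
                [exact HD|apply is_derive_inv; [exact HD|lra]]|].
    unfold w, weight, u, plus; simpl; field; lra.
  - rewrite (rsum_ext n _ (fun i => -1 * ((supp phi G0 i + - alpha * w t i) * op G0 (v t) i)))
      by (intros; ring).
    rewrite rsum_scal, (op_symmetric G0 (fun i => supp phi G0 i + - alpha * w t i)).
    rewrite (rsum_ext n _ (fun i => v t i * (v t i * L t i / supp phi G0 i))); [ring|].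
    intros i Hi; rewrite op_linear, <- v_energy by easy; ring.
Qed.

Lemma energy_bound t : 0 <= t < T -> rsum n (energy_term t) <= rsum n (energy_term 0).
Proof.
  intros Ht.
  assert (H : rsum n (energy_term t) - rsum n (energy_term 0) <= 0 * (t - 0)); [|lra].
  apply (derive_le (fun s => rsum n (energy_term s))
           (fun t => - rsum n (fun i => v t i * (v t i * L t i / supp phi G0 i)))); [lra| |].
  - intros s Hs; apply (continuous_rsum n (fun i s => energy_term s i)); intros i Hi.
    assert (HC := L_continuous s i Hi ltac:(lra)); assert (HL := L_pos s i Hi ltac:(lra)).
    unfold energy_term; apply (continuous_plus (V := R_NormedModule));
      apply (continuous_mult (K := R_AbsRing)); try apply continuous_const; [easy|].
    apply continuous_Rinv_comp; [easy|lra].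
  - intros s Hs; split; [apply energy_derive; lra|].
    assert (H : 0 <= rsum n (fun i => v s i * (v s i * L s i / supp phi G0 i))); [|lra].
    apply rsum_nonneg; intros i Hi; assert (HL := L_pos s i Hi ltac:(lra)).
    assert (HS := supp_pos phi G0 F phi_anis HF i Hi).
    replace (v s i * (v s i * L s i / supp phi G0 i)) with (v s i ^ 2 * (L s i / supp phi G0 i))
      by (field; lra).
    apply Rmult_le_pos; [apply pow2_ge_0|left; now apply Rdiv_lt_0_compat].
Qed.

(** All energy terms are nonnegative, so each is bounded by the initial energy: the term in L bounds
    the length above, the term in 1 / L bounds it below when c_i is not 0. *)
Lemma length_bounds : exists Lam m, 0 < Lam /\ 0 < m /\
  forall t i, (i < n)%nat -> 0 <= t < T ->
    L t i <= Lam /\ (transition G0 i <> 0 -> m <= L t i).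
Proof.
  set (E0 := rsum n (energy_term 0) + 1).
  assert (HT1 : forall t i, (i < n)%nat -> 0 <= t < T ->
    0 < supp phi G0 i * L t i /\ 0 <= alpha * (u i * delta phi F G0 i) * / L t i).
  { intros t i Hi Ht; assert (HL := L_pos t i Hi Ht).
    assert (HS := supp_pos phi G0 F phi_anis HF i Hi); assert (HD := delta_nonneg i Hi).
    assert (Hu : 0 <= u i) by apply pow2_ge_0; assert (0 < / L t i) by now apply Rinv_0_lt_compat.
    split; [now apply Rmult_lt_0_compat|].
    apply Rmult_le_pos; [|lra]; apply Rmult_le_pos; [lra|]; apply Rmult_le_pos; lra. }
  assert (HT2 : forall t i, (i < n)%nat -> 0 <= t < T -> energy_term t i < E0).
  { intros t i Hi Ht; unfold E0.
    assert (H := energy_bound t Ht).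
    assert (H' : energy_term t i <= rsum n (energy_term t)); [|lra].
    apply rsum_term; [|easy]; intros j Hj; unfold energy_term.
    destruct (HT1 t j Hj Ht); lra. }
  assert (HE0 : 0 < E0).
  { assert (Hn := n_pos); assert (A := HT2 0 0%nat Hn ltac:(lra)).
    destruct (HT1 0 0%nat Hn ltac:(lra)); unfold energy_term in A; lra. }
  destruct (uniform_bound n (fun i C => forall t, 0 <= t < T -> L t i <= C)) as (Lam & HLam & H1).
  { intros i C C' _ HC H t Ht; specialize (H t Ht); lra. }
  { intros i Hi; exists (E0 / supp phi G0 i); intros t Ht.
    assert (HS := supp_pos phi G0 F phi_anis HF i Hi).
    apply Rle_mult_div; [easy|].
    destruct (HT1 t i Hi Ht); assert (A := HT2 t i Hi Ht); unfold energy_term in A; lra. }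
  (* [uniform_bound] enlarges constants, so the lower bound is stated for the reciprocal length. *)
  destruct (uniform_bound n (fun i C => transition G0 i <> 0 -> forall t, 0 <= t < T -> / L t i <= C))
    as (C & HC & H2).
  { intros i C C' _ HC H Hc t Ht; specialize (H Hc t Ht); lra. }
  { intros i Hi; exists (E0 / (alpha * (u i * delta phi F G0 i))); intros Hc t Ht.
    assert (HD := delta_nonneg i Hi).
    assert (Hu : u i = 1).
    { destruct (transition_sqr G0 i) as [H|H]; [|easy]; exfalso; apply Hc; nra. }
    rewrite Hu, Rmult_1_l in *.
    apply Rle_mult_div; [now apply Rmult_lt_0_compat|].
    destruct (HT1 t i Hi Ht); assert (A := HT2 t i Hi Ht); unfold energy_term in A.
    rewrite Hu, Rmult_1_l in A; lra. }
  exists Lam, (/ C); split; [easy|split; [now apply Rinv_0_lt_compat|]].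
  intros t i Hi Ht; split; [now apply H1|]; intros Hc.
  assert (HL := L_pos t i Hi Ht); rewrite <- (Rinv_inv (L t i)).
  apply Rinv_le_contravar; [now apply Rinv_0_lt_compat|now apply H2].
Qed.

(* All-pairs potential: an edge with transition number 0 moves length from one of its
   neighbours to the other so that the potential decreases at least at the speed of the edge. *)
Definition psi (e t : R) : R :=
  / 2 * rsum n (fun j => rsum n (fun k => u j * u k * root e (L t j - L t k)))
  - (INR n + 1) * rsum n (fun j => u j * L t j).

(** The partial derivative of [psi] with respect to the length of edge j. *)
Definition grad (e t : R) (j : nat) : R :=
  u j * (rsum n (fun k => u k * slope e (L t j - L t k)) - (INR n + 1)).

Lemma psi_derive e t : 0 < e -> 0 < t < T ->
  is_derive (psi e) t (- rsum n (fun i => v t i * op G0 (grad e t) i)).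
Proof.
  intros He Ht.
  set (l := fun j => - op G0 (v t) j).
  set (a := fun j k => u j * u k * slope e (L t j - L t k)).
  assert (HE : - rsum n (fun i => v t i * op G0 (grad e t) i) =
    / 2 * rsum n (fun j => rsum n (fun k => u j * u k * ((l j - l k) * slope e (L t j - L t k))))
    - (INR n + 1) * rsum n (fun j => u j * l j)).
  { rewrite (op_symmetric G0 (v t)).
    (* Since [slope] is odd, [a] is antisymmetric; the two halves of the double sum agree and cancel
       the factor 1/2. *)
    assert (H1 : rsum n (fun j => rsum n (fun k => a j k * l k)) =
                 - rsum n (fun j => rsum n (fun k => a j k * l j))).
    { rewrite rsum_swap, <- (Rmult_1_l (rsum n (fun j => rsum n (fun k => a j k * l j)))).
      rewrite <- Ropp_mult_distr_l_reverse, <- rsum_scal; apply rsum_ext; intros j _.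
      rewrite <- rsum_scal; apply rsum_ext; intros k _; unfold a.
      replace (L t k - L t j) with (- (L t j - L t k)) by ring; rewrite slope_opp; ring. }
    assert (H2 : rsum n (fun j => rsum n (fun k => u j * u k * ((l j - l k) * slope e (L t j - L t k))))
                 = 2 * rsum n (fun j => rsum n (fun k => a j k * l j))).
    { transitivity (rsum n (fun j => rsum n (fun k => a j k * l j)
                                     + -1 * rsum n (fun k => a j k * l k))).
      - apply rsum_ext; intros j _; rewrite <- rsum_scal, <- rsum_plus.
        apply rsum_ext; intros k _; unfold a; ring.
      - rewrite rsum_plus, rsum_scal, H1; ring. }
    rewrite H2.
    transitivity (rsum n (fun j => rsum n (fun k => a j k * l j) + - (INR n + 1) * (u j * l j))).
    - rewrite <- (Rmult_1_l (rsum n _)), <- Ropp_mult_distr_l_reverse, <- rsum_scal.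
      apply rsum_ext; intros j _; unfold grad.
      rewrite (rsum_ext n (fun k => a j k * l j)
                 (fun k => (u j * l j) * (u k * slope e (L t j - L t k))))
        by (intros; unfold a; ring).
      rewrite rsum_scal; unfold l; ring.
    - rewrite rsum_plus, rsum_scal; field. }
  rewrite HE; unfold psi.
  apply (is_derive_minus (V := R_NormedModule)); apply is_derive_scal.
  - apply (is_derive_rsum n (fun j s => rsum n (fun k => u j * u k * root e (L s j - L s k)))).
    intros j Hj; apply (is_derive_rsum n (fun k s => u j * u k * root e (L s j - L s k))).
    intros k Hk; apply is_derive_scal, (is_derive_root e (fun s => L s j - L s k) (l j - l k) t He).
    apply (is_derive_minus (V := R_NormedModule)); now apply L_derive.
  - apply (is_derive_rsum n (fun j s => u j * L s j)); intros j Hj.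
    apply is_derive_scal; now apply L_derive.
Qed.

Lemma psi_continuous e t : 0 < e -> 0 <= t < T -> continuous (psi e) t.
Proof.
  intros He Ht; unfold psi.
  apply (continuous_minus (V := R_NormedModule));
    apply (continuous_mult (K := R_AbsRing)); try apply continuous_const.
  - apply (continuous_rsum n (fun j s => rsum n (fun k => u j * u k * root e (L s j - L s k)))).
    intros j Hj; apply (continuous_rsum n (fun k s => u j * u k * root e (L s j - L s k))).
    intros k Hk; apply (continuous_mult (K := R_AbsRing)); [apply continuous_const|].
    apply continuous_root; [easy|].
    apply (continuous_minus (V := R_NormedModule)); apply L_continuous; easy || lra.
  - apply (continuous_rsum n (fun j s => u j * L s j)); intros j Hj.
    apply (continuous_mult (K := R_AbsRing)); [apply continuous_const|].
    apply L_continuous; easy || lra.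
Qed.

Lemma u_range j : 0 <= u j <= 1.
Proof. destruct (transition_sqr G0 j) as [H|H]; unfold u; rewrite H; lra. Qed.

Lemma psi_smoothing e t : 0 <= e -> psi 0 t <= psi e t <= psi 0 t + INR n * (INR n * e).
Proof.
  intros He; unfold psi.
  set (A := fun e => rsum n (fun j => rsum n (fun k => u j * u k * root e (L t j - L t k)))).
  fold (A 0) (A e).
  assert (HI : 0 <= INR n * (INR n * e)) by (assert (0 <= INR n) by apply pos_INR; nra).
  assert (H0 : forall j k, u j * u k * root 0 (L t j - L t k) <= u j * u k * root e (L t j - L t k)
                           <= u j * u k * root 0 (L t j - L t k) + e).
  { intros j k; destruct (root_bounds 0 (L t j - L t k) ltac:(lra)) as [B0 _].
    destruct (root_bounds e (L t j - L t k) He) as [B1 _].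
    assert (Uj := u_range j); assert (Uk := u_range k); assert (0 <= u j * u k <= 1) by nra.
    split; [apply Rmult_le_compat_l; lra|]; nra. }
  assert (H : A 0 <= A e <= A 0 + INR n * (INR n * e)); [|lra].
  unfold A; split.
  - apply rsum_le; intros j _; apply rsum_le; intros k _; apply H0.
  - rewrite <- (rsum_const n), <- rsum_plus; apply rsum_le; intros j _.
    rewrite <- (rsum_const n), <- rsum_plus; apply rsum_le; intros k _; apply H0.
Qed.

Lemma grad_bound e t j : 0 < e -> Rabs (grad e t j) <= 2 * INR n + 1.
Proof.
  intros He; unfold grad; assert (U := u_range j); rewrite Rabs_mult, (Rabs_pos_eq (u j)) by lra.
  assert (H : Rabs (rsum n (fun k => u k * slope e (L t j - L t k))) <= INR n * 1).
  { eapply Rle_trans; [apply rsum_abs|]; apply rsum_le_const; intros k _.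
    assert (Uk := u_range k); rewrite Rabs_mult, (Rabs_pos_eq (u k)) by lra.
    assert (S := slope_bound e (L t j - L t k) He).
    assert (0 <= Rabs (slope e (L t j - L t k))) by apply Rabs_pos; nra. }
  assert (HI : 0 <= INR n) by apply pos_INR.
  set (S := rsum _ _) in *.
  assert (H' : Rabs (S - (INR n + 1)) <= 2 * INR n + 1).
  { apply Rabs_le_between in H; apply Rabs_le; lra. }
  assert (0 <= Rabs (S - (INR n + 1))) by apply Rabs_pos; nra.
Qed.

(** The slopes sum to at most n; this is where the coefficient n + 1 of [psi] comes from. *)
Lemma grad_neg e t j : 0 < e -> u j = 1 -> grad e t j <= -1.
Proof.
  intros He Hu; unfold grad; rewrite Hu, Rmult_1_l.
  assert (H : rsum n (fun k => u k * slope e (L t j - L t k)) <= INR n * 1); [|lra].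
  apply rsum_le_const; intros k _; assert (Uk := u_range k).
  assert (S := slope_bound e (L t j - L t k) He); apply Rabs_le_between in S; nra.
Qed.

(** By monotonicity of [slope], every k contributes a nonnegative amount to the difference, and k =
    q contributes the left side. This is the gain from summing over all pairs. *)
Lemma grad_diff e t p q : 0 < e -> (q < n)%nat -> u p = 1 -> u q = 1 -> L t q <= L t p ->
  slope e (L t p - L t q) <= grad e t p - grad e t q.
Proof.
  intros He Hq Up Uq HL; unfold grad; rewrite Up, Uq.
  set (f := fun k => u k * slope e (L t p - L t k) + -1 * (u k * slope e (L t q - L t k))).
  replace (1 * _ - _) with (rsum n f)
    by (unfold f; rewrite rsum_plus, rsum_scal; ring).
  replace (slope e (L t p - L t q)) with (f q)
    by (unfold f; rewrite Uq, Rminus_diag, slope_0; ring).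
  apply rsum_term; [|easy]; intros k _; unfold f.
  assert (Uk := u_range k).
  assert (S := slope_mono e (L t q - L t k) (L t p - L t k) He ltac:(lra)); nra.
Qed.

(** Makes the weights of two curved neighbours equal when their lengths are, so that their
    difference has the sign opposite to that of the lengths. *)
Lemma delta_neighbours i : (i < n)%nat -> transition G0 i = 0 ->
  delta phi F G0 (prev G0 i) = delta phi F G0 (next G0 i).
Proof.
  intros Hi HT; assert (Hs := closed_seg G0 i G0_closed Hi).
  assert (E := transition_0_tau phi G0 F phi_anis HG0 HF i Hs HT).
  assert (Hp := prev_lt G0 i n_pos); assert (Hq := next_lt G0 i n_pos).
  destruct (proj1 HF _ Hp) as [F1 N1]; destruct (proj1 HF _ Hq) as [F2 N2].
  unfold delta, normal; fold (tau G0 (prev G0 i)) (tau G0 (next G0 i)); rewrite E.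
  do 2 f_equal; apply (facet_same_length phi); try easy.
  rewrite <- N1, <- N2; unfold normal; fold (tau G0 (prev G0 i)) (tau G0 (next G0 i)); now rewrite E.
Qed.

(** Up to a positive factor, the left side is the contribution of edge i to the derivative of [psi],
    and the first term on the right is minus its speed. *)
Lemma pair_dissipation i : (i < n)%nat -> transition G0 i = 0 ->
  exists A, 0 <= A /\ forall e t, 0 < e -> 0 <= t < T ->
    (w t (prev G0 i) - w t (next G0 i)) * (grad e t (prev G0 i) - grad e t (next G0 i))
    <= - Rabs (w t (prev G0 i) - w t (next G0 i)) + A * e.
Proof.
  intros Hi HT; destruct length_bounds as (Lam & m & HLam & Hm & HB).
  assert (HD := delta_neighbours i Hi HT).
  assert (Hp := prev_lt G0 i n_pos); assert (Hq := next_lt G0 i n_pos).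
  set (p := prev G0 i) in *; set (q := next G0 i) in *.
  assert (Dp := delta_nonneg p Hp); assert (Dq := delta_nonneg q Hq).
  set (A := delta phi F G0 p * (2 * Lam) / m ^ 4).
  assert (HA : 0 <= A).
  { unfold A; apply Rmult_le_pos; [nra|left; apply Rinv_0_lt_compat; now apply pow_lt]. }
  exists A; split; [easy|]; intros e t He Ht.
  assert (Hw0 : forall j, u j = 0 -> w t j = 0).
  { intros j Hj; unfold w, weight; fold (u j); rewrite Hj; unfold Rdiv; ring. }
  assert (Hg0 : forall j, u j = 0 -> grad e t j = 0) by (intros j Hj; unfold grad; rewrite Hj; ring).
  assert (Hw1 : forall j, (j < n)%nat -> u j = 1 -> w t j = delta phi F G0 j / L t j ^ 2 /\ 0 <= w t j
                          /\ m <= L t j <= Lam).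
  { intros j Hj Hu; assert (HLj := L_pos t j Hj Ht).
    assert (E : w t j = delta phi F G0 j / L t j ^ 2)
      by (unfold w, weight; fold (u j); rewrite Hu; unfold Rdiv; ring).
    split; [easy|split; [rewrite E; left; apply Rdiv_lt_0_compat; [now apply delta_nonneg|now apply pow_lt]|]].
    destruct (HB t j Hj Ht) as [B1 B2]; split; [|easy]; apply B2.
    intros Hc; unfold u in Hu; rewrite Hc in Hu; simpl in Hu; lra. }
  assert (HAe : 0 <= A * e) by nra.
  (* A neighbour with c = 0 has zero weight and zero gradient. If just one is curved, [grad_neg]
     suffices; if both are, the ordering of the gradients is used. *)
  destruct (transition_sqr G0 p) as [Up|Up]; destruct (transition_sqr G0 q) as [Uq|Uq];
    fold (u p) in Up; fold (u q) in Uq.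
  - rewrite (Hw0 p), (Hw0 q), Rminus_diag, Rabs_R0 by easy; lra.
  - destruct (Hw1 q Hq Uq) as (_ & W & _); assert (N := grad_neg e t q He Uq).
    rewrite (Hw0 p), (Hg0 p), !Rminus_0_l, Rabs_Ropp, Rabs_pos_eq by easy; nra.
  - destruct (Hw1 p Hp Up) as (_ & W & _); assert (N := grad_neg e t p He Up).
    rewrite (Hw0 q), (Hg0 q), !Rminus_0_r, Rabs_pos_eq by easy; nra.
  - destruct (Hw1 p Hp Up) as (-> & _ & Bp); destruct (Hw1 q Hq Uq) as (-> & _ & Bq).
    unfold A; rewrite <- HD; apply weight_slope_bound; try easy.
    + intros H; now apply grad_diff.
    + intros H; now apply grad_diff.
Qed.

Lemma weight_bound : exists W, 0 < W /\ forall t j, (j < n)%nat -> 0 <= t < T -> Rabs (w t j) <= W.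
Proof.
  destruct length_bounds as (Lam & m & HLam & Hm & HB).
  destruct (uniform_bound n (fun j C => forall t, 0 <= t < T -> Rabs (w t j) <= C)) as (W & HW & H).
  - intros i C C' _ HC H t Ht; specialize (H t Ht); lra.
  - intros j Hj; exists (delta phi F G0 j / m ^ 2); intros t Ht.
    assert (HD := delta_nonneg j Hj); assert (HLj := L_pos t j Hj Ht).
    assert (Hi : 0 < / m ^ 2) by (apply Rinv_0_lt_compat; nra).
    unfold w, weight; fold (u j).
    destruct (transition_sqr G0 j) as [U|U]; fold (u j) in U; rewrite U.
    + unfold Rdiv; rewrite !Rmult_0_l, Rabs_R0; apply Rmult_le_pos; lra.
    + destruct (HB t j Hj Ht) as [_ B].
      assert (Bm : m <= L t j)
        by (apply B; intros Hc; unfold u in U; rewrite Hc in U; simpl in U; lra).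
      rewrite Rmult_1_l, Rabs_pos_eq by (left; apply Rdiv_lt_0_compat; [easy|now apply pow_lt]).
      apply Rmult_le_compat_l; [lra|apply Rinv_le_contravar; nra].
  - exists W; split; [easy|]; intros; now apply H.
Qed.

(** The weights are bounded and, since c_i is not 0, the length in the denominator stays above a
    positive constant. *)
Lemma speed_bound i : (i < n)%nat -> transition G0 i <> 0 ->
  exists V, 0 < V /\ forall t, 0 <= t < T -> Rabs (v t i) <= V.
Proof.
  intros Hi Hc; destruct length_bounds as (Lam & m & HLam & Hm & HB).
  destruct weight_bound as (W & HW & HWb); destruct (op_bound G0) as (K & HK & HO).
  assert (HS := supp_pos phi G0 F phi_anis HF i Hi).
  set (c := transition G0 i * flen (F i)).
  assert (Hc0 := Rabs_pos c).
  exists (supp phi G0 i * (Rabs c + alpha * (K * W)) / m + 1).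
  assert (HP : 0 <= supp phi G0 i * (Rabs c + alpha * (K * W))).
  { apply Rmult_le_pos; [lra|]; assert (0 <= K * W) by nra; nra. }
  assert (Him : 0 < / m) by now apply Rinv_0_lt_compat.
  split; [assert (0 <= supp phi G0 i * (Rabs c + alpha * (K * W)) / m) by (apply Rmult_le_pos; lra); lra|].
  intros t Ht; assert (HLi := L_pos t i Hi Ht).
  assert (HOi := HO (w t) W i Hi ltac:(lra) (fun j Hj => HWb t j Hj Ht)).
  assert (HmL : m <= L t i) by now apply HB.
  unfold v, velocity; fold c; change (weight phi F G0 (L t)) with (w t).
  set (o := op G0 (w t) i) in *.
  unfold Rdiv; rewrite !Rabs_mult, (Rabs_pos_eq (supp phi G0 i)), (Rabs_pos_eq (/ L t i))
    by (lra || (left; now apply Rinv_0_lt_compat)).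
  assert (HA : Rabs (- c - alpha * o) <= Rabs c + alpha * (K * W)).
  { unfold Rminus; eapply Rle_trans; [apply Rabs_triang|]; rewrite !Rabs_Ropp, Rabs_mult, (Rabs_pos_eq alpha) by lra.
    apply Rplus_le_compat_l, Rmult_le_compat_l; lra. }
  assert (HL : / L t i <= / m) by now apply Rinv_le_contravar.
  assert (supp phi G0 i * Rabs (- c - alpha * o) * / L t i
          <= supp phi G0 i * (Rabs c + alpha * (K * W)) * / m); [|lra].
  apply Rmult_le_compat; [|left; now apply Rinv_0_lt_compat| |easy].
  - apply Rmult_le_pos; [lra|apply Rabs_pos].
  - apply Rmult_le_compat_l; lra.
Qed.

(** The neighbours have the same tangent, so the turns at the two ends are opposite. It is applied
    to both the weights and the gradient of the potential. *)
Lemma op_opposite_turns a i : (i < n)%nat -> transition G0 i = 0 -> a i = 0 ->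
  op G0 a i = (a (prev G0 i) - a (next G0 i)) / turn G0 i.
Proof.
  intros Hi HT Ha; assert (Hs := closed_seg G0 i G0_closed Hi).
  assert (E := transition_0_tau phi G0 F phi_anis HG0 HF i Hs HT).
  assert (HN : turn G0 (next G0 i) = - turn G0 i).
  { unfold turn; rewrite prev_next, E by easy; apply cross_anti. }
  assert (HD : turn G0 i <> 0) by (apply turn_neq_0; [easy|now apply seg_edge]).
  unfold op; rewrite Ha, HN; field; easy.
Qed.

Lemma turn_bound i : (i < n)%nat -> Rabs (turn G0 i) <= 1.
Proof.
  intros Hi; assert (Hp := prev_lt G0 i n_pos).
  assert (HL := lagrange (tau G0 (prev G0 i)) (tau G0 i)).
  rewrite !tau_unit, Rmult_1_r in HL by easy; fold (turn G0 i) in HL.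
  assert (0 <= dot (tau G0 (prev G0 i)) (tau G0 i) ^ 2) by apply pow2_ge_0.
  apply Rabs_le; nra.
Qed.

(** For c_i = 0 the velocity carries a factor 1 / L_i with no uniform bound, which multiplies the
    smoothing error; for the other edges both terms on the left are bounded. [C] depends neither on
    e nor on t. *)
Lemma edge_dissipation : exists C, 0 < C /\ forall i, (i < n)%nat ->
  forall e t, 0 < e -> 0 < t < T ->
    - (v t i * op G0 (grad e t) i) + Rabs (v t i) <= C * (1 + e / L t i).
Proof.
  apply (uniform_bound n (fun i C => forall e t, 0 < e -> 0 < t < T ->
    - (v t i * op G0 (grad e t) i) + Rabs (v t i) <= C * (1 + e / L t i))).
  { intros i C C' Hi HC H e t He Ht; eapply Rle_trans; [now apply H|].
    apply Rmult_le_compat_r; [|easy].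
    assert (0 < e / L t i) by (apply Rdiv_lt_0_compat; [easy|apply L_pos; easy || lra]); lra. }
  intros i Hi; destruct (Req_dec (transition G0 i) 0) as [Hc|Hc].
  - destruct (pair_dissipation i Hi Hc) as (A & HA & HP).
    assert (HS := supp_pos phi G0 F phi_anis HF i Hi).
    assert (HD : turn G0 i <> 0)
      by (apply turn_neq_0; [easy|apply seg_edge; [easy|now apply closed_seg]]).
    assert (HDb := turn_bound i Hi); assert (HDp := Rabs_pos_lt _ HD).
    set (D := turn G0 i) in *.
    assert (HDi : 0 < / D ^ 2) by (apply Rinv_0_lt_compat; rewrite <- pow2_abs; nra).
    exists (supp phi G0 i * alpha * / D ^ 2 * A); intros e t He Ht.
    assert (HLi := L_pos t i Hi ltac:(lra)).
    specialize (HP e t He ltac:(lra)).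
    set (dw := w t (prev G0 i) - w t (next G0 i)) in *.
    set (dg := grad e t (prev G0 i) - grad e t (next G0 i)) in *.
    assert (Hg : op G0 (grad e t) i = dg / D)
      by (apply op_opposite_turns; [easy|easy|unfold grad, u; rewrite Hc; ring]).
    assert (Hw : op G0 (w t) i = dw / D)
      by (apply op_opposite_turns; [easy|easy|unfold w, weight; rewrite Hc; unfold Rdiv; ring]).
    set (k := supp phi G0 i * alpha * / L t i).
    assert (HiL : 0 < / L t i) by now apply Rinv_0_lt_compat.
    assert (Hk : 0 < k) by (unfold k; apply Rmult_lt_0_compat; [now apply Rmult_lt_0_compat|easy]).
    assert (Hv : v t i = - (k * (dw / D))).
    { unfold v, velocity; change (weight phi F G0 (L t)) with (w t).
      rewrite Hw, Hc; unfold k; field; lra. }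
    assert (HvA : Rabs (v t i) = k * (Rabs dw * / Rabs D)).
    { rewrite Hv, Rabs_Ropp, Rabs_mult, (Rabs_pos_eq k), Rabs_div by lra; easy. }
    (* The speed contains 1 / |D| and the gain 1 / D^2; they compare because |D| <= 1. *)
    assert (H1 : / Rabs D <= / D ^ 2).
    { rewrite <- pow2_abs; apply Rinv_le_contravar; [|]; nra. }
    assert (Hdw := Rabs_pos dw).
    assert (H2 : k * (Rabs dw * / Rabs D) <= k * (Rabs dw * / D ^ 2))
      by (apply Rmult_le_compat_l; [lra|]; now apply Rmult_le_compat_l).
    assert (H3 : k * / D ^ 2 * (dw * dg) <= k * / D ^ 2 * (- Rabs dw + A * e))
      by (apply Rmult_le_compat_l; [apply Rmult_le_pos; lra|easy]).
    rewrite HvA, Hg, Hv.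
    replace (- (- (k * (dw / D)) * (dg / D))) with (k * / D ^ 2 * (dw * dg)) by (field; easy).
    replace (supp phi G0 i * alpha * / D ^ 2 * A * (1 + e / L t i))
      with (supp phi G0 i * alpha * / D ^ 2 * A + k * / D ^ 2 * (A * e)) by (unfold k; field; lra).
    assert (0 <= supp phi G0 i * alpha * / D ^ 2 * A).
    { apply Rmult_le_pos; [|easy]; apply Rmult_le_pos; [|lra]; nra. }
    lra.
  - destruct (speed_bound i Hi Hc) as (V & HV & Hv); destruct (op_bound G0) as (K & HK & HO).
    assert (HI : 0 <= INR n) by apply pos_INR.
    exists (V * (K * (2 * INR n + 1)) + V); intros e t He Ht.
    assert (HLi := L_pos t i Hi ltac:(lra)); assert (HeL : 0 < e / L t i) by now apply Rdiv_lt_0_compat.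
    assert (HOi := HO (grad e t) (2 * INR n + 1) i Hi ltac:(lra) (fun j _ => grad_bound e t j He)).
    specialize (Hv t ltac:(lra)).
    assert (H1 : - (v t i * op G0 (grad e t) i) <= V * (K * (2 * INR n + 1))).
    { eapply Rle_trans; [apply Rle_abs|]; rewrite Rabs_Ropp, Rabs_mult.
      apply Rmult_le_compat; [apply Rabs_pos|apply Rabs_pos|easy|easy]. }
    assert (0 <= V * (K * (2 * INR n + 1))) by (apply Rmult_le_pos; [lra|]; apply Rmult_le_pos; lra).
    nra.
Qed.

(** On [s, b] the lengths have a positive lower bound m, so the error e / m can be sent to 0 there,
    while the final constant does not involve m. *)
Lemma increment_bound : exists C, 0 < C /\ forall i s b, (i < n)%nat -> 0 <= s <= b -> b < T ->
  Rabs (x b i - x s i) <= (C * b - psi 0 b) - (C * s - psi 0 s).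
Proof.
  destruct edge_dissipation as (C & HC & HD).
  assert (HI : 0 < INR n) by (apply lt_0_INR, n_pos).
  exists (INR n * C); split; [nra|]; intros i s b Hi Hs Hb.
  destruct (solution_min_len phi alpha F G0 T x b Hx ltac:(lra) Hb) as (m & Hm & HM).
  assert (Hsum : forall e t, 0 < e -> 0 < t <= b ->
    - rsum n (fun j => v t j * op G0 (grad e t) j) + Rabs (v t i) <= INR n * (C * (1 + e / m))).
  { intros e t He Ht.
    apply Rle_trans with (rsum n (fun j => - (v t j * op G0 (grad e t) j) + Rabs (v t j))).
    - rewrite rsum_plus; apply Rplus_le_compat.
      + rewrite (rsum_ext n (fun j => - (v t j * op G0 (grad e t) j))
                   (fun j => -1 * (v t j * op G0 (grad e t) j))) by (intros; ring).
        rewrite rsum_scal; lra.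
      + apply (rsum_term n (fun j => Rabs (v t j))); [intros; apply Rabs_pos|easy].
    - apply rsum_le_const; intros j Hj; eapply Rle_trans; [apply HD; [easy|easy|lra]|].
      apply Rmult_le_compat_l; [lra|]; apply Rplus_le_compat_l, Rmult_le_compat_l; [lra|].
      apply Rinv_le_contravar; [easy|]; apply HM; [now apply closed_seg|lra]. }
  assert (Hstep : forall g g' : R -> R, (forall t, 0 <= t < T -> continuous g t) ->
    (forall t, 0 < t < T -> is_derive g t (g' t) /\ g' t <= Rabs (v t i)) ->
    g b - g s + psi 0 b - psi 0 s <= INR n * C * (b - s)).
  { intros g g' Hg Hg'; apply Rnot_lt_le; intros Hlt.
    set (d := g b - g s + psi 0 b - psi 0 s - INR n * C * (b - s)) in *.
    assert (Hd : 0 < d) by (unfold d; lra).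
    set (Q := INR n * C * / m * (b - s) + INR n * INR n).
    assert (Him : 0 < / m) by now apply Rinv_0_lt_compat.
    assert (HQ : 0 < Q).
    { unfold Q; assert (0 <= INR n * C * / m * (b - s)) by (apply Rmult_le_pos; [apply Rmult_le_pos|]; nra); nra. }
    set (e := d / (2 * Q)); assert (He : 0 < e) by (apply Rdiv_lt_0_compat; lra).
    assert (HH : (g b + psi e b) - (g s + psi e s) <= INR n * (C * (1 + e / m)) * (b - s)).
    { apply (derive_le (fun t => g t + psi e t)
              (fun t => g' t + - rsum n (fun j => v t j * op G0 (grad e t) j))); [lra| |].
      - intros t Ht; apply (continuous_plus (V := R_NormedModule));
          [apply Hg|apply psi_continuous]; easy || lra.
      - intros t Ht; destruct (Hg' t ltac:(lra)) as [G1 G2]; split.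
        + apply (is_derive_plus (V := R_NormedModule)); [easy|apply psi_derive; easy || lra].
        + assert (A := Hsum e t He ltac:(lra)); lra. }
    assert (P1 := psi_smoothing e b ltac:(lra)); assert (P2 := psi_smoothing e s ltac:(lra)).
    assert (E : e * Q = d / 2) by (unfold e; field; lra).
    assert (E' : INR n * (C * (1 + e / m)) * (b - s) + INR n * (INR n * e) = INR n * C * (b - s) + e * Q)
      by (unfold Q; field; lra).
    unfold d in *; lra. }
  apply Rabs_le; split.
  - assert (A := Hstep (fun t => - x t i) (fun t => - v t i)).
    assert (- x b i - - x s i + psi 0 b - psi 0 s <= INR n * C * (b - s)); [apply A|lra].
    + intros t Ht; apply (continuous_opp (V := R_NormedModule)), x_continuous; easy || lra.
    + intros t Ht; split; [apply (is_derive_opp (V := R_NormedModule)); now apply x_derive|].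
      rewrite <- Rabs_Ropp; apply Rle_abs.
  - assert (A := Hstep (fun t => x t i) (fun t => v t i)).
    assert (x b i - x s i + psi 0 b - psi 0 s <= INR n * C * (b - s)); [apply A|lra].
    + intros t Ht; apply x_continuous; easy || lra.
    + intros t Ht; split; [now apply x_derive|apply Rle_abs].
Qed.

Lemma psi_lower : exists M, forall t, 0 <= t < T -> - M <= psi 0 t.
Proof.
  destruct length_bounds as (Lam & m & HLam & Hm & HB).
  assert (HI : 0 <= INR n) by apply pos_INR.
  exists ((INR n + 1) * (INR n * Lam)); intros t Ht; unfold psi.
  assert (H1 : 0 <= rsum n (fun j => rsum n (fun k => u j * u k * root 0 (L t j - L t k)))).
  { apply rsum_nonneg; intros j _; apply rsum_nonneg; intros k _.
    assert (Uj := u_range j); assert (Uk := u_range k).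
    apply Rmult_le_pos; [apply Rmult_le_pos; lra|apply sqrt_pos]. }
  assert (H2 : rsum n (fun j => u j * L t j) <= INR n * Lam).
  { apply rsum_le_const; intros j Hj; assert (Uj := u_range j).
    destruct (HB t j Hj Ht) as [H _]; assert (HLj := L_pos t j Hj Ht); nra. }
  assert (H3 : (INR n + 1) * rsum n (fun j => u j * L t j) <= (INR n + 1) * (INR n * Lam))
    by (apply Rmult_le_compat_l; lra).
  lra.
Qed.

(** The increments of the bounded function [P] dominate those of the levels, which therefore have
    finite variation. *)
Lemma levels_controlled : exists P M, (forall t, 0 <= t < T -> P t <= M) /\
  forall i s b, (i < n)%nat -> 0 <= s <= b -> b < T -> Rabs (x b i - x s i) <= P b - P s.
Proof.
  destruct increment_bound as (C & HC & H); destruct psi_lower as (M & HM).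
  exists (fun t => C * t - psi 0 t), (C * T + M); split; [|exact H].
  intros t Ht; specialize (HM t Ht); nra.
Qed.

End Closed.

(** * Limits at the final time *)

Definition tends (f : R -> R) (T l : R) : Prop :=
  forall eps, 0 < eps -> exists t0, 0 <= t0 < T /\ forall t, t0 <= t < T -> Rabs (f t - l) < eps.

Lemma monotone_tends (f : R -> R) (T M : R) : 0 < T ->
  (forall s b, 0 <= s <= b -> b < T -> f s <= f b) -> (forall t, 0 <= t < T -> f t <= M) ->
  exists l, tends f T l.
Proof.
  intros HT Hm HM.
  destruct (completeness (fun y => exists t, 0 <= t < T /\ y = f t)) as [l [Hl1 Hl2]].
  - exists M; intros y (t & Ht & ->); now apply HM.
  - exists (f 0), 0; split; [lra|easy].
  - exists l; intros eps Heps.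
    destruct (classic (exists t0, 0 <= t0 < T /\ l - eps < f t0)) as [(t0 & H0 & H1)|Hn].
    + exists t0; split; [easy|]; intros t Ht.
      assert (A := Hl1 (f t) (ex_intro _ t (conj (conj (Rle_trans _ _ _ (proj1 H0) (proj1 Ht)) (proj2 Ht)) eq_refl))).
      assert (B := Hm t0 t ltac:(lra) ltac:(lra)); apply Rabs_def1; lra.
    + exfalso; assert (A : l <= l - eps); [|lra].
      apply Hl2; intros y (t & Ht & ->); apply Rnot_lt_le; intros H; apply Hn; now exists t.
Qed.

(** Both [P] and [f + P] are nondecreasing and bounded above, and f is their difference. *)
Lemma controlled_tends (f P : R -> R) (T M : R) : 0 < T ->
  (forall t, 0 <= t < T -> P t <= M) ->
  (forall s b, 0 <= s <= b -> b < T -> Rabs (f b - f s) <= P b - P s) ->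
  exists l, tends f T l.
Proof.
  intros HT HM H.
  assert (H' : forall s b, 0 <= s <= b -> b < T -> - (P b - P s) <= f b - f s <= P b - P s)
    by (intros s b Hs Hb; apply Rabs_le_between; now apply H).
  destruct (monotone_tends P T M HT) as (p & Hp); [|easy|].
  { intros s b Hs Hb; specialize (H' s b Hs Hb); lra. }
  destruct (monotone_tends (fun t => f t + P t) T (f 0 + (M - P 0) + M) HT) as (q & Hq).
  { intros s b Hs Hb; specialize (H' s b Hs Hb); lra. }
  { intros t Ht; specialize (H' 0 t ltac:(lra) ltac:(lra)); specialize (HM t Ht); lra. }
  exists (q - p); intros eps Heps.
  destruct (Hp (eps / 2) ltac:(lra)) as (t1 & H1 & A1).
  destruct (Hq (eps / 2) ltac:(lra)) as (t2 & H2 & A2).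
  exists (Rmax t1 t2); split; [unfold Rmax; destruct Rle_dec; lra|]; intros t Ht.
  assert (B1 := Rmax_l t1 t2); assert (B2 := Rmax_r t1 t2).
  specialize (A1 t ltac:(lra)); specialize (A2 t ltac:(lra)).
  apply Rabs_def2 in A1; apply Rabs_def2 in A2; apply Rabs_def1; lra.
Qed.

Lemma tends_all n (f : R -> nat -> R) (T : R) (l : nat -> R) : 0 < T ->
  (forall i, (i < n)%nat -> tends (fun t => f t i) T (l i)) ->
  forall eps, 0 < eps -> exists t0, 0 <= t0 < T /\
    forall t, t0 <= t < T -> forall i, (i < n)%nat -> Rabs (f t i - l i) < eps.
Proof.
  intros HT H eps Heps; induction n as [|n IH]; [exists 0; split; [lra|lia]|].
  destruct IH as (t1 & H1 & A1); [intros; apply H; lia|].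
  destruct (H n ltac:(lia) eps Heps) as (t2 & H2 & A2).
  exists (Rmax t1 t2); split; [unfold Rmax; destruct Rle_dec; lra|]; intros t Ht i Hi.
  assert (B1 := Rmax_l t1 t2); assert (B2 := Rmax_r t1 t2).
  destruct (Nat.eq_dec i n) as [->|Hin]; [apply A2; lra|apply A1; [lra|lia]].
Qed.

Lemma tends_len G x T X : 0 < T ->
  (forall i, (i < nb_edges G)%nat -> tends (fun t => x t i) T (X i)) ->
  forall i, (i < nb_edges G)%nat -> tends (fun t => len G (x t) i) T (len G X i).
Proof.
  intros HT H i Hi eps Heps; destruct (op_bound G) as (K & HK & HO).
  destruct (tends_all (nb_edges G) x T X HT H (eps / (K + 1))) as (t0 & H0 & A);
    [apply Rdiv_lt_0_compat; lra|].
  exists t0; split; [easy|]; intros t Ht; specialize (A t Ht).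
  assert (HE : 0 < eps / (K + 1)) by (apply Rdiv_lt_0_compat; lra).
  assert (B := HO (fun j => x t j + -1 * X j) (eps / (K + 1)) i Hi ltac:(lra)).
  rewrite op_linear in B; unfold len.
  replace (- op G (x t) i - - op G X i) with (- (op G (x t) i + -1 * op G X i)) by ring.
  rewrite Rabs_Ropp; eapply Rle_lt_trans; [apply B|].
  - intros j Hj; replace (x t j + -1 * X j) with (x t j - X j) by ring; left; now apply A.
  - assert (E : (K + 1) * (eps / (K + 1)) = eps) by (field; lra); lra.
Qed.

(* If no edge vanished, the flow could be continued beyond the maximal time. *)
Lemma vanishing_edge phi alpha F G0 (T : R) X :
  anisotropy phi -> 0 < alpha -> polygonal G0 -> facets_of phi G0 F -> is_closed G0 -> 0 < T ->
  max_time phi alpha F G0 = Finite T ->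
  (forall i, (i < nb_edges G0)%nat -> tends (fun t => max_solution phi alpha F G0 t i) T (X i)) ->
  exists i, (i < nb_edges G0)%nat /\ transition G0 i = 0 /\ len G0 X i = 0.
Proof.
  intros Hphi Halpha HG0 HF HC HT HMT HX.
  set (x := max_solution phi alpha F G0) in *.
  assert (Hx : solution phi alpha F G0 T x)
    by (rewrite <- HMT; now apply max_solution_solution).
  assert (HL := tends_len G0 x T X HT HX).
  destruct (length_bounds phi alpha F G0 Hphi Halpha HG0 HF HC T HT x Hx)
    as (Lam & m & HLam & Hm & HB).
  assert (Hpos : forall t i, (i < nb_edges G0)%nat -> 0 <= t < T -> 0 < len G0 (x t) i)
    by (intros; now apply (L_pos phi alpha F G0 HC T x Hx)).
  apply NNPP; intros Hn.
  (* Limits of positive lengths cannot be negative; a zero limit is excluded by assumption when c_i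
     = 0 and by the energy bound otherwise. *)
  assert (HXpos : forall i, (i < nb_edges G0)%nat -> 0 < len G0 X i).
  { intros i Hi; apply Rnot_le_lt; intros Hle.
    destruct (Req_dec (transition G0 i) 0) as [Hc|Hc].
    - destruct (Req_dec (len G0 X i) 0) as [Hz|Hz]; [apply Hn; now exists i|].
      destruct (HL i Hi (- len G0 X i) ltac:(lra)) as (t0 & H0 & A).
      specialize (A t0 ltac:(lra)); apply Rabs_def2 in A.
      assert (B := Hpos t0 i Hi ltac:(lra)); lra.
    - destruct (HL i Hi m ltac:(lra)) as (t0 & H0 & A).
      specialize (A t0 ltac:(lra)); apply Rabs_def2 in A.
      destruct (HB t0 i Hi ltac:(lra)) as [_ B]; specialize (B Hc); lra. }
  (* A bound on all of [0, T): compactness up to a time t0, and half of the limit length after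
     it. *)
  destruct (uniform_bound (nb_edges G0)
    (fun i C => 0 < C /\ forall t, 0 <= t < T -> / C <= len G0 (x t) i)) as (C & HC0 & HCb).
  { intros i C C' Hi HCC [H1 H2]; split; [lra|]; intros t Ht.
    apply Rle_trans with (/ C); [now apply Rinv_le_contravar|now apply H2]. }
  { intros i Hi.
    destruct (HL i Hi (len G0 X i / 2)) as (t0 & H0 & A); [specialize (HXpos i Hi); lra|].
    destruct (solution_min_len phi alpha F G0 T x t0 Hx ltac:(lra)) as (m1 & Hm1 & M1);
      [simpl; lra|].
    assert (HXi := HXpos i Hi).
    set (mm := Rmin m1 (len G0 X i / 2)).
    assert (Hmm : 0 < mm) by (apply Rmin_glb_lt; lra).
    exists (/ mm); split; [now apply Rinv_0_lt_compat|]; intros t Ht; rewrite Rinv_inv.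
    destruct (Rle_dec t t0) as [Hle|Hle].
    - eapply Rle_trans; [apply Rmin_l|]; apply M1; [now apply closed_seg|lra].
    - eapply Rle_trans; [apply Rmin_r|]; specialize (A t ltac:(lra)); apply Rabs_def2 in A; lra. }
  set (m0 := / C); assert (Hm0 : 0 < m0) by now apply Rinv_0_lt_compat.
  assert (HM0 : forall t i, (i < nb_edges G0)%nat -> 0 <= t < T -> m0 <= len G0 (x t) i)
    by (intros t i Hi Ht; now apply HCb).
  (* Half of the bound leaves the margin needed for the truncation to stay inactive a little beyond
     T. *)
  assert (Hm2 : 0 < m0 / 2) by lra.
  destruct (truncated_exists phi alpha F G0 (m0 / 2) Hm2) as (y & Y0 & Yc & Yd & Yr).
  destruct (truncated_lip phi alpha F G0 (m0 / 2) Hm2) as (K & M & HK & _).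
  assert (Hxy : forall b i, (i < nb_edges G0)%nat -> 0 <= b < T -> x b i = y b i).
  { intros b i Hi Hb.
    destruct (solution_truncated phi alpha F G0 T x (m0 / 2) b Hx) as [Cx Dx]; [simpl; lra| |].
    - intros j t Hj Ht; assert (A := HM0 t j (proj1 Hj) ltac:(lra)); lra.
    - apply (ode_unique (nb_edges G0) (truncated phi alpha F G0 (m0 / 2)) K b x y); [lra| | | |easy].
      + intros j Hj; rewrite Y0; now apply (proj1 Hx).
      + intros j t Hj Ht; split; [now apply Cx|apply Yc].
      + intros j t Hj Ht; split; [now apply Dx|split; [apply Yd; lra|apply HK]]. }
  assert (HLc : forall i, (i < nb_edges G0)%nat -> continuous (fun t => len G0 (y t) i) T)
    by (intros i Hi; apply continuous_len; [easy|intros; apply Yc]).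
  assert (Hnear : forall k, (k <= nb_edges G0)%nat ->
    locally T (fun t => forall i, (i < k)%nat -> m0 / 2 <= len G0 (y t) i)).
  { induction k as [|k IH]; intros Hk; [exists (mkposreal 1 Rlt_0_1); intros; lia|].
    assert (H4 : 0 < m0 / 4) by lra.
    destruct (HLc k ltac:(lia) _ (locally_ball (len G0 (y T) k) (mkposreal _ H4))) as [eta Heta].
    assert (Hball : forall t, Rabs (t - T) < eta -> Rabs (len G0 (y t) k - len G0 (y T) k) < m0 / 4)
      by (intros t Ht; exact (Heta t Ht)).
    assert (Heta0 := cond_pos eta).
    assert (HTk : 3 * m0 / 4 <= len G0 (y T) k).
    (* A time before T and close to it, from which the bound [m0] is transferred to T with a loss of
       at most [m0 / 4]. *)
    { set (t := Rmax 0 (T - eta / 2)).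
      assert (Ht : 0 <= t < T /\ Rabs (t - T) < eta).
      { unfold t, Rmax; destruct Rle_dec; (split; [lra|apply Rabs_def1; lra]). }
      assert (A := Hball t (proj2 Ht)); apply Rabs_def2 in A.
      assert (B := HM0 t k ltac:(lia) (proj1 Ht)).
      unfold len in B; rewrite (op_ext G0 (x t) (y t)) in B
        by (lia || (intros; apply Hxy; easy)).
      unfold len in A; unfold len; lra. }
    assert (HIH := IH ltac:(lia)).
    generalize (filter_and (F := locally T) _ _ HIH (locally_ball T eta)); apply filter_imp.
    intros t [H1 H2] i Hi; destruct (Nat.eq_dec i k) as [->|Hik]; [|apply H1; lia].
    assert (A := Hball t H2); apply Rabs_def2 in A; lra. }
  destruct (Hnear (nb_edges G0) (le_n _)) as [eps Heps].
  assert (Hext : solution phi alpha F G0 (T + eps) y).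
  { apply (truncated_solution phi alpha F G0 (m0 / 2)); try easy.
    intros i t Hs Ht Ht'; simpl in Ht'; destruct (Rlt_dec t T) as [Hlt|Hlt].
    - assert (A := HM0 t i (proj1 Hs) (conj Ht Hlt)); unfold len in *.
      rewrite (op_ext G0 (x t) (y t)) in A by (apply Hs || (intros; apply Hxy; easy)); lra.
    - apply Heps; [|apply Hs].
      change (Rabs (t - T) < eps); apply Rabs_def1; lra. }
  assert (Heps0 := cond_pos eps).
  assert (A : Rbar_le (T + eps) (max_time phi alpha F G0)).
  { apply max_time_lub; split; [lra|now exists y]. }
  rewrite HMT in A; simpl in A; lra.
Qed.

(** * Kuratowski limits of closed polygonal curves *)

Lemma norm_plus_le (a b : pt) : norm (plus a b) <= norm a + norm b.
Proof. apply (norm_triangle (V := prod_NormedModule R_AbsRing R_NormedModule R_NormedModule)). Qed.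

Lemma norm_scal_le (k : R) (a : pt) : norm (scal k a) <= Rabs k * norm a.
Proof. apply (norm_scal (V := prod_NormedModule R_AbsRing R_NormedModule R_NormedModule)). Qed.

Lemma norm_minus_sym (a b : pt) : norm (minus a b) = norm (minus b a).
Proof. rewrite !norm_dot; f_equal; destruct a, b; plane; ring. Qed.

Definition point_at (a b : pt) (s : R) : pt := plus a (scal s (minus b a)).

Lemma point_at_close (a b a' b' : pt) (s r : R) : 0 <= s <= 1 ->
  norm (minus a a') <= r -> norm (minus b b') <= r ->
  norm (minus (point_at a b s) (point_at a' b' s)) <= r.
Proof.
  intros Hs Ha Hb.
  replace (minus (point_at a b s) (point_at a' b' s))
    with (plus (scal (1 - s) (minus a a')) (scal s (minus b b')))
    by (unfold point_at; destruct a, b, a', b'; plane; f_equal; ring).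
  eapply Rle_trans; [apply norm_plus_le|].
  assert (A := norm_scal_le (1 - s) (minus a a')); assert (B := norm_scal_le s (minus b b')).
  rewrite Rabs_pos_eq in A, B by lra.
  assert (A' : (1 - s) * norm (minus a a') <= (1 - s) * r) by (apply Rmult_le_compat_l; lra).
  assert (B' : s * norm (minus b b') <= s * r) by (apply Rmult_le_compat_l; lra).
  lra.
Qed.

Lemma point_at_continuous (a b x : pt) t :
  continuous (fun s => norm (minus (point_at a b s) x)) t.
Proof.
  apply lipschitz_continuous with (L := norm (minus b a)); intros s u.
  assert (H := norm_triangle_inv (V := prod_NormedModule R_AbsRing R_NormedModule R_NormedModule)
                 (minus (point_at a b u) x) (minus (point_at a b s) x)).
  change (Rabs (norm (minus (point_at a b u) x) - norm (minus (point_at a b s) x))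
          <= norm (minus (minus (point_at a b u) x) (minus (point_at a b s) x))) in H.
  eapply Rle_trans; [exact H|].
  replace (minus (minus (point_at a b u) x) (minus (point_at a b s) x))
    with (scal (u - s) (minus b a))
    by (unfold point_at; destruct a, b, x; plane; f_equal; ring).
  rewrite Rmult_comm; apply norm_scal_le.
Qed.

Lemma norm_0_eq (x y : pt) : norm (minus x y) = 0 -> x = y.
Proof. intros H; apply NNPP; intros Hn; assert (A := norm_minus_pos y x (not_eq_sym Hn)); lra. Qed.

Section Kuratowski.

Variable n : nat.
Variable Fl : (R -> Prop) -> Prop.
Context {FF : Filter Fl}.
Hypothesis Fl_proper : ~ Fl (fun _ => False).
Variables a b : R -> nat -> pt.
Variables a0 b0 : nat -> pt.
Variable A : R -> pt -> Prop.
Variable K : pt -> Prop.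
Hypothesis Hcvg : forall eps, 0 < eps -> Fl (fun t => forall i, (i < n)%nat ->
  norm (minus (a t i) (a0 i)) <= eps /\ norm (minus (b t i) (b0 i)) <= eps).
Hypothesis HA : Fl (fun t => forall x, A t x <->
  exists i s, (i < n)%nat /\ 0 <= s <= 1 /\ x = point_at (a t i) (b t i) s).
Hypothesis HK : forall x, K x <->
  exists i s, (i < n)%nat /\ 0 <= s <= 1 /\ x = point_at (a0 i) (b0 i) s.

(** The distance to [x] attains a positive minimum on each of finitely many compact segments. *)
Lemma segments_closed x : ~ K x -> exists d, 0 < d /\ forall y, K y -> d <= norm (minus y x).
Proof.
  intros Hx.
  destruct (positive_min (fun i s => norm (minus (point_at (a0 i) (b0 i) s) x))
              (fun _ => True) 1 n) as (d & Hd & H); [lra| |].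
  - intros i s Hi _ Hs; split; [apply point_at_continuous|].
    assert (HN := pt_norm_nonneg (minus (point_at (a0 i) (b0 i) s) x)).
    destruct (Req_dec (norm (minus (point_at (a0 i) (b0 i) s) x)) 0) as [Hz|Hz]; [|lra].
    exfalso; apply Hx, HK; exists i, s; split; [easy|split; [easy|]].
    symmetry; now apply norm_0_eq.
  - exists d; split; [easy|]; intros y Hy; apply HK in Hy.
    destruct Hy as (i & s & Hi & Hs & ->); now apply H.
Qed.

(** It suffices to go around the inclusions: K in the lower limit, the lower limit in the upper
    limit by properness of the filter, the upper limit in K by closedness. *)
Lemma kuratowski_segments : kuratowski_cvg Fl A K.
Proof.
  assert (HKL : forall x, K x -> lower_limit Fl A x).
  { intros x Hx eps Heps; apply HK in Hx; destruct Hx as (i & s & Hi & Hs & ->).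
    generalize (filter_and _ _ HA (Hcvg (eps / 2) ltac:(lra))); apply filter_imp.
    intros t [H1 H2]; exists (point_at (a t i) (b t i) s); split.
    - apply H1; now exists i, s.
    - destruct (H2 i Hi) as [H3 H4].
      assert (H5 := point_at_close _ _ _ _ s _ Hs H3 H4); lra. }
  assert (HLU : forall x, lower_limit Fl A x -> upper_limit Fl A x).
  { intros x Hx eps Heps Hn; apply Fl_proper.
    generalize (filter_and _ _ (Hx eps Heps) Hn); apply filter_imp; intros t [H1 H2]; tauto. }
  assert (HUK : forall x, upper_limit Fl A x -> K x).
  { intros x Hx; apply NNPP; intros Hn.
    destruct (segments_closed x Hn) as (d & Hd & H).
    apply (Hx (d / 2) ltac:(lra)).
    generalize (filter_and _ _ HA (Hcvg (d / 2) ltac:(lra))); apply filter_imp.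
    intros t [H1 H2] (y & Hy & Hyx); apply H1 in Hy; destruct Hy as (i & s & Hi & Hs & ->).
    destruct (H2 i Hi) as [H3 H4].
    assert (H5 := point_at_close _ _ _ _ s _ Hs H3 H4).
    assert (H6 : d <= norm (minus (point_at (a0 i) (b0 i) s) x))
      by (apply H, HK; now exists i, s).
    assert (H7 := norm_plus_le (minus (point_at (a0 i) (b0 i) s) (point_at (a t i) (b t i) s))
                    (minus (point_at (a t i) (b t i) s) x)).
    rewrite norm_minus_sym in H5.
    replace (plus _ _) with (minus (point_at (a0 i) (b0 i) s) x) in H7.
    - lra.
    - generalize (point_at (a0 i) (b0 i) s), (point_at (a t i) (b t i) s).
      intros [p1 p2] [q1 q2]; destruct x; plane; f_equal; ring. }
  split; intros x; split; auto.
Qed.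

End Kuratowski.

(** The union of the segments at levels [y]; they may be degenerate, as happens at the limit
    levels. *)
Definition trace (G : curve) (y : nat -> R) (p : pt) : Prop :=
  exists i s, (i < nb_edges G)%nat /\ 0 <= s <= 1 /\
    p = point_at (meet_at G y i) (meet_at G y (next G i)) s.

Lemma support_rebuild G y p : polygonal G -> is_closed G -> support (rebuild G y) p <-> trace G y p.
Proof.
  intros HG HC; unfold support, trace; rewrite nb_edges_rebuild.
  assert (HE : forall i, (i < nb_edges G)%nat ->
    edge_of (rebuild G y) i = Seg (meet_at G y i) (meet_at G y (next G i))).
  { intros i Hi; assert (H := rebuild_edge G y HG i Hi).
    assert (Hs := closed_seg G i HC Hi); destruct Hs as [_ Hs].
    now destruct (edge_of G i). }
  split.
  - intros (i & Hi & H); rewrite HE in H by easy; destruct H as (s & Hs & E); now exists i, s.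
  - intros (i & s & Hi & Hs & E); exists i; split; [easy|]; rewrite HE by easy; now exists s.
Qed.

Lemma meet_at_lipschitz G : polygonal G -> is_closed G -> exists K, 0 < K /\
  forall i, (i < nb_edges G)%nat -> forall y y' eps,
    (forall j, (j < nb_edges G)%nat -> Rabs (y j - y' j) <= eps) ->
    norm (minus (meet_at G y i) (meet_at G y' i)) <= K * eps.
Proof.
  intros HG HC; assert (Hn := nb_edges_pos G HG).
  apply (uniform_bound (nb_edges G) (fun i K => forall y y' eps,
    (forall j, (j < nb_edges G)%nat -> Rabs (y j - y' j) <= eps) ->
    norm (minus (meet_at G y i) (meet_at G y' i)) <= K * eps)).
  - intros i K K' Hi HK H y y' eps Hy.
    apply Rle_trans with (K * eps); [exact (H y y' eps Hy)|].
    apply Rmult_le_compat_r; [|easy].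
    apply Rle_trans with (Rabs (y i - y' i)); [apply Rabs_pos|now apply Hy].
  - intros i Hi; exists (2 * / Rabs (turn G i)); intros y y' eps Hy.
    assert (Hp := prev_lt G i Hn).
    assert (HD : turn G i <> 0) by (apply turn_neq_0; [easy|apply seg_edge; [easy|now apply closed_seg]]).
    assert (HI : 0 < / Rabs (turn G i)) by now apply Rinv_0_lt_compat, Rabs_pos_lt.
    assert (H1 := Hy _ Hp); assert (H2 := Hy i Hi).
    set (r := y (prev G i) - y' (prev G i)) in *; set (q := y i - y' i) in *.
    replace (minus (meet_at G y i) (meet_at G y' i))
      with (plus (scal (/ turn G i * r) (tau G i)) (scal (/ turn G i * - q) (tau G (prev G i))))
      by (unfold meet_at, meet, r, q; fold (turn G i);
          destruct (tau G i), (tau G (prev G i)); plane; f_equal; ring).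
    assert (HU : forall j, (j < nb_edges G)%nat -> norm (tau G j) = 1)
      by (intros j Hj; rewrite norm_dot, tau_unit by easy; apply sqrt_1).
    eapply Rle_trans; [apply norm_plus_le|].
    assert (A := norm_scal_le (/ turn G i * r) (tau G i)).
    assert (B := norm_scal_le (/ turn G i * - q) (tau G (prev G i))).
    rewrite HU, Rabs_mult, Rabs_inv, Rmult_1_r in A, B by easy.
    rewrite Rabs_Ropp in B.
    assert (A' : / Rabs (turn G i) * Rabs r <= / Rabs (turn G i) * eps)
      by (apply Rmult_le_compat_l; lra).
    assert (B' : / Rabs (turn G i) * Rabs q <= / Rabs (turn G i) * eps)
      by (apply Rmult_le_compat_l; lra).
    lra.
Qed.

Lemma kuratowski_trace G Fl (y : R -> nat -> R) y0 A (K : pt -> Prop) :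
  polygonal G -> is_closed G -> Filter Fl -> ~ Fl (fun _ => False) ->
  (forall eps, 0 < eps ->
     Fl (fun t => forall j, (j < nb_edges G)%nat -> Rabs (y t j - y0 j) < eps)) ->
  (forall t p, A t p <-> trace G (y t) p) -> (forall p, K p <-> trace G y0 p) ->
  kuratowski_cvg Fl A K.
Proof.
  intros HG HC HFl Hpr Hy HA HK; assert (Hn := nb_edges_pos G HG).
  destruct (meet_at_lipschitz G HG HC) as (L & HL & HLip).
  apply (kuratowski_segments (nb_edges G) Fl Hpr
    (fun t i => meet_at G (y t) i) (fun t i => meet_at G (y t) (next G i))
    (fun i => meet_at G y0 i) (fun i => meet_at G y0 (next G i))); [| |exact HK].
  - intros eps Heps.
    generalize (Hy (eps / L) ltac:(now apply Rdiv_lt_0_compat)); apply filter_imp.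
    intros t Ht i Hi; assert (E : L * (eps / L) = eps) by (field; lra); rewrite <- E.
    split; apply HLip; try easy; try (now apply next_lt); intros j Hj; left; now apply Ht.
  - apply filter_forall; intros t; apply HA.
Qed.

(** Compare with the zero levels, for which every vertex is the origin. *)
Lemma trace_bounded G B : polygonal G -> is_closed G -> exists M, forall y p,
  (forall j, (j < nb_edges G)%nat -> Rabs (y j) <= B) -> trace G y p -> norm p <= M.
Proof.
  intros HG HC; assert (Hn := nb_edges_pos G HG).
  destruct (meet_at_lipschitz G HG HC) as (L & HL & HLip).
  assert (E0 : forall i, meet_at G (fun _ => 0) i = (0, 0)).
  { intros i; unfold meet_at, meet; destruct (tau G i), (tau G (prev G i)); plane; f_equal; ring. }
  exists (L * B); intros y p Hy (i & s & Hi & Hs & ->).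
  assert (H : forall j, (j < nb_edges G)%nat ->
    norm (minus (meet_at G y j) (meet_at G (fun _ => 0) j)) <= L * B)
    by (intros j Hj; apply HLip; [easy|]; intros k Hk; rewrite Rminus_0_r; now apply Hy).
  assert (A := point_at_close _ _ _ _ s _ Hs (H i Hi) (H _ (next_lt G i Hn))).
  rewrite !E0 in A.
  replace (minus _ (point_at (0, 0) (0, 0) s)) with (point_at (meet_at G y i) (meet_at G y (next G i)) s) in A.
  - exact A.
  - unfold point_at; destruct (meet_at G y i), (meet_at G y (next G i)); plane; f_equal; ring.
Qed.

(** * Behaviour of closed flows at the maximal time *)

Lemma at_left_tail (T t0 : R) : t0 < T -> at_left T (fun t => t0 <= t < T).
Proof.
  intros H; unfold at_left, within.
  generalize (open_gt t0 T H); apply filter_imp; intros t H1 H2; lra.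
Qed.

Lemma closed_flow_limit phi alpha F G0 (T : R) :
  anisotropy phi -> 0 < alpha -> polygonal G0 -> facets_of phi G0 F -> is_closed G0 ->
  max_time phi alpha F G0 = Finite T ->
  let x := max_solution phi alpha F G0 in
  let G t := rebuild G0 (x t) in
  (exists K : pt -> Prop,
     kuratowski_cvg (at_left T) (fun t => support (G t)) K /\
     kuratowski_continuous_on (fun t => 0 <= t <= T) (extended G T K) /\
     bounded_set (fun p => exists t, 0 <= t <= T /\ extended G T K t p)) /\
  (exists i : nat, (i < nb_edges G0)%nat /\ transition G0 i = 0 /\
     filterlim (fun t => real (H1 (edge_of (G t) i))) (at_left T) (locally 0)) /\
  (forall i : nat, (i < nb_edges G0)%nat -> transition G0 i <> 0 ->
     exists m : R, 0 < m /\ at_left T (fun t => m <= real (H1 (edge_of (G t) i)))).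
Proof.
  intros Hphi Halpha HG0 HF HC HMT x G.
  assert (HT : 0 < T).
  { assert (A := max_time_pos phi alpha F G0 HG0); rewrite HMT in A; exact A. }
  assert (Hx : solution phi alpha F G0 T x)
    by (rewrite <- HMT; now apply max_solution_solution).
  destruct (levels_controlled phi alpha F G0 Hphi Halpha HG0 HF HC T HT x Hx) as (P & M & HM & HP).
  assert (HX : exists X : nat -> R, forall i, (i < nb_edges G0)%nat -> tends (fun t => x t i) T (X i)).
  { exists (fun i => epsilon (inhabits 0) (fun l => tends (fun t => x t i) T l)); intros i Hi.
    apply epsilon_spec, (controlled_tends _ P T M HT HM); intros; now apply HP. }
  destruct HX as (X & HX).
  assert (Hlen : forall t i, (i < nb_edges G0)%nat -> 0 <= t < T ->
                 real (H1 (edge_of (G t) i)) = len G0 (x t) i).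
  { intros t i Hi Ht.
    destruct (solution_rebuild phi alpha F G0 HG0 T x t Hx (proj1 Ht) (proj2 Ht)) as [HPar HLev].
    unfold G; rewrite (proj1 (parallel_length G0 _ HG0 HPar i (closed_seg G0 i HC Hi))); simpl.
    unfold len; f_equal; now apply op_ext. }
  split; [|split].
  - exists (trace G0 X).
    assert (Hleft : forall eps, 0 < eps -> exists t0, t0 < T /\ forall t, t0 <= t < T ->
              forall j, (j < nb_edges G0)%nat -> Rabs (x t j - X j) < eps).
    { intros eps Heps; destruct (tends_all _ x T X HT HX eps Heps) as (t0 & H0 & A).
      exists t0; split; [lra|exact A]. }
    (* With the limit levels as values from T on, convergence at T and continuity before T become
       one statement about [trace]. *)
    set (y := fun t => if Rlt_dec t T then x t else X).
    assert (Hext : forall t p, extended G T (trace G0 X) t p <-> trace G0 (y t) p).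
    { intros t p; unfold extended, y; destruct (Rlt_dec t T); [|easy].
      now apply support_rebuild. }
    split; [|split].
    + apply (kuratowski_trace G0 (at_left T) x X); try easy.
      * apply at_left_proper_filter.
      * intros Hf; apply filter_ex in Hf; now destruct Hf.
      * intros eps Heps; destruct (Hleft eps Heps) as (t0 & H0 & A).
        generalize (at_left_tail T t0 H0); apply filter_imp; exact A.
      * intros t p; now apply support_rebuild.
    + intros t Ht.
      apply (kuratowski_trace G0 (within (fun t => 0 <= t <= T) (locally t)) y (y t)); try easy.
      * apply within_filter, locally_filter.
      * intros Hf; exact (locally_singleton _ _ Hf Ht).
      * intros eps Heps; unfold within; destruct (Rlt_dec t T) as [Hlt|Hlt].
        -- assert (Hyt : y t = x t) by (unfold y; now destruct (Rlt_dec t T)).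
           rewrite Hyt.
           assert (Hk : forall k, (k <= nb_edges G0)%nat -> locally t (fun s => forall j, (j < k)%nat ->
                          Rabs (x s j - x t j) < eps)).
           { induction k as [|k IH]; intros Hk; [apply filter_forall; lia|].
             assert (HCk := proj1 (proj2 Hx) k ltac:(lia) t Hlt).
             assert (HIH := IH ltac:(lia)).
             assert (HB := HCk _ (locally_ball (x t k) (mkposreal eps Heps))).
             generalize (filter_and (F := locally t) _ _ HIH HB); apply filter_imp.
             intros s [H2 H3] j Hj; destruct (Nat.eq_dec j k) as [->|Hjk]; [exact H3|apply H2; lia]. }
           generalize (filter_and (F := locally t) _ _ (Hk _ (le_n _)) (open_lt T t Hlt)).
           apply filter_imp; intros s [H2 H3] _ j Hj; unfold y.
           destruct (Rlt_dec s T); [now apply H2|easy].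
        -- assert (Et : t = T) by lra; subst t.
           assert (Hyt : y T = X) by (unfold y; destruct (Rlt_dec T T); [lra|easy]).
           rewrite Hyt; destruct (Hleft eps Heps) as (t0 & H0 & A).
           generalize (open_gt t0 T H0); apply filter_imp; intros s H2 H3 j Hj; unfold y.
           destruct (Rlt_dec s T) as [Hs|Hs]; [apply A; [lra|easy]|].
           rewrite Rminus_diag, Rabs_R0; exact Heps.
    (* Initial level plus total variation bounds the levels before T; the extra 1 covers the limit
       levels, which are within 1 of an earlier value. *)
    + set (B0 := rsum (nb_edges G0) (fun j => Rabs (x 0 j)) + (M - P 0) + 1).
      assert (HB : forall t j, (j < nb_edges G0)%nat -> 0 <= t < T -> Rabs (x t j) <= B0 - 1).
      { intros t j Hj Ht.
        assert (A := HP j 0 t Hj ltac:(lra) ltac:(lra)); specialize (HM t Ht).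
        assert (B := rsum_term (nb_edges G0) (fun j => Rabs (x 0 j)) j
                       (fun j _ => Rabs_pos (x 0 j)) Hj).
        assert (C := Rabs_triang (x 0 j) (x t j - x 0 j)).
        replace (x 0 j + (x t j - x 0 j)) with (x t j) in C by ring.
        unfold B0; cbv beta in B; lra. }
      destruct (trace_bounded G0 B0 HG0 HC) as (R0 & HR0).
      exists R0; intros p (t & Ht & Hp); apply Hext in Hp; apply (HR0 (y t)); [|exact Hp].
      intros j Hj; unfold y; destruct (Rlt_dec t T) as [Hlt|Hlt].
      * assert (A := HB t j Hj ltac:(lra)); lra.
      * destruct (Hleft 1 Rlt_0_1) as (t0 & H0 & A).
        set (t1 := Rmax t0 0); assert (Ht1 : t0 <= t1 /\ 0 <= t1 < T).
        { unfold t1; split; [apply Rmax_l|split; [apply Rmax_r|now apply Rmax_lub_lt]]. }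
        specialize (A t1 ltac:(lra) j Hj); specialize (HB t1 j Hj ltac:(lra)).
        apply Rabs_def2 in A; apply Rabs_le_between in HB; apply Rabs_le; lra.
  - destruct (vanishing_edge phi alpha F G0 T X Hphi Halpha HG0 HF HC HT HMT HX) as (i & Hi & Hc & HL).
    exists i; split; [easy|split; [easy|]].
    intros Q [eps HQ].
    destruct (tends_len G0 x T X HT HX i Hi eps (cond_pos eps)) as (t0 & H0 & A).
    change (at_left T (fun t => Q (real (H1 (edge_of (G t) i))))).
    generalize (at_left_tail T t0 (proj2 H0)); apply filter_imp; intros t Ht.
    apply HQ; rewrite Hlen by (easy || lra).
    specialize (A t Ht); rewrite HL in A; exact A.
  - intros i Hi Hc.
    destruct (length_bounds phi alpha F G0 Hphi Halpha HG0 HF HC T HT x Hx) as (Lam & m & _ & Hm & HB).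
    exists m; split; [easy|].
    generalize (at_left_tail T 0 HT); apply filter_imp; intros t Ht.
    rewrite Hlen by easy; now apply HB.
Qed.

Theorem theorem4p1 :
  forall (phi : R * R -> R) (alpha : R) (G0 : curve),
  crystalline phi -> 0 < alpha -> admissible phi G0 ->
  exists (T : Rbar) (G : R -> curve),
    maximal_flow phi alpha G0 T G /\
    (forall s t : R, 0 <= s -> 0 <= t -> Rbar_lt (t + s) T ->
       exists (T' : Rbar) (G' : R -> curve),
         maximal_flow phi alpha (G s) T' G' /\ Rbar_lt t T' /\
         G (t + s) = G' t) /\
    (is_closed G0 -> forall Tmax : R, T = Finite Tmax ->
       (exists K : R * R -> Prop,
          kuratowski_cvg (at_left Tmax) (fun t => support (G t)) K /\
          kuratowski_continuous_on (fun t => 0 <= t <= Tmax) (extended G Tmax K) /\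
          bounded_set (fun x => exists t, 0 <= t <= Tmax /\ extended G Tmax K t x)) /\
       (exists i : nat, (i < nb_edges G0)%nat /\ transition G0 i = 0 /\
          filterlim (fun t => real (H1 (edge_of (G t) i))) (at_left Tmax) (locally 0)) /\
       (forall i : nat, (i < nb_edges G0)%nat -> transition G0 i <> 0 ->
          exists m : R, 0 < m /\
            at_left Tmax (fun t => m <= real (H1 (edge_of (G t) i))))).
Proof.
  intros phi alpha G0 [Hphi _] Halpha [HG0 [F HF]].
  exists (max_time phi alpha F G0), (fun t => rebuild G0 (max_solution phi alpha F G0 t)).
  split; [now apply maximal_flow_exists|split].
  - intros s t Hs Ht HT.
    apply (flow_semigroup phi alpha F G0 (max_time phi alpha F G0)); try easy.
    now apply max_solution_solution.
  - intros HC Tmax HT; exact (closed_flow_limit phi alpha F G0 Tmax Hphi Halpha HG0 HF HC HT).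
Qed.
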